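(* For $\epsilon>0$ let $N_0(\epsilon)$ denote the smallest positive integer $N_0$ with the following property: for every integer $N\ge N_0$ and every subset $A\subset[N]$, writing $|A|=\alpha N$, there is a nonzero integer $d$ such that $A$ contains at least $(\alpha^3-\epsilon)N$ three-term arithmetic progressions with common difference $d$ (i.e. there are at least $(\alpha^3-\epsilon)N$ integers $x$ with $x,x+d,x+2d\in A$). Then there exist absolute constants $c,C>0$ such that for all $0<\epsilon<1/2$, $$\mathrm{tower}(c\log(1/\epsilon))\le N_0(\epsilon)\le \mathrm{tower}(C\log(1/\epsilon)).$$
   Context: $[N]=\{1,\dots,N\}$. $\mathrm{tower}(m)$ denotes an exponential tower of twos of height $m$: $\mathrm{tower}(0)=1$ and $\mathrm{tower}(m+1)=2^{\mathrm{tower}(m)}$ for integers $m\ge 0$; for a real number $x\ge 0$, $\mathrm{tower}(x)$ means $\mathrm{tower}(\lfloor x\rfloor)$. $\log$ is the natural logarithm (the base is immaterial up to changing the constants). That a finite $N_0(\epsilon)$ exists for every $\epsilon>0$ is a theorem of Green. *)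

(* Defs.v *)
From mathcomp Require Import all_boot all_order all_algebra finmap.
From mathcomp Require Import reals exp.

Set Implicit Arguments.
Unset Strict Implicit.
Unset Printing Implicit Defensive.

Import Order.TTheory GRing.Theory Num.Theory.
Local Open Scope ring_scope.

Fixpoint tower (m : nat) : nat :=
  if m is m'.+1 then (2 ^ tower m')%N else 1%N.

(* Num.truncn is the nat-valued floor on nonnegative reals; it is 0 on
   negative ones, where [towerR] is not meant to be used. *)
Definition towerR (R : realType) (x : R) : nat := tower (Num.truncn x).

Definition subset_interval (N : nat) (A : {fset int}) : Prop :=
  forall a : int, a \in A -> 1 <= a <= N%:Z.

(* An integer x with x, x + d, x + 2d in A lies in A, so filtering A loses
   nothing. *)
Definition num_3AP (A : {fset int}) (d : int) : nat :=
  #|` [fset x in A | ((x + d)%R \in A) && ((x + 2 * d)%R \in A)]%fset|.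

Definition density (R : realType) (N : nat) (A : {fset int}) : R :=
  #|` A|%:R / N%:R.

Definition popular_difference_from (R : realType) (eps : R) (N0 : nat) : Prop :=
  forall N : nat, (N0 <= N)%N ->
  forall A : {fset int}, subset_interval N A ->
  exists d : int,
    d != 0 /\ (density R N A ^+ 3 - eps) * N%:R <= (num_3AP A d)%:R.

Definition is_N0 (R : realType) (eps : R) (N0 : nat) : Prop :=
  [/\ (0 < N0)%N,
      popular_difference_from eps N0
    & forall M : nat, (0 < M)%N -> popular_difference_from eps M -> (N0 <= M)%N].

(* Main.v *)
From HB Require Import structures.
Require Import Defs.
From mathcomp Require Import all_boot all_order all_algebra finmap.
From mathcomp Require Import boolp reals sequences exp.
From mathcomp Require Import cyclic separable cyclotomic complex ring lra zify.

(** The upper bound is an energy increment. View [A] as a subset of the cyclic group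
    of odd order [n], let [f] be its indicator and, for a symmetric set [B], let
    [f * B] be the function of averages of [f] over the translates of [B]. The
    energy of [B] is the sum of the cubes of [f * B]; it lies between [n al^3] and
    [n], where [al] is the density of [A]. Given [B0], choose a Bohr set [B1] for
    the frequencies where [f] or the indicator of [B0] is large, and then [B2]
    from [B1] in the same way. The progressions with difference in [B1 + B1] are
    counted almost equally by [f] and by [g = f * B2], since [f - g] has small
    transform ([next_scale], [count3_uniform_ge]). Schur's inequality, applied to
    the three values of [g] along each of these progressions, shows that their
    mean number is at least twice the energy of [B0] minus the energy of [B2]
    ([count3_lower]). If no difference is popular this number is less than
    [n (al^3 - eps)], so that the excess of the energy over [n al^3] doubles from
    [B0] to [B2] and starts at [eps n]. This happens at most about
    [log_2 (1 / eps)] times. Parseval's identity bounds the number of frequencies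
    by a power of the index of the previous set, hence each scale costs a bounded
    number of exponentials.

    The lower bound builds weights for which Schur's inequality is nearly sharp. On
    the cyclic group of order [m], delete one point from a constant weight
    ([level_start]): all nonzero differences then have a density of progressions
    [tau] below the cube of the mean, by about [1 / m^2], while the difference zero
    exceeds it by about [1 / m]. A weight [f] on [G] is raised to [G * 'Z_p] by
    multiplying it over the positions [x] of a set [X] by [weight (xi x * y)], where
    [weight] is a trigonometric polynomial with mean one and few progressions. If
    the frequencies [xi x] satisfy no short linear relation, differences that move
    in [G] keep their density exactly. A difference along the fibers sees the sum
    of cubes of [f], lowered by the progressions missing over [X]; for random [xi]
    this works for all these differences simultaneously as long as [p] is at most
    exponential in [#|X|] ([random_frequencies], [level_lift]). The size of [X]
    needed is proportional to the excess of the sum of cubes, which each stage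
    multiplies by a constant, so that about [ln m] stages are possible and each
    is an exponential in the order of the group ([chain]). Finally a random set
    follows the last weight ([sample_exists]), and since all groups are cyclic,
    with a generator [g], the map sending an integer [x] to [g *~ x] turns it into
    a set of integers ([not_popular]). *)

Set Implicit Arguments.
Unset Strict Implicit.
Unset Printing Implicit Defensive.

Import Order.TTheory GRing.Theory Num.Theory.
Import Normc.
Local Open Scope ring_scope.

(** * Modulus of complex numbers *)

Section ComplexModulus.
Context {R : rcfType}.
Implicit Types z : R[i].

Lemma normc_sqr z : normc z ^+ 2 = complex.Re z ^+ 2 + complex.Im z ^+ 2.
Proof. by case: z => a b /=; rewrite sqr_sqrtr // addr_ge0 // sqr_ge0. Qed.

Lemma normc_ge0 z : 0 <= normc z.
Proof. by case: z => a b; apply: sqrtr_ge0. Qed.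

Lemma Re_le_normc z : complex.Re z <= normc z.
Proof.
apply: le_trans (ler_norm _) _; rewrite -[X in _ <= X]ger0_norm ?normc_ge0 //.
by rewrite -ler_sqr ?nnegrE ?normr_ge0 // !real_normK ?num_real // normc_sqr lerDl sqr_ge0.
Qed.

Lemma normc_le_ReIm z : normc z <= `|complex.Re z| + `|complex.Im z|.
Proof.
rewrite -ler_sqr ?nnegrE ?normc_ge0 ?addr_ge0 ?normr_ge0 // normc_sqr sqrrD.
by rewrite !real_normK ?num_real // -addrA lerD2l lerDr mulrn_wge0 // mulr_ge0.
Qed.

Lemma normc_sum (I : Type) (r : seq I) (P : pred I) (F : I -> R[i]) :
  normc (\sum_(i <- r | P i) F i) <= \sum_(i <- r | P i) normc (F i).
Proof.
elim/big_rec2: _ => [|i x y _ h]; first by rewrite normc0.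
by apply: le_trans (le_normcD _ _) _; rewrite lerD2l.
Qed.

Lemma normc_conj z : ((normc z ^+ 2)%:C = z * conjc z)%C.
Proof. by case: z => a b; rewrite normc_sqr /=; congr (_ +i* _)%C => /=; ring. Qed.

Lemma conjcM z w : conjc (z * w) = conjc z * conjc w.
Proof. exact: rmorphM. Qed.

Lemma conjc_sum (I : Type) (r : seq I) (P : pred I) (F : I -> R[i]) :
  conjc (\sum_(i <- r | P i) F i) = \sum_(i <- r | P i) conjc (F i).
Proof. exact: rmorph_sum. Qed.

Lemma normc_real (x : R) : normc (x%:C)%C = `|x|.
Proof. by rewrite /= expr0n addr0 sqrtr_sqr. Qed.

End ComplexModulus.

(** * Characters and Fourier transform of cyclic groups *)

Section Characters.
Context {R : rcfType}.

(** In characteristic zero [X^n - 1] is separable, so in an algebraically closed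
    field it has [n] distinct roots, and these form a cyclic group. *)
Lemma prim_root_exists (n : nat) :
  (0 < n)%N -> exists w : R[i], n.-primitive_root w.
Proof.
move=> n_gt0; pose p : {poly R[i]} := 'X^n - 1.
have [r Dp] := closed_field_poly_normal p.
rewrite (monicP _) ?monicXnsubC // scale1r in Dp.
have rn1: all n.-unity_root r by apply/allP=> z; rewrite -root_prod_XsubC -Dp.
have sz_r: (n < (size r).+1)%N.
  by rewrite -(size_prod_XsubC r id) -Dp size_XnsubC.
have [|z] := hasP (has_prim_root n_gt0 rn1 _ sz_r); last by exists z.
by rewrite -separable_prod_XsubC -Dp separable_Xn_sub_1 // pnatr_eq0 -lt0n.
Qed.

Definition faithful_char (n : nat) (chi : 'Z_n -> R[i]) : Prop :=
  [/\ chi 0 = 1, forall x y, chi (x + y) = chi x * chi y &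
      forall x, chi x = 1 -> x = 0].

Lemma faithful_char_exists (n : nat) : (1 < n)%N ->
  exists chi : 'Z_n -> R[i], faithful_char chi.
Proof.
move=> n_gt1; have [|w wP] := @prim_root_exists n; first by apply: ltnW.
have wmod k : w ^+ (k %% (Zp_trunc n).+2) = w ^+ k.
  by rewrite Zp_cast // prim_expr_mod.
exists (fun x : 'Z_n => w ^+ (x : nat)); split=> [|x y|x]; first exact: expr0.
  by rewrite -exprD; apply: wmod.
move=> /eqP; rewrite -(prim_order_dvd wP) => /dvdnP[[|k]] xE; apply: val_inj => //=.
have := ltn_ord x; rewrite [X in (_ < X)%N -> _]Zp_cast //.
by rewrite xE mulSn ltnNge leq_addr.
Qed.

End Characters.

Section Fourier.
Context {R : rcfType} {n : nat}.
Local Notation G := 'Z_n.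
Local Notation N := (#|'Z_n|%:R).
Variable chi : G -> R[i].
Hypothesis chiP : faithful_char chi.
Let chi0 : chi 0 = 1. Proof. by case: chiP. Qed.
Let chiD x y : chi (x + y) = chi x * chi y. Proof. by case: chiP. Qed.
Let chi_inj x : chi x = 1 -> x = 0. Proof. by case: chiP => _ _; apply. Qed.
Local Open Scope complex_scope.

Lemma normc_char x : normc (chi x) = 1.
Proof.
have chiMn k : chi (x *+ k) = chi x ^+ k.
  by elim: k => [|k IH]; rewrite ?mulr0n ?expr0 // mulrS chiD IH exprS.
have normcX k : normc (chi x ^+ k) = normc (chi x) ^+ k.
  by elim: k => [|k IH]; rewrite ?expr0 ?normc1 // !exprS normcM IH.
have h : normc (chi x) ^+ #|G| = 1.
  rewrite -normcX -chiMn; suff -> : x *+ #|G| = 0 by rewrite chi0 normc1.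
  by rewrite -mulr_natr card_ord (@pchar_Zp (Zp_trunc n).+2) ?mulr0.
have G_gt0 : (0 < #|G|)%N by rewrite card_ord.
by apply/eqP; rewrite -(pexpr_eq1 G_gt0) ?normc_ge0 // h.
Qed.

Lemma char_conj x : conjc (chi x) = chi (- x).
Proof.
have h : chi x * conjc (chi x) = 1 by rewrite -normc_conj normc_char expr1n.
by rewrite -[RHS]mulr1 -h mulrA -chiD addNr chi0 mul1r.
Qed.

Lemma char_sum (t : G) : \sum_x chi (x * t) = if t == 0 then N else 0.
Proof.
case: eqP => [->|/eqP tn0].
  under eq_bigr do rewrite mulr0 chi0.
  by rewrite sumr_const.
have h : (1 - chi t) * (\sum_x chi (x * t)) = 0.
  rewrite mulrBl mul1r mulr_sumr.
  rewrite [X in X - _](reindex_inj (addrI 1)) /=.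
  by rewrite -sumrB big1 // => x _; rewrite mulrDl mul1r chiD subrr.
apply/eqP; move/eqP: h; rewrite mulf_eq0 => /orP[|//].
by rewrite subr_eq0 eq_sym => /eqP/chi_inj/eqP; rewrite (negPf tn0).
Qed.

Definition fourier (a : G -> R) (xi : G) : R[i] := \sum_x (a x)%:C * chi (xi * x).

Lemma fourier_inversion a x :
  \sum_xi fourier a xi * chi (- (xi * x)) = (N * a x)%:C.
Proof.
under eq_bigr do rewrite mulr_suml.
rewrite exchange_big /= (bigD1 x) //= [X in _ + X]big1 ?addr0 => [|y ynx].
  under eq_bigr do rewrite -mulrA -chiD subrr chi0 mulr1.
  by rewrite sumr_const rmorphM /= rmorph_nat mulrC mulr_natr.
under eq_bigr do rewrite -mulrA -chiD -mulrBr.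
by rewrite -mulr_sumr char_sum subr_eq0 (negPf ynx) mulr0.
Qed.

Lemma parseval a : \sum_xi normc (fourier a xi) ^+ 2 = N * \sum_x a x ^+ 2.
Proof.
apply: (@complexI R); rewrite rmorph_sum /=.
under eq_bigr => xi _.
  rewrite normc_conj [X in _ * conjc X]/fourier conjc_sum mulr_sumr.
  under eq_bigr do rewrite conjcM conjc_real char_conj mulrCA.
  over.
rewrite exchange_big /= mulr_sumr rmorph_sum /=; apply: eq_bigr => x _.
by rewrite -mulr_sumr fourier_inversion -rmorphM /=; congr _%:C; ring.
Qed.

End Fourier.

(** * Averages over translates and their transforms *)

Section BohrAverages.
Context {R : rcfType} {n : nat}.
Local Notation G := 'Z_n.
Local Notation N := (#|'Z_n|%:R).
Variable chi : G -> R[i].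
Hypothesis chiP : faithful_char chi.
Let chi0 : chi 0 = 1. Proof. by case: chiP. Qed.
Let chiD x y : chi (x + y) = chi x * chi y. Proof. by case: chiP. Qed.
Local Open Scope complex_scope.
Local Notation ft := (fourier chi).

(** Fourier inversion of [F] separates [b] from [b'], and Parseval bounds what
    remains. When [u] and [v] are bounded functions on a set [B], the sum has
    [#|B|^2] terms and the bound is [eta #|B|]: a saving as soon as [eta] is small
    against [#|B|], so uniformity of [F] on the whole group controls all
    translates of [B] at once, at the price of the index of [B]. *)
Lemma fourier_bilinear_le (F u v : G -> R) (s t : G) (eta K : R) (x : G) :
    s \is a GRing.unit -> t \is a GRing.unit ->
    (forall xi, normc (ft F xi) <= eta) ->
    \sum_b u b ^+ 2 <= K -> \sum_b v b ^+ 2 <= K ->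
  \sum_b \sum_b' u b * v b' * F (x + s * b + t * b') <= eta * K.
Proof.
move=> su tu Feta uK vK.
have eta0 : 0 <= eta by apply: le_trans (Feta 0); apply: normc_ge0.
have N0 : 0 < N :> R by rewrite ltr0n card_ord.
set S := (X in X <= _).
have NSE : (N * S)%:C = \sum_xi ft F xi * chi (- (xi * x))
    * (ft u (- (xi * s)) * ft v (- (xi * t))).
  rewrite mulr_sumr rmorph_sum /=.
  under eq_bigr => b _.
    rewrite mulr_sumr rmorph_sum /=.
    under eq_bigr => b' _.
      rewrite mulrCA rmorphM /= -(fourier_inversion chiP) mulr_sumr.
      over.
    rewrite exchange_big /=; over.
  rewrite exchange_big /=; apply: eq_bigr => xi _.
  set A := ft F xi.
  rewrite /fourier [in RHS]mulr_suml [RHS]mulr_sumr; apply: eq_bigr => b _.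
  rewrite [in RHS]mulr_sumr [RHS]mulr_sumr; apply: eq_bigr => b' _.
  rewrite rmorphM /= [xi * _]mulrDr mulrDr !opprD !chiD !mulNr !mulrA.
  by ring.
have UU (w : G -> R) (r : G) : r \is a GRing.unit -> \sum_b w b ^+ 2 <= K ->
    \sum_xi normc (ft w (- (xi * r))) ^+ 2 <= N * K.
  move=> ru wK; have inj : injective (fun xi => - (xi * r)).
    by move=> y z /oppr_inj /(mulIr ru).
  suff <- : \sum_xi normc (ft w xi) ^+ 2 =
      \sum_xi normc (ft w (- (xi * r))) ^+ 2.
    by rewrite (parseval chiP) // ler_wpM2l // ltW.
  by rewrite (reindex_inj inj).
rewrite -(ler_pM2l N0) -[X in X <= _]/(complex.Re (N * S)%:C) NSE.
apply: le_trans (Re_le_normc _) _; apply: le_trans (normc_sum _ _ _) _.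
have -> : N * (eta * K) = eta / 2 * (N * K + N * K) by field.
apply: le_trans (_ : \sum_xi eta / 2 * (normc (ft u (- (xi * s))) ^+ 2
   + normc (ft v (- (xi * t))) ^+ 2) <= _); last first.
  rewrite -mulr_sumr ler_wpM2l ?divr_ge0 // big_split /=.
  by apply: lerD; apply: UU.
apply: ler_sum => xi _; rewrite !normcM (normc_char chiP) // mulr1.
set a := normc (ft u _); set c := normc (ft v _).
have ac : 0 <= a * c by rewrite mulr_ge0 ?normc_ge0.
apply: le_trans (ler_wpM2r ac (Feta xi)) _.
rewrite -mulrA ler_wpM2l //; have := sqr_ge0 (a - c); rewrite sqrrB; lra.
Qed.

(** The dilation [t = 2] is needed because the outer terms of a progression differ
    by twice its difference. *)
Definition bavg (B : {set G}) (t : G) (f : G -> R) (x : G) : R :=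
  (\sum_(b in B) f (x + t * b)) / #|B|%:R.

Definition char_mean (B : {set G}) (xi : G) : R[i] :=
  (\sum_(b in B) chi (xi * b)) * (#|B|%:R^-1)%:C.

Lemma fourier_bavg B t f xi :
  ft (bavg B t f) xi = ft f xi * char_mean B (- (xi * t)).
Proof.
rewrite /fourier /bavg /char_mean mulrA mulr_sumr.
under eq_bigr => x _ do rewrite rmorphM rmorph_sum /= mulrAC mulr_suml.
rewrite -mulr_suml exchange_big /=; congr (_ * _).
apply: eq_bigr => b _; rewrite [LHS](reindex_inj (addIr (- (t * b)))) /=.
rewrite mulr_suml; apply: eq_bigr => x _.
by rewrite subrK -mulrA -chiD mulrBr mulNr mulrA.
Qed.

Lemma normc_char_mean B xi : normc (char_mean B xi) <= 1.
Proof.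
rewrite /char_mean normcM normc_real.
have [->|B0] := eqVneq B set0; first by rewrite big_set0 normc0 mul0r.
have B1 : 0 < #|B|%:R :> R by rewrite ltr0n card_gt0.
rewrite ger0_norm ?invr_ge0 ?ler0n // ler_pdivrMr // mul1r.
apply: le_trans (normc_sum _ _ _) _.
under eq_bigr do rewrite (normc_char chiP) //.
by rewrite sumr_const.
Qed.

(** Each term at [- xi] is the conjugate of the corresponding term at [xi]. *)
Lemma char_mean_near1 B xi rho : B != set0 ->
    (forall b, b \in B -> normc (1 - chi (xi * b)) <= rho) ->
  normc (1 - char_mean B (- xi)) <= rho.
Proof.
move=> B0 h; have B1 : 0 < #|B|%:R :> R by rewrite ltr0n card_gt0.
have -> : 1 - char_mean B (- xi)
    = (\sum_(b in B) (1 - chi (- xi * b))) * (#|B|%:R^-1)%:C.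
  rewrite sumrB mulrBl sumr_const; congr (_ - _).
  have <- : #|B|%:R%:C = #|B|%:R :> R[i] by rewrite rmorph_nat.
  by rewrite -rmorphM /= divff ?gt_eqF.
rewrite normcM normc_real ger0_norm ?invr_ge0 ?ler0n // ler_pdivrMr //.
apply: le_trans (normc_sum _ _ _) _.
rewrite mulr_natr -sumr_const; apply: ler_sum => b bB.
apply: le_trans (h b bB).
have -> : 1 - chi (- xi * b) = - chi (- xi * b) * (1 - chi (xi * b)).
  by rewrite mulrBr mulr1 !mulNr -chiD addNr chi0; ring.
by rewrite normcM normcN (normc_char chiP) // mul1r.
Qed.

End BohrAverages.

(** * Bohr sets *)

Lemma pigeonhole_fiber (T : finType) (k : nat) (bin : T -> 'I_k.+1) (X : {set T}) :
  exists c, (#|X| <= k.+1 * #|[set x in X | bin x == c]|)%N.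
Proof.
pose F c := #|[set x in X | bin x == c]|.
have [c _ cmax] := @arg_maxnP _ ord0 predT F isT.
exists c; rewrite -sum1_card (partition_big bin predT) //=.
rewrite -[X in (_ <= X * _)%N](card_ord k.+1) -sum_nat_const.
apply: leq_sum => d _.
by rewrite sum1dep_card; apply: cmax.
Qed.

(** Cutting along one function at a time costs a factor [2 m + 1] for each. *)
Lemma common_cell {R : realType} (T : finType) (I : eqType) (phi : I -> T -> R)
    (m : nat) (l : seq I) :
    (0 < m)%N -> (forall i x, `|phi i x| <= 1) ->
  exists X : {set T}, (#|T| <= (m.*2).+1 ^ size l * #|X|)%N /\
    forall i x y, i \in l -> x \in X -> y \in X ->
      `|phi i x - phi i y| <= m%:R^-1.
Proof.
move=> m0 phi1; have m1 : 0 < m%:R :> R by rewrite ltr0n.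
elim: l => [|i l [X [cX hX]]].
  by exists setT; split=> //; rewrite expn0 mul1n cardsT.
pose lev x := (phi i x + 1) * m%:R.
have lev0 x : 0 <= lev x.
  by rewrite mulr_ge0 // -lerBlDr sub0r; have := phi1 i x; rewrite ler_norml => /andP[].
have levm x : (Num.truncn (lev x) < (m.*2).+1)%N.
  rewrite ltnS -(ler_nat R); have /andP[h _] := truncn_itv (lev0 x); apply: le_trans h _.
  rewrite /lev -muln2 natrM mulrC ler_wpM2l //.
  by have := phi1 i x; rewrite ler_norml => /andP[_]; lra.
have [c cP] := pigeonhole_fiber (fun x => Ordinal (levm x)) X.
exists [set x in X | Ordinal (levm x) == c]; split.
  by apply: leq_trans cX _; rewrite expnSr -mulnA leq_mul2l cP orbT.
move=> j x y; rewrite !inE => /predU1P[->|jl] /andP[xX /eqP xc] /andP[yX /eqP yc].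
  2: by apply: hX.
have e : Num.truncn (lev x) = Num.truncn (lev y).
  by have /(congr1 val) := etrans xc (esym yc).
rewrite -[X in X <= _](@mulfK _ m%:R) ?gt_eqF // -[X in _ <= X]mul1r.
rewrite ler_wpM2r ?invr_ge0 // -[X in `|_| * X]ger0_norm // -normrM.
have -> : (phi i x - phi i y) * m%:R = lev x - lev y by rewrite /lev; ring.
have /andP[x1 x2] := truncn_itv (lev0 x); have /andP[y1 y2] := truncn_itv (lev0 y).
rewrite e in x1 x2; rewrite ler_norml -natr1 in x2 y2 *; apply/andP; split; lra.
Qed.

Section BohrSets.
Context {R : realType} {n : nat}.
Hypothesis n_gt1 : (1 < n)%N.
Local Notation G := 'Z_n.
Local Notation N := (#|'Z_n|%:R).

(** Chebyshev's inequality in Parseval's identity. *)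
Lemma large_spectrum_card (chi : G -> R[i]) (a : G -> R) (c : R) :
    faithful_char chi -> 0 <= c ->
  #|[set xi | c < normc (fourier chi a xi)]|%:R * c ^+ 2
    <= N * \sum_x a x ^+ 2.
Proof.
move=> chiP c0; rewrite -(parseval chiP).
rewrite mulr_natl -sumr_const [X in _ <= X](bigID [pred xi | c < normc (fourier chi a xi)]) /=.
rewrite -[X in X <= _]addr0; apply: lerD; last by apply: sumr_ge0 => x _; apply: sqr_ge0.
rewrite (eq_bigl (fun xi => c < normc (fourier chi a xi))) => [|xi]; last by rewrite inE.
apply: ler_sum => xi h; rewrite ler_sqr ?nnegrE ?normc_ge0 //; exact: ltW.
Qed.

(** These are the residues of the integers of absolute value at most [n / m]:
    progressions with such a difference seldom wrap around. *)
Definition near_zero (m : nat) (b : G) : bool :=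
  (b * m <= #|{: G}|)%N || ((#|{: G}| - b) * m <= #|{: G}|)%N.

Lemma near_zeroN m b : near_zero m b -> near_zero m (- b).
Proof.
rewrite /near_zero; have [->|b0] := eqVneq b 0; first by rewrite oppr0.
have bN : (b <= #|G|)%N by rewrite card_ord ltnW.
have -> : nat_of_ord (- b) = (#|G| - b)%N.
  rewrite card_ord /= modn_small // ltn_subrL /=.
  by rewrite lt0n andbT; apply: contra b0 => /eqP e; apply/eqP/val_inj.
by rewrite subKn // orbC.
Qed.

Lemma near_zeroB m (x y : G) : (0 < m)%N ->
  `|(x : nat)%:R / N - (y : nat)%:R / N| <= m%:R^-1 :> R -> near_zero m (x - y).
Proof.
move=> m0; have N0 : 0 < N :> R by rewrite ltr0n card_ord.
wlog xy : x y / (y <= x)%N => [wl|].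
  have [xy|/ltnW xy] := leqP y x; first exact: wl.
  by rewrite distrC => /wl -/(_ xy) /near_zeroN; rewrite opprB.
have -> : (x : nat)%:R / N - (y : nat)%:R / N = (x - y)%N%:R / N :> R.
  by rewrite natrB // mulrBl.
rewrite ger0_norm ?divr_ge0 // ler_pdivrMr // mulrC ler_pdivlMr ?ltr0n //.
rewrite -natrM ler_nat => h; apply/orP; left.
suff -> : nat_of_ord (x - y) = (x - y)%N by [].
have xl : (x < (Zp_trunc n).+2)%N := ltn_ord x.
have yl : (y < (Zp_trunc n).+2)%N := ltn_ord y.
rewrite /= modnDmr addnBA ?(ltnW yl) // addnC -addnBA // modnDl modn_small //.
by apply: leq_ltn_trans (leq_subr _ _) xl.
Qed.

(** The differences of two elements of a common cell of the real and imaginary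
    parts of the given characters, and of the position, lie in the Bohr set. *)
Lemma bohr_set_exists (chi : G -> R[i]) (Gam : seq G) (m : nat) :
    faithful_char chi -> (0 < m)%N ->
  exists B : {set G},
    [/\ 0 \in B, forall b, b \in B -> - b \in B,
        forall b, b \in B -> near_zero m b,
        (#|{: G}| <= (m.*2).+1 ^ (size Gam).*2.+1 * #|B|)%N &
        forall b xi, b \in B -> xi \in Gam -> normc (1 - chi (xi * b)) <= 2 / m%:R].
Proof.
move=> chiP m0; have [chi0 chiD _] := chiP; have N0 : 0 < N :> R by rewrite ltr0n card_ord.
have m1 : 0 < m%:R^-1 :> R by rewrite invr_gt0 ltr0n.
pose phi (i : option (G * bool)) (x : G) : R :=
  if i is Some (xi, b) then
    if b then complex.Re (chi (xi * x)) else complex.Im (chi (xi * x))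
  else (x : nat)%:R / N.
pose l := None :: [seq Some (xi, true) | xi <- Gam] ++ [seq Some (xi, false) | xi <- Gam].
have phi1 i x : `|phi i x| <= 1.
  case: i => [[xi b]|] /=; last first.
    by rewrite ger0_norm ?divr_ge0 // ler_pdivrMr // mul1r ler_nat card_ord ltnW.
  have := normc_sqr (chi (xi * x)); rewrite (normc_char chiP) // expr1n => h.
  rewrite -ler_sqr ?nnegrE ?normr_ge0 // real_normK ?num_real // expr1n h.
  by case: b; rewrite ?lerDl ?lerDr sqr_ge0.
have [X [cX hX]] := common_cell l m0 phi1.
pose B : {set G} := [set b | near_zero m b &&
  all (fun xi => normc (1 - chi (xi * b)) <= 2 / m%:R) Gam].
have X0 : X != set0.
  by apply/eqP => X0; move: cX; rewrite X0 cards0 muln0 card_ord.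
have [x0 x0X] := set0Pn _ X0.
exists B; split.
- rewrite inE /near_zero mul0n leq0n /=; apply/allP => xi _.
  by rewrite mulr0 chi0 subrr normc0 mulr_ge0 // ltW.
- move=> b; rewrite !inE => /andP[/near_zeroN -> /allP h]; apply/allP => xi /h {h}.
  have -> : 1 - chi (xi * - b) = - chi (- (xi * b)) * (1 - chi (xi * b)).
    by rewrite mulrN mulrBr mulr1 mulNr -[chi (- _) * _]chiD addNr chi0; ring.
  by rewrite normcM normcN (normc_char chiP) // mul1r.
- by move=> b; rewrite inE => /andP[].
- apply: leq_trans cX _.
  have -> : size l = (size Gam).*2.+1 by rewrite /= size_cat !size_map addnn.
  rewrite leq_mul2l; apply/orP; right.
  rewrite -(card_imset (mem X) (addIr (- x0))); apply: subset_leq_card.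
  apply/subsetP => _ /imsetP[x xX ->]; rewrite inE; apply/andP; split.
    by apply: near_zeroB => //; apply: (hX None) => //; rewrite inE.
  apply/allP => xi xiG.
  have -> : 1 - chi (xi * (x - x0)) = chi (- (xi * x0)) * (chi (xi * x0) - chi (xi * x)).
    by rewrite [RHS]mulrBr -!chiD addNr chi0 mulrBr [- (xi * x0) + _]addrC.
  rewrite normcM (normc_char chiP) // mul1r; apply: le_trans (normc_le_ReIm _) _.
  have h b : Some (xi, b) \in l.
    rewrite inE mem_cat; apply/orP; right; apply/orP.
    by case: b; [left|right]; apply: map_f.
  have := hX _ _ _ (h true) x0X xX; have := hX _ _ _ (h false) x0X xX.
  rewrite /= !raddfB /=; lra.
- by move=> b xi; rewrite inE => /andP[_ /allP h] /h.
Qed.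

End BohrSets.

(** * The choice of the next scale *)

Section NextScale.
Context {R : realType} {n : nat}.
Hypothesis n_gt1 : (1 < n)%N.
Local Notation G := 'Z_n.
Local Notation N := (#|'Z_n|%:R).

Lemma fourierB (chi : G -> R[i]) (f g : G -> R) xi :
  fourier chi (fun x => f x - g x) xi = fourier chi f xi - fourier chi g xi.
Proof.
by rewrite /fourier -sumrB; apply: eq_bigr => x _; rewrite rmorphB mulrBl.
Qed.

Lemma char_mean_fourier (chi : G -> R[i]) (B : {set G}) xi :
  normc (char_mean chi B xi)
    = normc (fourier chi (fun b => (b \in B)%:R) xi) / #|B|%:R.
Proof.
rewrite /char_mean normcM normc_real ger0_norm ?invr_ge0 ?ler0n //.
congr (normc _ / _); rewrite /fourier [LHS]big_mkcond; apply: eq_bigr => b _.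
by case: (b \in B); rewrite (rmorph1, rmorph0) (mul1r, mul0r).
Qed.

(** The frequencies to neutralise are those where [f], or the indicator of [B],
    has a large transform. Parseval bounds their number by a polynomial in [w] and
    [k], so that the index of the Bohr set is exponential in such a polynomial:
    this is the exponential paid at each scale. *)
Lemma next_scale (f : G -> R) (B : {set G}) (k w : nat) :
    (forall x, 0 <= f x <= 1) -> B != set0 -> (0 < k)%N -> (0 < w)%N ->
    (#|G| <= w * #|B|)%N ->
  exists B' : {set G},
    [/\ [/\ 0 \in B', forall b, b \in B' -> - b \in B',
        forall b, b \in B' -> near_zero (4 * w * k) b &
        (#|{: G}| <= (8 * w * k).+1 ^ (16 * (w * k) ^ 2).+1 * #|B'|)%N],
      forall (s t : G) (u v : G -> R) (x : G),
        s \is a GRing.unit -> t \is a GRing.unit ->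
        \sum_b u b ^+ 2 <= #|B|%:R -> \sum_b v b ^+ 2 <= #|B|%:R ->
        \sum_b \sum_b' u b * v b' * (f (x + s * b + t * b')
           - bavg B' 1 f (x + s * b + t * b')) <= #|B|%:R ^+ 2 / k%:R &
      forall t : G, t = 1 \/ t = 2 ->
        \sum_x (bavg B' t (bavg B 1 f) x - bavg B 1 f x) ^+ 2 <= N / k%:R ^+ 2].
Proof.
move=> f01 B0 k0 w0 Bw.
have [chi chiP] := @faithful_char_exists R n n_gt1.
have [chi0 chiD _] := chiP.
have N0 : 0 < N :> R by rewrite ltr0n card_ord.
have k1 : 0 < k%:R :> R by rewrite ltr0n.
have w1 : 1 <= w%:R :> R by rewrite ler1n.
have b1 : 0 < #|B|%:R :> R by rewrite ltr0n card_gt0.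
have w0' : 0 < w%:R :> R by rewrite ltr0n.
have kn0 : k%:R != 0 :> R by rewrite gt_eqF.
have wn0 : w%:R != 0 :> R by rewrite gt_eqF // (lt_le_trans ltr01).
have bn0 : #|B|%:R != 0 :> R by rewrite gt_eqF.
have BwR : N <= w%:R * #|B|%:R :> R by rewrite -natrM ler_nat.
have f2 : \sum_x f x ^+ 2 <= N.
  rewrite -sumr_const; apply: ler_sum => x _.
  by have /andP[f0 f1] := f01 x; rewrite expr_le1.
(* Half of the target, as the complementary factor is at most two. *)
pose c : R := #|B|%:R / (2 * k%:R).
have c0 : 0 < c by rewrite divr_gt0 // mulr_gt0.
pose G1 := [set xi | c < normc (fourier chi f xi)].
pose oB (b : G) : R := (b \in B)%:R.
pose G2 := [set xi | c < normc (fourier chi oB xi)].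
have cE : c ^+ 2 = #|B|%:R ^+ 2 / (4 * k%:R ^+ 2) by rewrite /c; field; rewrite ?kn0 ?wn0 ?bn0 //.
have bound (X : R) (a : nat) : a%:R * c ^+ 2 <= X -> X <= (w%:R * #|B|%:R) ^+ 2 ->
    (a <= 4 * (w * k) ^ 2)%N.
  move=> h1 h2; rewrite -(ler_nat R) -(ler_pM2r (exprn_gt0 2 c0)).
  apply: le_trans h1 _; apply: le_trans h2 _; rewrite cE natrM natrX natrM.
  rewrite le_eqVlt; apply/orP; left; apply/eqP; field; rewrite ?kn0 ?wn0 ?bn0 //.
have G1c : (#|G1| <= 4 * (w * k) ^ 2)%N.
  apply: bound (large_spectrum_card _ chiP (ltW c0)) _.
  apply: le_trans (ler_wpM2l (ltW N0) f2) _.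
  by rewrite expr2 ler_pM // ltW.
have G2c : (#|G2| <= 4 * (w * k) ^ 2)%N.
  apply: bound (large_spectrum_card _ chiP (ltW c0)) _.
  have -> : \sum_x oB x ^+ 2 = #|B|%:R.
    rewrite -sumr_const [RHS]big_mkcond; apply: eq_bigr => x _.
    by rewrite /oB; case: (x \in B); rewrite ?expr1n ?expr0n.
  apply: le_trans (ler_wpM2r (ltW b1) BwR) _.
  rewrite exprMn [X in _ <= _ * X]expr2 mulrA ler_pM2r // ler_pM2r //.
  by rewrite expr2 ler_peMl // (le_trans ler01).
pose Gam := enum G1 ++ [seq - xi | xi <- enum G2].
have m0 : (0 < 4 * w * k)%N by rewrite !muln_gt0 w0 k0.
have [B' [B'0 B'N B'm B'c B'chi]] := bohr_set_exists Gam chiP m0.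
(* The radius is 1 / (2 w k), as the transform of f is at most w #|B|. *)
have rhoE : 2 / (4 * w * k)%N%:R = (2 * w%:R * k%:R)^-1 :> R.
  by rewrite !natrM; field; rewrite ?kn0 ?wn0 ?bn0 //.
rewrite rhoE in B'chi; set rho := (_^-1) in B'chi.
have rho_le : rho <= (2 * k%:R)^-1.
  rewrite lef_pV2 ?posrE ?mulr_gt0 //.
  by rewrite -mulrA ler_wpM2l // -[X in X <= _]mul1r ler_wpM2r // ltW.
have rho0 : 0 < rho.
  by rewrite invr_gt0 !mulr_gt0.
have B'0' : B' != set0 by apply/set0Pn; exists 0.
exists B'; split.
- split=> //; apply: leq_trans B'c _; rewrite leq_mul2r; apply/orP; right.
  have -> : (4 * w * k).*2 = (8 * w * k)%N by rewrite -muln2; ring.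
  rewrite leq_exp2l ?ltnS ?muln_gt0 ?w0 ?k0 // size_cat size_map -!cardE -muln2.
  have -> : (16 * (w * k) ^ 2 = (4 * (w * k) ^ 2 + 4 * (w * k) ^ 2) * 2)%N by ring.
  by rewrite leq_mul2r leq_add.
- move=> s t u v x su tu uB vB.
  have -> : #|B|%:R ^+ 2 / k%:R = #|B|%:R / k%:R * #|B|%:R :> R by field; rewrite ?kn0 ?wn0 ?bn0 //.
  apply: (fourier_bilinear_le chiP (F := fun y => f y - bavg B' 1 f y)) => // xi.
  rewrite fourierB (fourier_bavg chiP) mulr1 -[X in X - _]mulr1 -mulrBr normcM.
  have [xiG|] := boolP (xi \in G1).
    have xiGam : xi \in Gam by rewrite mem_cat mem_enum xiG.
    have h1 : normc (1 - char_mean chi B' (- xi)) <= rho.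
      by apply: char_mean_near1 => // b bB; apply: B'chi.
    have h2 : normc (fourier chi f xi) <= w%:R * #|B|%:R.
      apply: le_trans BwR; apply: le_trans (normc_sum _ _ _) _.
      rewrite -sumr_const; apply: ler_sum => y _.
      rewrite normcM (normc_char chiP) // mulr1 normc_real.
      by have /andP[f0 f1] := f01 y; rewrite ger0_norm.
    apply: le_trans (ler_pM (normc_ge0 _) (normc_ge0 _) h2 h1) _.
    have -> : w%:R * #|B|%:R * rho = (#|B|%:R / k%:R) / 2 by rewrite /rho; field; rewrite ?kn0 ?wn0 ?bn0 //.
    have : 0 < #|B|%:R / k%:R :> R by rewrite divr_gt0.
    lra.
  rewrite inE -leNgt => h1.
  have h2 : normc (1 - char_mean chi B' (- xi)) <= 2.
    apply: le_trans (le_normcD _ _) _; rewrite normcN normc1.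
    have := normc_char_mean chiP B' (- xi); lra.
  apply: le_trans (ler_pM (normc_ge0 _) (normc_ge0 _) h1 h2) _.
  by rewrite le_eqVlt; apply/orP; left; apply/eqP; rewrite /c; field; rewrite ?kn0 ?wn0 ?bn0 //.
move=> t t12; rewrite -(ler_pM2l N0).
rewrite -(parseval chiP (fun x => bavg B' t (bavg B 1 f) x - bavg B 1 f x)).
have tt xi b : xi \in Gam -> b \in B' -> normc (1 - chi (xi * t * b)) <= 2 * rho.
  move=> xiG bB; have := B'chi _ _ bB xiG.
  case: t12 => ->; first by rewrite mulr1; lra.
  have -> : xi * 2 * b = xi * b + xi * b by ring.
  rewrite chiD; set z := chi _ => h.
  have -> : 1 - z * z = (1 - z) + z * (1 - z) by ring.
  apply: le_trans (le_normcD _ _) _; rewrite normcM (normc_char chiP) //; lra.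
have key xi : normc (char_mean chi B (- xi)) * normc (1 - char_mean chi B' (- (xi * t))) <= k%:R^-1.
  have [xiG|] := boolP (- xi \in G2).
    have xiGam : xi \in Gam.
      by rewrite mem_cat -[xi]opprK map_f ?orbT // mem_enum.
    apply: le_trans (ler_pM (normc_ge0 _) (normc_ge0 _)
       (normc_char_mean chiP _ _)
       (char_mean_near1 chiP B'0' (fun b => tt xi b xiGam))) _.
    rewrite mul1r; have -> : k%:R^-1 = 2 * (2 * k%:R)^-1 :> R by field; rewrite ?kn0 ?wn0 ?bn0 //.
    by rewrite ler_wpM2l.
  rewrite inE -leNgt => h1.
  have h1' : normc (char_mean chi B (- xi)) <= (2 * k%:R)^-1.
    rewrite char_mean_fourier ler_pdivrMr //; apply: le_trans h1 _.
    by rewrite /c mulrC.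
  have h2 : normc (1 - char_mean chi B' (- (xi * t))) <= 2.
    apply: le_trans (le_normcD _ _) _; rewrite normcN normc1.
    have := normc_char_mean chiP B' (- (xi * t)); lra.
  apply: le_trans (ler_pM (normc_ge0 _) (normc_ge0 _) h1' h2) _.
  by rewrite le_eqVlt; apply/orP; left; apply/eqP; field; rewrite ?kn0 ?wn0 ?bn0 //.
apply: le_trans (_ : \sum_xi normc (fourier chi f xi) ^+ 2 / k%:R ^+ 2 <= _).
  apply: ler_sum => xi _; rewrite fourierB !(fourier_bavg chiP).
  rewrite mulr1 -[X in _ - X]mulr1 -mulrBr normcM normcM -[normc (_ - 1)]normcN opprB.
  rewrite -mulrA exprMn ler_wpM2l ?sqr_ge0 // -exprVn.
  by rewrite ler_sqr ?nnegrE ?mulr_ge0 ?normc_ge0 ?invr_ge0 ?ler0n.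
rewrite -mulr_suml (parseval chiP) -mulrA ler_pM2l //.
by rewrite ler_wpM2r // invr_ge0 sqr_ge0.
Qed.

End NextScale.

(** * Convexity and contraction properties of averages *)

Section Averages.
Context {R : realType} {n : nat}.
Local Notation G := 'Z_n.
Local Notation N := (#|'Z_n|%:R).
Implicit Types (f g h : G -> R) (B : {set G}) (s t : G).

Lemma card_gt0R (B : {set G}) : B != set0 -> 0 < #|B|%:R :> R.
Proof. by move=> B0; rewrite ltr0n card_gt0. Qed.

Lemma bavgC B B' s t f x :
  bavg B s (bavg B' t f) x = bavg B' t (bavg B s f) x.
Proof.
rewrite /bavg -!mulr_suml mulrAC exchange_big /=; congr (_ / _ / _).
by apply: eq_bigr => b _; apply: eq_bigr => b' _; rewrite addrAC.
Qed.

Lemma eq_bavg B t f g x : f =1 g -> bavg B t f x = bavg B t g x.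
Proof. by move=> fg; rewrite /bavg; congr (_ / _); apply: eq_bigr => b _; rewrite fg. Qed.

Lemma le_bavg B t f g x : (forall y, f y <= g y) -> bavg B t f x <= bavg B t g x.
Proof. by move=> fg; rewrite ler_wpM2r ?invr_ge0 ?ler0n // ler_sum. Qed.

Lemma bavg_cst B t (c : R) x : B != set0 -> bavg B t (fun=> c) x = c.
Proof.
move=> /card_gt0R B0; rewrite /bavg sumr_const -[X in X / _]mulr_natr mulfK //.
by rewrite gt_eqF.
Qed.

Lemma bavg01 B t f x : B != set0 -> (forall y, 0 <= f y <= 1) ->
  0 <= bavg B t f x <= 1.
Proof.
move=> B0 f01; rewrite -[X in X <= _ <= _](bavg_cst t 0 x B0).
rewrite -[X in _ <= _ <= X](bavg_cst t 1 x B0).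
by rewrite !le_bavg // => y; have /andP[] := f01 y.
Qed.

Lemma bavgD B t f g x : bavg B t (fun y => f y + g y) x = bavg B t f x + bavg B t g x.
Proof. by rewrite /bavg big_split mulrDl. Qed.

Lemma bavgZ B t c f x : bavg B t (fun y => c * f y) x = c * bavg B t f x.
Proof. by rewrite /bavg -mulr_sumr mulrA. Qed.

Lemma bavg_norm_le B t f x : `|bavg B t f x| <= bavg B t (fun y => `|f y|) x.
Proof.
rewrite /bavg normrM [X in _ * X]ger0_norm ?invr_ge0 ?ler0n //.
by rewrite ler_wpM2r ?invr_ge0 ?ler0n // ler_norm_sum.
Qed.

Lemma sum_bavg B t f : B != set0 -> \sum_x bavg B t f x = \sum_x f x.
Proof.
move=> /card_gt0R B0; rewrite -mulr_suml exchange_big /=.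
under eq_bigr => b _.
  have <- : \sum_x f x = \sum_x f (x + t * b) by rewrite (reindex_inj (addIr (t * b))).
  over.
by rewrite sumr_const -[X in X / _]mulr_natr mulfK // gt_eqF.
Qed.

(** Jensen's inequality: the cube lies above its tangent at the mean. *)
Lemma bavg_cube_le B t f x : B != set0 -> (forall y, 0 <= f y) ->
  bavg B t f x ^+ 3 <= bavg B t (fun y => f y ^+ 3) x.
Proof.
move=> B0 f0; set m := bavg B t f x.
have m0 : 0 <= m by rewrite -(bavg_cst t 0 x B0); apply: le_bavg.
have -> : m ^+ 3 = bavg B t (fun y => 3 * m ^+ 2 * f y + - 2 * m ^+ 3) x.
  by rewrite bavgD bavgZ bavg_cst // -/m; ring.
apply: le_bavg => y; rewrite -subr_ge0.
have -> : f y ^+ 3 - (3 * m ^+ 2 * f y + - 2 * m ^+ 3)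
  = (f y - m) ^+ 2 * (f y + 2 * m) by ring.
by rewrite mulr_ge0 ?sqr_ge0 // addr_ge0 // mulr_ge0.
Qed.

Lemma bavg_sqr_le_bavg B t f x : B != set0 ->
  bavg B t f x ^+ 2 <= bavg B t (fun y => f y ^+ 2) x.
Proof.
move=> B0; set m := bavg B t f x.
have -> : m ^+ 2 = bavg B t (fun y => 2 * m * f y + - m ^+ 2) x.
  by rewrite bavgD bavgZ bavg_cst // -/m; ring.
apply: le_bavg => y; rewrite -subr_ge0.
have -> : f y ^+ 2 - (2 * m * f y + - m ^+ 2) = (f y - m) ^+ 2 by ring.
exact: sqr_ge0.
Qed.

Lemma sum_bavg_cube_le B t f : B != set0 -> (forall y, 0 <= f y) ->
  \sum_x bavg B t f x ^+ 3 <= \sum_x f x ^+ 3.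
Proof.
move=> B0 f0; rewrite -(sum_bavg t (fun y => f y ^+ 3) B0).
by apply: ler_sum => x _; apply: bavg_cube_le.
Qed.

Lemma sum_bavg_norm_le B t f : B != set0 ->
  \sum_x `|bavg B t f x| <= \sum_x `|f x|.
Proof.
move=> B0; rewrite -(sum_bavg t (fun y => `|f y|) B0).
by apply: ler_sum => x _; apply: bavg_norm_le.
Qed.

Lemma sum_cube_stable f g :
    (forall x, 0 <= f x <= 1) -> (forall x, 0 <= g x <= 1) ->
  \sum_x g x ^+ 3 - 3 * \sum_x `|f x - g x| <= \sum_x f x ^+ 3.
Proof.
move=> f01 g01; rewrite mulr_sumr -sumrB; apply: ler_sum => x _.
have /andP[f0 f1] := f01 x; have /andP[g0 g1] := g01 x.
have [fg|gf] := leP (f x) (g x); last first.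
  have : g x ^+ 3 <= f x ^+ 3 by rewrite lerXn2r ?nnegrE // ltW.
  have := normr_ge0 (f x - g x); lra.
rewrite ler0_norm ?subr_le0 // -subr_ge0.
have -> : f x ^+ 3 - (g x ^+ 3 - 3 * - (f x - g x))
  = (g x - f x) * ((1 - g x ^+ 2) + (1 - g x * f x) + (1 - f x ^+ 2)) by ring.
apply: mulr_ge0; first by rewrite subr_ge0.
apply: addr_ge0; first apply: addr_ge0; rewrite subr_ge0.
- by rewrite expr_le1.
- by rewrite mulr_ile1.
- by rewrite expr_le1.
Qed.

(** The inequality [2 a <= k a^2 + 1 / k], in place of Cauchy-Schwarz. *)
Lemma sum_norm_le_of_sqr f (k : nat) : (0 < k)%N ->
  \sum_x f x ^+ 2 <= N / k%:R ^+ 2 -> \sum_x `|f x| <= N / k%:R.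
Proof.
move=> k0 h; have k1 : 0 < k%:R :> R by rewrite ltr0n.
have kn0 : k%:R != 0 :> R by rewrite gt_eqF.
have -> : N / k%:R = \sum_(x : G) (2 * k%:R)^-1 + k%:R / 2 * (N / k%:R ^+ 2) :> R.
  by rewrite sumr_const -[X in X + _]mulr_natl; field; rewrite kn0.
apply: le_trans (_ : \sum_x ((2 * k%:R)^-1 + k%:R / 2 * f x ^+ 2) <= _).
  apply: ler_sum => x _; rewrite -(real_normK (num_real (f x))).
  set a := `|_|; rewrite -subr_ge0.
  have -> : (2 * k%:R)^-1 + k%:R / 2 * a ^+ 2 - a = (k%:R * a - 1) ^+ 2 * (2 * k%:R)^-1.
    by field; rewrite kn0.
  by rewrite mulr_ge0 ?sqr_ge0 // invr_ge0 mulr_ge0 // ltW.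
by rewrite big_split /= lerD2l -mulr_sumr ler_wpM2l // divr_ge0 // ltW.
Qed.

Definition symmetric_set B := forall b, b \in B -> - b \in B.

Lemma sum_symm B (F : G -> R) : symmetric_set B ->
  \sum_(b in B) F (- b) = \sum_(b in B) F b.
Proof.
move=> BN; rewrite [RHS](reindex_inj oppr_inj) /=; apply: eq_bigl => b.
by apply/idP/idP => [/BN //|/BN]; rewrite opprK.
Qed.

(** Translating [x] by [- t b] leaves [b] in the first factor only and [b'] in the
    second only. *)
Lemma pair_correlation B t f g : B != set0 -> symmetric_set B ->
  \sum_x \sum_(b in B) \sum_(b' in B) f x * g (x + t * (b + b'))
    = #|B|%:R ^+ 2 * \sum_x bavg B t f x * bavg B t g x.
Proof.
move=> /card_gt0R B0 BN.
have bn0 : #|B|%:R != 0 :> R by rewrite gt_eqF.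
transitivity (\sum_x \sum_(b in B) \sum_(b' in B) f (x + t * - b) * g (x + t * b')).
  rewrite exchange_big [RHS]exchange_big /=; apply: eq_bigr => b _.
  rewrite [LHS](reindex_inj (addIr (t * - b))) /=; apply: eq_bigr => x _.
  by apply: eq_bigr => b' _; congr (_ * g _); ring.
rewrite mulr_sumr; apply: eq_bigr => x _.
under eq_bigr do rewrite -mulr_sumr.
rewrite -mulr_suml /bavg (sum_symm (fun b => f (x + t * b)) BN).
by field; rewrite bn0.
Qed.

End Averages.

(** * Progressions and energy at three consecutive scales *)

Section MainInequality.
Context {R : realType} {n : nat}.
Local Notation G := 'Z_n.
Local Notation N := (#|'Z_n|%:R).
Implicit Types (f g h F : G -> R) (B : {set G}) (s t : G) (k : nat).

(** A function with this property can be dropped from one term of a progression with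
    difference [b + b'], whatever bounded functions stand at the other two terms. *)
Definition uniform_at B (c : R) F : Prop :=
  forall (s t : G) (u v : G -> R) (x : G),
    s \is a GRing.unit -> t \is a GRing.unit ->
    \sum_b u b ^+ 2 <= #|B|%:R -> \sum_b v b ^+ 2 <= #|B|%:R ->
  \sum_b \sum_b' u b * v b' * F (x + s * b + t * b') <= c.

(** What the scale [B'] must satisfy relative to [B]: replacing [f] by its average
    over [B'] is invisible to the progressions with difference in [B + B], and
    averages over [B] hardly change when averaged again over [B'] or [2 B']. *)
Definition refines k f B B' : Prop :=
  [/\ 0 \in B', symmetric_set B',
      uniform_at B (#|B|%:R ^+ 2 / k%:R) (fun x => f x - bavg B' 1 f x) &
      forall t, t = 1 \/ t = 2 ->
        \sum_x (bavg B' t (bavg B 1 f) x - bavg B 1 f x) ^+ 2 <= N / k%:R ^+ 2].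

Definition count3 B f g h : R :=
  \sum_x \sum_(b in B) \sum_(b' in B)
    f x * g (x + (b + b')) * h (x + 2 * (b + b')).

Lemma shift_sum3 B (E : G -> G -> G -> R) (sg : G -> G -> G) :
  \sum_x \sum_(b in B) \sum_(b' in B) E x b b'
    = \sum_x \sum_(b in B) \sum_(b' in B) E (x + sg b b') b b'.
Proof.
rewrite exchange_big [RHS]exchange_big /=; apply: eq_bigr => b _.
rewrite exchange_big [RHS]exchange_big /=; apply: eq_bigr => b' _.
by rewrite [LHS](reindex_inj (addIr (sg b b'))).
Qed.

Lemma uniform_at_ge B c F (p q : G -> R) s t x :
    uniform_at B c F -> s \is a GRing.unit -> t \is a GRing.unit ->
    (forall b, 0 <= p b <= 1) -> (forall b, 0 <= q b <= 1) ->
  - c <= \sum_(b in B) \sum_(b' in B) p b * q b' * F (x + s * b + t * b').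
Proof.
move=> FU su tu p01 q01.
have sq (r : G -> R) (e : R) : e ^+ 2 = 1 -> (forall b, 0 <= r b <= 1) ->
    \sum_b (e * ((b \in B)%:R * r b)) ^+ 2 <= #|B|%:R.
  move=> e1 r01; rewrite -sumr_const [X in _ <= X]big_mkcond; apply: ler_sum => b _.
  rewrite !exprMn e1 mul1r; have /andP[r0 r1] := r01 b.
  by case: (b \in B); rewrite ?expr0n ?mul0r // expr1n mul1r expr_le1.
rewrite lerNl; apply: le_trans (FU s t _ _ x su tu (sq p (-1) _ p01) (sq q 1 _ q01)).
- rewrite -sumrN [X in X <= _]big_mkcond ler_sum // => b _.
  case: (b \in B); last by rewrite big1 // => b' _ /=; ring.
  rewrite -sumrN [X in X <= _]big_mkcond ler_sum // => b' _.
  by case: (b' \in B); rewrite le_eqVlt; apply/orP; left; apply/eqP => /=; ring.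
- by rewrite sqrrN expr1n.
- by rewrite expr1n.
Qed.

(** Whichever term [F] occupies, a translation of [x] by a combination of [b] and
    [b'] makes one of the two other terms depend on [b] alone and the other on
    [b'] alone. *)
Lemma count3_uniform_ge B c F f g : symmetric_set B ->
    (2 : G) \is a GRing.unit -> uniform_at B c F ->
    (forall x, 0 <= f x <= 1) -> (forall x, 0 <= g x <= 1) ->
  [/\ - (N * c) <= count3 B F f g, - (N * c) <= count3 B f F g
    & - (N * c) <= count3 B f g F].
Proof.
move=> BN u2 FU f01 g01.
have sumNc (E : G -> R) : (forall x, - c <= E x) -> - (N * c) <= \sum_x E x.
  by move=> h; rewrite -mulrN mulr_natl -sumr_const; apply: ler_sum.
split; rewrite /count3.
- rewrite (shift_sum3 _ _ (fun b b' => - b - 2 * b')).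
  apply: sumNc => x; rewrite exchange_big /=.
  apply: le_trans (uniform_at_ge (s := -2) (t := -1) x FU _ _
      (fun b => f01 (x - b)) (fun b => g01 (x + b))) _; rewrite ?unitrN ?unitr1 //.
  rewrite ler_sum // => b _; rewrite ler_sum // => b' _.
  rewrite le_eqVlt; apply/orP; left; apply/eqP.
  have -> : x + (- b' - 2 * b) + (b' + b) = x - b by ring.
  have -> : x + (- b' - 2 * b) + 2 * (b' + b) = x + b' by ring.
  have -> : x + (- b' - 2 * b) = x + -2 * b + -1 * b' by ring.
  by ring.
- rewrite (shift_sum3 _ _ (fun b b' => - 2 * b)).
  apply: sumNc => x.
  apply: le_trans (uniform_at_ge (s := -1) (t := 1) x FU _ _
      (fun b => f01 (x - 2 * b)) (fun b => g01 (x + 2 * b))) _; rewrite ?unitrN ?unitr1 //.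
  rewrite ler_sum // => b _; rewrite ler_sum // => b' _.
  rewrite le_eqVlt; apply/orP; left; apply/eqP.
  have -> : x + -2 * b + (b + b') = x + -1 * b + 1 * b' by ring.
  have -> : x + -2 * b + 2 * (b + b') = x + 2 * b' by ring.
  have -> : x + -2 * b = x - 2 * b by ring.
  by ring.
- rewrite (shift_sum3 _ _ (fun b b' => - b)).
  apply: sumNc => x.
  apply: le_trans (uniform_at_ge (s := 1) (t := 2) x FU _ _
      (fun b => f01 (x - b)) (fun b => g01 (x + b))) _; rewrite ?unitrN ?unitr1 //.
  rewrite ler_sum // => b _; rewrite ler_sum // => b' _.
  rewrite le_eqVlt; apply/orP; left; apply/eqP.
  have -> : x + - b + (b + b') = x + b' by ring.
  have -> : x + - b + 2 * (b + b') = x + 1 * b + 2 * b' by ring.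
  by ring.
Qed.

Definition energy f B : R := \sum_x bavg B 1 f x ^+ 3.

(** Equality holds when two of the variables agree and the third is equal to them
    or vanishes; this is the extremal behaviour that limits the growth of energy. *)
Lemma schur (a b c : R) : 0 <= a -> 0 <= b -> 0 <= c ->
  a ^+ 2 * b + a * b ^+ 2 + b ^+ 2 * c + b * c ^+ 2 + a ^+ 2 * c + a * c ^+ 2
    <= a ^+ 3 + b ^+ 3 + c ^+ 3 + 3 * (a * b * c).
Proof.
wlog ab : a b c / b <= a => [wl a0 b0 c0|].
  have [ab|/ltW ba] := leP b a; first exact: wl.
  by have := wl b a c ba b0 a0 c0; lra.
(* For a >= b >= c both terms of the decomposition below are nonnegative. *)
wlog bc : a b c ab / c <= b => [wl a0 b0 c0|].
  have [bc|/ltW cb] := leP c b; first exact: wl.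
  have [ac|/ltW ca] := leP c a.
    by have := wl a c b ac cb a0 c0 b0; lra.
  by have := wl c a b ca ab c0 a0 b0; lra.
move=> a0 b0 c0; rewrite -subr_ge0.
set E := (X in 0 <= X).
have -> : E = (a - b) ^+ 2 * (a + b - c) + c * ((a - c) * (b - c)).
  by rewrite /E; ring.
apply: addr_ge0; last by rewrite !mulr_ge0 ?subr_ge0 // (le_trans bc).
by rewrite mulr_ge0 ?sqr_ge0 // -addrA addr_ge0 // subr_ge0.
Qed.

(** Schur's inequality summed over the progressions. Each mixed term becomes a
    product of the averages of [g^2] and [g], which is at least the cube of the
    average of [g]. *)
Lemma schur_count B g : B != set0 -> symmetric_set B -> (forall x, 0 <= g x) ->
  4 * \sum_x bavg B 1 g x ^+ 3 + 2 * \sum_x bavg B 2 g x ^+ 3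
    <= 3 * \sum_x g x ^+ 3 + 3 * (count3 B g g g / #|B|%:R ^+ 2).
Proof.
move=> B0 BN g0; have b0 := card_gt0R (R := R) B0.
have b2 : 0 < #|B|%:R ^+ 2 :> R by rewrite exprn_gt0.
have bn0 : #|B|%:R != 0 :> R by rewrite gt_eqF.
pose S (E : G -> G -> R) := \sum_x \sum_(b in B) \sum_(b' in B) E x (b + b').
have SD E1 E2 : S (fun x d => E1 x d + E2 x d) = S E1 + S E2.
  rewrite /S -big_split; apply: eq_bigr => x _; rewrite -big_split.
  by apply: eq_bigr => b _; rewrite -big_split.
have Sshift (E : G -> G -> R) (r : G) : S E = S (fun x d => E (x + r * d) d).
  by rewrite /S (shift_sum3 _ _ (fun b b' => r * (b + b'))).
have S3 (r : G) : S (fun x d => g (x + r * d) ^+ 3) = #|B|%:R ^+ 2 * \sum_x g x ^+ 3.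
  rewrite -(Sshift (fun x d => g x ^+ 3)) /S mulr_sumr; apply: eq_bigr => x _.
  rewrite !sumr_const -[_ *+ _ *+ _]mulr_natl -[g x ^+ 3 *+ _]mulr_natl.
  by rewrite mulrA -expr2.
have pair (t : G) : #|B|%:R ^+ 2 * \sum_x bavg B t g x ^+ 3
    <= S (fun x d => g x ^+ 2 * g (x + t * d)) /\
    #|B|%:R ^+ 2 * \sum_x bavg B t g x ^+ 3
    <= S (fun x d => g x * g (x + t * d) ^+ 2).
  rewrite /S (pair_correlation t (fun x => g x ^+ 2)) //.
  rewrite (pair_correlation t g (fun x => g x ^+ 2)) //.
  rewrite !ler_pM2l //; split; rewrite ler_sum // => x _; rewrite exprS.
    rewrite mulrC ler_wpM2r ?bavg_sqr_le_bavg //.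
    by rewrite -(bavg_cst t 0 x B0) le_bavg.
  by rewrite ler_wpM2l ?bavg_sqr_le_bavg // -(bavg_cst t 0 x B0) le_bavg.
have eqS E1 E2 : (forall x d, E1 x d = E2 x d) -> S E1 = S E2.
  move=> e; apply: eq_bigr => x _; apply: eq_bigr => b _.
  by apply: eq_bigr => b' _; apply: e.
have [p1 p2] := pair 1; have [p3 p4] := pair 2.
have shift1 E : S E = S (fun x d => E (x - d) d).
  by rewrite (Sshift _ (-1)); apply: eqS => x d; rewrite mulN1r.
have [q1 q2] : S (fun x d => g x ^+ 2 * g (x + 1 * d))
      = S (fun x d => g (x + d) ^+ 2 * g (x + 2 * d)) /\
    S (fun x d => g x * g (x + 1 * d) ^+ 2)
      = S (fun x d => g (x + d) * g (x + 2 * d) ^+ 2).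
  split; rewrite [RHS]shift1; apply: eqS => x d; rewrite subrK;
  by congr (_ * g _ ^+ _) || congr (_ * g _); ring.
have mainS : S (fun x d => g x ^+ 2 * g (x + 1 * d) + g x * g (x + 1 * d) ^+ 2
      + g (x + d) ^+ 2 * g (x + 2 * d) + g (x + d) * g (x + 2 * d) ^+ 2
      + g x ^+ 2 * g (x + 2 * d) + g x * g (x + 2 * d) ^+ 2)
   <= S (fun x d => g (x + 0 * d) ^+ 3 + g (x + 1 * d) ^+ 3 + g (x + 2 * d) ^+ 3
      + (g x * g (x + d) * g (x + 2 * d) + (g x * g (x + d) * g (x + 2 * d)
      + g x * g (x + d) * g (x + 2 * d)))).
  rewrite /S; do 3 (apply: ler_sum => ? _); rewrite mul1r mul0r addr0.
  by apply: le_trans (schur (g0 _) (g0 _) (g0 _)) _; rewrite le_eqVlt; apply/orP; left; apply/eqP; ring.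
rewrite !SD -q1 -q2 !S3 -/(count3 B g g g) in mainS.
rewrite -(ler_pM2l b2).
have -> : #|B|%:R ^+ 2 * (3 * \sum_x g x ^+ 3 + 3 * (count3 B g g g / #|B|%:R ^+ 2))
  = 3 * (#|B|%:R ^+ 2 * \sum_x g x ^+ 3) + 3 * count3 B g g g by field; rewrite bn0.
have -> : #|B|%:R ^+ 2 * (4 * \sum_x bavg B 1 g x ^+ 3 + 2 * \sum_x bavg B 2 g x ^+ 3)
  = 4 * (#|B|%:R ^+ 2 * \sum_x bavg B 1 g x ^+ 3)
    + 2 * (#|B|%:R ^+ 2 * \sum_x bavg B 2 g x ^+ 3) by ring.
have cE : S (fun x d => g x * g (x + d) * g (x + 2 * d)) = count3 B g g g by [].
move: p1 p2 p3 p4 mainS; rewrite cE; lra.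
Qed.

Lemma refines_L1 k f B B' t : (0 < k)%N -> refines k f B B' -> t = 1 \/ t = 2 ->
  \sum_x `|bavg B' t (bavg B 1 f) x - bavg B 1 f x| <= N / k%:R.
Proof. by move=> k0 [_ _ _ h] /h; apply: sum_norm_le_of_sqr. Qed.

(** By Jensen's inequality the sum of cubes decreases when one averages again over
    [B1] and then over [B0]. After the first of these averages [B2] is absorbed by
    [B1], and after the second [B1] and [t B1] are absorbed by [B0], each at a cost
    of [3 N / k]. *)
Lemma mean_cube_chain k f B0 B1 B2 t : (0 < k)%N ->
    (forall x, 0 <= f x <= 1) -> B0 != set0 ->
    refines k f B0 B1 -> refines k f B1 B2 -> t = 1 \/ t = 2 ->
  energy f B0 - 9 * (N / k%:R) <= \sum_x bavg B1 t (bavg B2 1 f) x ^+ 3.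
Proof.
move=> k0 f01 B00 r01 r12 t12.
have B10 : B1 != set0 by apply/set0Pn; exists 0; case: r01.
have B20 : B2 != set0 by apply/set0Pn; exists 0; case: r12.
have i1 : (1 : G) = 1 \/ (1 : G) = 2 by left.
have e1 := refines_L1 k0 r12 i1.
have e2 := refines_L1 k0 r01 t12.
have e3 := refines_L1 k0 r01 i1.
have A B t' h x : B != set0 -> (forall y, 0 <= h y <= 1) -> 0 <= bavg B t' h x <= 1 :=
  @bavg01 R n B t' h x.
have ge0 h : (forall x, 0 <= h x <= 1) -> forall x, 0 <= h x.
  by move=> h01 x; have /andP[] := h01 x.
have contr B t' h h' : B != set0 ->
    \sum_x `|bavg B t' h x - bavg B t' h' x| <= \sum_x `|h x - h' x|.
  move=> Bn0; apply: le_trans (sum_bavg_norm_le t' (fun x => h x - h' x) Bn0).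
  apply: ler_sum => x _; rewrite -[bavg B t' h' x]mul1r -mulNr -bavgZ -bavgD.
  by rewrite le_eqVlt; apply/orP; left; apply/eqP; congr `|_|; apply: eq_bavg => y; ring.
(* Jensen over B1, then B2 is absorbed. *)
have s1 : \sum_x bavg B1 t (bavg B2 1 (bavg B1 1 f)) x ^+ 3
    <= \sum_x bavg B1 t (bavg B2 1 f) x ^+ 3.
  have := sum_bavg_cube_le 1 B10 (ge0 _ (fun x => A B1 t _ x B10 (fun y => A B2 1 f y B20 f01))).
  apply: le_trans; rewrite le_eqVlt; apply/orP; left; apply/eqP; apply: eq_bigr => x _.
  by rewrite [in RHS]bavgC; congr (_ ^+ 3); apply: eq_bavg => y; rewrite bavgC.
have s2 := sum_cube_stable
  (fun x => A B1 t _ x B10 (fun y => A B2 1 _ y B20 (fun z => A B1 1 f z B10 f01)))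
  (fun x => A B1 t _ x B10 (fun y => A B1 1 f y B10 f01)).
have c2 := contr B1 t (bavg B2 1 (bavg B1 1 f)) (bavg B1 1 f) B10.
(* Jensen over B0, then t B1 and B1 are absorbed. *)
have s3 : \sum_x bavg B1 1 (bavg B1 t (bavg B0 1 f)) x ^+ 3
    <= \sum_x bavg B1 t (bavg B1 1 f) x ^+ 3.
  have := sum_bavg_cube_le 1 B00 (ge0 _ (fun x => A B1 t _ x B10 (fun y => A B1 1 f y B10 f01))).
  apply: le_trans; rewrite le_eqVlt; apply/orP; left; apply/eqP; apply: eq_bigr => x _.
  rewrite [in RHS]bavgC bavgC; congr (_ ^+ 3); apply: eq_bavg => y.
  by rewrite bavgC.
have s4 := sum_cube_stable
  (fun x => A B1 1 _ x B10 (fun y => A B1 t _ y B10 (fun z => A B0 1 f z B00 f01)))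
  (fun x => A B1 1 _ x B10 (fun y => A B0 1 f y B00 f01)).
have c4 := contr B1 1 (bavg B1 t (bavg B0 1 f)) (bavg B0 1 f) B10.
have s5 := sum_cube_stable
  (fun x => A B1 1 _ x B10 (fun y => A B0 1 f y B00 f01)) (fun y => A B0 1 f y B00 f01).
rewrite -/(energy f B0) in s5; lra.
Qed.

(** Few progressions with difference in [B1 + B1] thus force the energy at the
    scale [B2] to exceed twice the energy at the scale [B0], up to the count. *)
Lemma count3_lower k f B0 B1 B2 : (0 < k)%N -> (2 : G) \is a GRing.unit ->
    (forall x, 0 <= f x <= 1) -> B0 != set0 ->
    refines k f B0 B1 -> refines k f B1 B2 ->
  #|B1|%:R ^+ 2 * (2 * energy f B0 - energy f B2 - 21 * (N / k%:R))
    <= count3 B1 f f f.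
Proof.
move=> k0 u2 f01 B00 r01 r12.
have B10 : B1 != set0 by apply/set0Pn; exists 0; case: r01.
have B20 : B2 != set0 by apply/set0Pn; exists 0; case: r12.
have B1N : symmetric_set B1 by case: r01.
have kn0 : k%:R != 0 :> R by rewrite gt_eqF // ltr0n.
have b1 := card_gt0R (R := R) B10; have b1n0 : #|B1|%:R != 0 :> R by rewrite gt_eqF.
set g := bavg B2 1 f; have g01 x : 0 <= g x <= 1 by apply: bavg01.
have g0 x : 0 <= g x by have /andP[] := g01 x.
have [_ _ FU _] := r12.
have [h1 _ _] := count3_uniform_ge B1N u2 FU f01 f01.
have [_ h2 _] := count3_uniform_ge B1N u2 FU g01 f01.
have [_ _ h3] := count3_uniform_ge B1N u2 FU g01 g01.
rewrite -/g in h1 h2 h3.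
(* One term of the progression is replaced at a time. *)
have tele : count3 B1 f f f = count3 B1 g g g +
   (count3 B1 (fun x => f x - g x) f f + (count3 B1 g (fun x => f x - g x) f
   + count3 B1 g g (fun x => f x - g x))).
  rewrite /count3 -!big_split; apply: eq_bigr => x _; rewrite -!big_split.
  apply: eq_bigr => b _; rewrite -!big_split; apply: eq_bigr => b' _ /=; ring.
have sc := schur_count B10 B1N g0.
have m1 := mean_cube_chain k0 f01 B00 r01 r12 (or_introl (erefl (1 : G))).
have m2 := mean_cube_chain k0 f01 B00 r01 r12 (or_intror (erefl (2 : G))).
rewrite -/g -/(energy f B2) in m1 m2 sc.
have lam : 2 * energy f B0 - energy f B2 - 18 * (N / k%:R)
    <= count3 B1 g g g / #|B1|%:R ^+ 2 by rewrite /energy -/g in sc m1 m2 *; lra.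
rewrite ler_pdivlMr ?exprn_gt0 // mulrC in lam.
rewrite tele; have e : N * (#|B1|%:R ^+ 2 / k%:R) = #|B1|%:R ^+ 2 * (N / k%:R) :> R.
  by field; rewrite kn0.
rewrite e in h1 h2 h3; lra.
Qed.

End MainInequality.

(** * Energy increment in cyclic groups of odd order *)

Definition scale_loss (k w : nat) : nat := ((8 * w * k).+1 ^ (16 * (w * k) ^ 2).+1)%N.

Lemma leq_scale_loss k w : (0 < k)%N -> (w <= scale_loss k w)%N.
Proof.
case: w => // w k0; apply: leq_trans (_ : (8 * w.+1 * k).+1 <= _)%N.
  by rewrite leqW // mulnAC leq_pmull // muln_gt0 k0.
by rewrite /scale_loss -[X in (X <= _)%N]expn1 leq_exp2l // ltnS !muln_gt0 k0.
Qed.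

Section Popular.
Context {R : realType} {n : nat}.
Hypothesis n_gt1 : (1 < n)%N.
Local Notation G := 'Z_n.
Local Notation N := (#|'Z_n|%:R).
Hypothesis two_unit : (2 : G) \is a GRing.unit.

Definition aps (T : finZmodType) (A : {set T}) (d : T) : {set T} :=
  [set x | [&& x \in A, x + d \in A & x + d *+ 2 \in A]].

Definition indicator (A : {set G}) (x : G) : R := (x \in A)%:R.

Lemma indicator01 A x : 0 <= indicator A x <= 1.
Proof. by rewrite /indicator ler0n lern1 leq_b1. Qed.

Lemma near_zeroW m m' (b : G) : (m <= m')%N -> near_zero m' b -> near_zero m b.
Proof.
move=> mm /orP[h|h]; apply/orP; [left|right]; apply: leq_trans h;
by rewrite leq_mul2l mm orbT.
Qed.

Lemma count3_indicator A (B : {set G}) :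
  count3 B (indicator A) (indicator A) (indicator A)
    = \sum_(b in B) \sum_(b' in B) #|aps A (b + b')|%:R.
Proof.
rewrite /count3 exchange_big /=; apply: eq_bigr => b _.
rewrite exchange_big /=; apply: eq_bigr => b' _.
rewrite -sum1_card natr_sum [RHS]big_mkcond; apply: eq_bigr => x _.
rewrite inE /indicator [2 * _]mulr_natl.
by do 3 case: (_ \in A); rewrite /= ?mulr0 ?mul0r ?mul1r.
Qed.

Variables (A : {set G}) (k : nat).
Hypothesis k_gt0 : (0 < k)%N.
Let al : R := #|A|%:R / N.

Hypothesis few : forall b b' : G,
  near_zero (4 * k) b -> near_zero (4 * k) b' -> b + b' != 0 ->
  #|aps A (b + b')|%:R <= N * (al ^+ 3 - 23 / k%:R).

(** The difference zero comes from at most [#|B|] of the [#|B|^2] pairs, which is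
    negligible once [#|B|] exceeds a multiple of [k]. *)
Lemma count3_upper (B : {set G}) : B != set0 -> (24 * k <= #|B|)%N ->
    (forall b, b \in B -> near_zero (4 * k) b) ->
  count3 B (indicator A) (indicator A) (indicator A)
    <= #|B|%:R ^+ 2 * (N * (al ^+ 3 - 22 / k%:R)).
Proof.
move=> B0 kB Bz; have b1 := card_gt0R (R := R) B0.
have N0 : 0 < N :> R by rewrite ltr0n card_ord.
have k1 : 0 < k%:R :> R by rewrite ltr0n.
have bn0 : #|B|%:R != 0 :> R by rewrite gt_eqF.
pose tau := N * (al ^+ 3 - 23 / k%:R); have few' := few.
rewrite -/tau in few'.
have al0 : 0 <= al by rewrite divr_ge0.
have one (b : G) : b \in B ->
    \sum_(b' in B) #|aps A (b + b')|%:R <= #|B|%:R * tau + (N - tau).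
  move=> bB; have tauN : tau <= N.
    rewrite -[X in _ <= X]mulr1 ler_wpM2l ?ltW //.
    have : al ^+ 3 <= 1.
      by rewrite expr_le1 // /al ler_pdivrMr // mul1r ler_nat max_card.
    have : 0 < 23 / k%:R :> R by rewrite divr_gt0.
    lra.
  apply: le_trans (_ : \sum_(b' in B) (tau + (b' == - b)%:R * (N - tau)) <= _).
    apply: ler_sum => b' b'B; have [e|ne] := eqVneq b' (- b).
      by rewrite mul1r addrCA subrr addr0 ler_nat max_card.
    rewrite mul0r addr0; apply: few'; [exact: Bz|exact: Bz|].
    by apply: contra ne => /eqP e; rewrite -[b'](addKr b) e addr0.
  rewrite big_split /= sumr_const -[tau *+ _]mulr_natl lerD2l -mulr_suml.
  rewrite -[X in _ <= X]mul1r ler_wpM2r ?subr_ge0 // -natr_sum lern1.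
  rewrite big_mkcond (bigD1 (- b)) //= eqxx big1 => [|b' /negPf ->].
    by case: ifP.
  by case: ifP.
rewrite count3_indicator; apply: le_trans; first by apply: ler_sum; apply: one.
rewrite sumr_const -[X in X <= _]mulr_natl.
have tau24 : (N - tau) / #|B|%:R <= N / k%:R.
  have kB' : 24 * k%:R <= #|B|%:R :> R by rewrite -natrM ler_nat.
  rewrite ler_pdivrMr // mulrAC ler_pdivlMr //.
  have : N - tau <= 24 * N.
    have k1' : k%:R^-1 <= 1 :> R by rewrite invf_le1 // ler1n.
    have : 0 <= N * al ^+ 3 by rewrite mulr_ge0 ?exprn_ge0 // ltW.
    have : N * k%:R^-1 <= N * 1 :> R by rewrite ler_pM2l.
    rewrite /tau mulrBr; lra.
  move=> h; apply: le_trans (ler_wpM2r (ltW k1) h) _.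
  have -> : 24 * N * k%:R = N * (24 * k%:R) :> R by ring.
  by rewrite ler_pM2l.
have -> : #|B|%:R * (#|B|%:R * tau + (N - tau))
  = #|B|%:R ^+ 2 * (tau + (N - tau) / #|B|%:R) by field; rewrite bn0.
rewrite ler_pM2l ?exprn_gt0 //.
have -> : N * (al ^+ 3 - 22 / k%:R) = tau + N / k%:R by rewrite /tau; ring.
by rewrite lerD2l.
Qed.

Lemma energy_setT : energy (indicator A) setT = N * al ^+ 3.
Proof.
rewrite /energy; under eq_bigr => x _.
  have -> : bavg setT 1 (indicator A) x = al.
    rewrite /bavg cardsT /al; congr (_ / _).
    rewrite -sum1_card natr_sum [RHS]big_mkcond [RHS](reindex_inj (addrI x)) /=.
    rewrite big_mkcond; apply: eq_bigr => b _; rewrite inE mul1r /indicator.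
    by case: (_ \in A).
  over.
by rewrite sumr_const mulr_natl.
Qed.

Lemma energy_le (B : {set G}) : B != set0 -> energy (indicator A) B <= N.
Proof.
move=> B0; rewrite /energy -sumr_const; apply: ler_sum => x _.
by have /andP[h0 h1] := bavg01 (1 : G) x B0 (indicator01 A); rewrite expr_le1.
Qed.

(** The excess of the energy over [N al^3] doubles, because the count of
    progressions stays below [N al^3]. *)
Lemma energy_increment (B : {set G}) (w : nat) :
    B != set0 -> (0 < w)%N -> (#|G| <= w * #|B|)%N ->
    (24 * k * scale_loss k w <= #|G|)%N ->
  exists B2 : {set G}, [/\ B2 != set0,
    (#|{: G}| <= scale_loss k (scale_loss k w) * #|B2|)%N &
    2 * energy (indicator A) B - N * al ^+ 3 + N / k%:R <= energy (indicator A) B2].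
Proof.
move=> B0 w0 Bw big; have k1 : 0 < k%:R :> R by rewrite ltr0n.
have kw w' : (0 < w')%N -> (4 * k <= 4 * w' * k)%N by move=> ?; rewrite mulnAC leq_pmulr.
have [B1 [[B10 B1N B1z B1c] U1 L1]] := next_scale n_gt1 (indicator01 A) B0 k_gt0 w0 Bw.
rewrite -/(scale_loss k w) in B1c.
have B1n0 : B1 != set0 by apply/set0Pn; exists 0.
have w10 : (0 < scale_loss k w)%N by apply: leq_trans w0 (leq_scale_loss _ _).
have [B2 [[B20 B2N B2z B2c] U2 L2]] := next_scale n_gt1 (indicator01 A) B1n0 k_gt0 w10 B1c.
rewrite -/(scale_loss k (scale_loss k w)) in B2c.
exists B2; split=> //; first by apply/set0Pn; exists 0.
have low := count3_lower k_gt0 two_unit (indicator01 A) B0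
  (And4 B10 B1N U1 L1) (And4 B20 B2N U2 L2).
have kB1 : (24 * k <= #|B1|)%N.
  rewrite -(leq_pmul2l w10) mulnC; exact: leq_trans big B1c.
have up := count3_upper B1n0 kB1 (fun b bB => near_zeroW (kw w w0) (B1z b bB)).
have := le_trans low up; rewrite ler_pM2l ?exprn_gt0 ?card_gt0R //.
have -> : N * (al ^+ 3 - 22 / k%:R) = N * al ^+ 3 - 22 * (N / k%:R) by ring.
lra.
Qed.

Fixpoint scale_index (i : nat) : nat :=
  if i is i'.+1 then scale_loss k (scale_loss k (scale_index i')) else 1%N.

Lemma scale_index_gt0 i : (0 < scale_index i)%N.
Proof.
elim: i => //= i IH; apply: leq_trans IH _.
by apply: leq_trans (leq_scale_loss _ k_gt0) (leq_scale_loss _ k_gt0).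
Qed.

Lemma scale_index_mono i j : (i <= j)%N -> (scale_index i <= scale_index j)%N.
Proof.
move=> /subnKC <-; elim: (j - i)%N => [|d IH]; rewrite ?addn0 // addnS /=.
apply: leq_trans IH _.
by apply: leq_trans (leq_scale_loss _ k_gt0) (leq_scale_loss _ k_gt0).
Qed.

Lemma energy_growth (s : nat) : (24 * k * scale_index s <= #|{: G}|)%N ->
  exists B : {set G}, [/\ B != set0, (#|{: G}| <= scale_index s * #|B|)%N &
    N * al ^+ 3 + (2 ^+ s - 1) * (N / k%:R) <= energy (indicator A) B].
Proof.
elim: s => [_|s IH big].
  exists setT; rewrite energy_setT subrr mul0r addr0 cardsT mul1n.
  by split=> //; rewrite -card_gt0 cardsT card_ord.
have [|B [B0 Bc BE]] := IH.
  by apply: leq_trans big; rewrite leq_mul2l scale_index_mono ?orbT.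
have [|B2 [B20 B2c B2E]] := energy_increment B0 (scale_index_gt0 s) Bc.
  by apply: leq_trans big; rewrite leq_mul2l leq_scale_loss ?orbT.
exists B2; split=> //; apply: le_trans B2E; rewrite [2 ^+ s.+1]exprS.
have -> : (2 * 2 ^+ s - 1) * (N / k%:R)
  = 2 * ((2 ^+ s - 1) * (N / k%:R)) + N / k%:R :> R by ring.
lra.
Qed.

Lemma too_few_false (s : nat) :
  (k.+1 < 2 ^ s)%N -> (24 * k * scale_index s <= #|{: G}|)%N -> False.
Proof.
move=> ks big; have k1 : 0 < k%:R :> R by rewrite ltr0n.
have N0 : 0 < N :> R by rewrite ltr0n card_ord.
have [B [B0 _ BE]] := energy_growth big.
have := le_trans BE (energy_le B0).
have al0 : 0 <= al by rewrite divr_ge0.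
have h : 0 <= N * al ^+ 3 by rewrite mulr_ge0 ?exprn_ge0 // ltW.
have : k.+1%:R < 2 ^+ s :> R by rewrite -natrX ltr_nat.
rewrite -natr1 => h2.
have : k%:R * (N / k%:R) < (2 ^+ s - 1) * (N / k%:R) :> R.
  by rewrite ltr_pM2r ?divr_gt0 //; lra.
rewrite mulrCA divff ?gt_eqF // mulr1; lra.
Qed.

End Popular.

(** Otherwise the excess energy would double [s] times and outgrow [N]. *)
Theorem popular_difference_cyclic {R : realType} (n k s : nat) (A : {set 'Z_n}) :
    (1 < n)%N -> odd n -> (0 < k)%N -> (k.+1 < 2 ^ s)%N ->
    (24 * k * scale_index k s <= n)%N ->
  exists b b' : 'Z_n, [/\ near_zero (4 * k) b, near_zero (4 * k) b', b + b' != 0 &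
    n%:R * ((#|A|%:R / n%:R) ^+ 3 - 23 / k%:R) <= #|aps A (b + b')|%:R :> R].
Proof.
move=> n1 no k0 ks big.
have Nn : #|'Z_n| = n by rewrite card_ord Zp_cast.
have u2 : (2 : 'Z_n) \is a GRing.unit.
  by rewrite unitZpE // coprimen2.
have [h|h] := pselect (exists b b' : 'Z_n, [/\ near_zero (4 * k) b,
   near_zero (4 * k) b', b + b' != 0 &
    n%:R * ((#|A|%:R / n%:R) ^+ 3 - 23 / k%:R) <= #|aps A (b + b')|%:R :> R]) => //.
exfalso; apply: (@too_few_false R n n1 u2 A k k0 _ s ks); last by rewrite Nn.
move=> b b' hb hb' bb; rewrite leNgt; apply/negP => lt; apply: h.
exists b, b'; split=> //; have -> : n%:R = #|'Z_n|%:R :> R by rewrite Nn.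
exact: ltW.
Qed.

(** * From residues to integers *)

Section Transfer.
Context {n : nat}.
Hypothesis n_gt1 : (1 < n)%N.
Local Notation G := 'Z_n.

Lemma card_Zn : #|{: G}| = n.
Proof. by rewrite card_ord Zp_cast. Qed.

Lemma ltn_Zn (x : G) : (x < n)%N.
Proof. by have := ltn_ord x; rewrite [X in (_ < X)%N]Zp_cast. Qed.

Lemma near_zero_int m (b : G) : near_zero m b ->
  exists D : int, (`|D| * m <= n)%N /\ b = D%:~R.
Proof.
rewrite /near_zero card_Zn => /orP[h|h].
  by exists (b : nat)%:Z; split => //; rewrite -[RHS]/((b : nat)%:R) natr_Zp.
exists ((b : nat)%:Z - n%:Z); split.
  by have := ltn_Zn b; rewrite distnEr // ltnW // ltn_Zn.
rewrite rmorphB /= -![_%:~R]/(_%:R) natr_Zp pchar_Zp // subr0 //.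
Qed.

Lemma val_int_Zn (D : int) (y : nat) : D = y%:Z -> (y < n)%N ->
  nat_of_ord (D%:~R : G) = y.
Proof. by move=> -> yn; rewrite -[_%:~R]/(_%:R) val_Zp_nat // modn_small. Qed.

Definition residues (A : {fset int}) : {set G} := [set x : G | (x.+1)%:Z \in A].

Lemma card_residues_ge (A : {fset int}) : subset_interval n A ->
  (#|` A| <= #|residues A|)%N.
Proof.
move=> An; rewrite cardE -(size_map (fun x : G => (x.+1)%:Z)).
apply: uniq_leq_size; first exact: fset_uniq.
move=> a aA; have /andP[a1 a2] := An a aA.
have an : (`|a|.-1 < n)%N by lia.
apply/mapP; exists (`|a|.-1%:R : G).
  by rewrite mem_enum inE val_Zp_nat // modn_small //; have -> : `|a|.-1.+1%:Z = a by lia.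
by rewrite val_Zp_nat // modn_small //; lia.
Qed.

(** The progressions that wrap around start among the first or among the last
    [2 |D|] residues, according to the sign of [D]. *)
Lemma card_aps_le (A : {fset int}) (D : int) :
  (#|aps (residues A) (D%:~R)| <= num_3AP A D + 2 * `|D|)%N.
Proof.
pose good := [set x : G | (0 <= (x : nat)%:Z + 2 * D) && ((x : nat)%:Z + 2 * D < n%:Z)].
rewrite -(cardsID good) leq_add //.
  rewrite cardE -(size_map (fun x : G => (x.+1)%:Z)).
  apply: uniq_leq_size.
    rewrite map_inj_uniq ?enum_uniq // => x y e; apply: val_inj => /=; lia.
  move=> _ /mapP[x + ->]; rewrite mem_enum !inE => /andP[/and3P[xA xdA x2dA] /andP[g1 g2]].
  have xn := ltn_Zn x.
  have h (E : int) (y : nat) : (x : nat)%:Z + E = y%:Z -> (y < n)%N ->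
      nat_of_ord (x + E%:~R) = y.
    move=> e yn; rewrite -(@val_int_Zn _ _ e yn) rmorphD /=.
    by rewrite -[(x : nat)%:Z%:~R]/((x : nat)%:R) natr_Zp.
  have [y1 e1] : exists y1 : nat, (x : nat)%:Z + D = y1%:Z by exists (absz ((x : nat)%:Z + D)); lia.
  have [y2 e2] : exists y2 : nat, (x : nat)%:Z + 2 * D = y2%:Z by exists (absz ((x : nat)%:Z + 2 * D)); lia.
  rewrite (h _ y1) // in xdA; last by lia.
  have e3 : D%:~R *+ 2 = (2 * D)%:~R :> G by rewrite rmorphM /= mulr_natl.
  rewrite e3 (h _ y2) // in x2dA; last by lia.
  have -> : (x.+1%:Z + D = y1.+1%:Z)%R by lia.
  have -> : (x.+1%:Z + 2 * D = y2.+1%:Z)%R by lia.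
  by apply/and3P; split=> //; apply: xA.
have [D0|D0] := leP 0 D.
  pose f (i : 'I_(2 * `|D|)) : G := (n.-1 - i)%:R.
  apply: leq_trans (_ : #|f @: setT| <= _)%N; last first.
    by apply: leq_trans (leq_imset_card _ _) _; rewrite cardsT card_ord.
  apply: subset_leq_card; apply/subsetP => x; rewrite !inE => /andP[bad _].
  have xn := ltn_Zn x.
  have xl : (n.-1 - x < 2 * `|D|)%N by move: bad; lia.
  apply/imsetP; exists (Ordinal xl) => //; rewrite /f /=.
  have -> : (n.-1 - (n.-1 - x) = x)%N by lia.
  by rewrite natr_Zp.
pose f (i : 'I_(2 * `|D|)) : G := (i : nat)%:R.
apply: leq_trans (_ : #|f @: setT| <= _)%N; last first.
  by apply: leq_trans (leq_imset_card _ _) _; rewrite cardsT card_ord.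
apply: subset_leq_card; apply/subsetP => x; rewrite !inE => /andP[bad _].
have xn := ltn_Zn x.
have xl : (x < 2 * `|D|)%N by move: bad; lia.
by apply/imsetP; exists (Ordinal xl) => //; rewrite /f /= natr_Zp.
Qed.

End Transfer.

Lemma popular_difference_odd {R : realType} (n k s : nat) (A : {fset int}) :
    (1 < n)%N -> odd n -> (0 < k)%N -> (k.+1 < 2 ^ s)%N ->
    (24 * k * scale_index k s <= n)%N -> subset_interval n A ->
  exists d : int, d != 0 /\
    n%:R * ((#|` A|%:R / n%:R) ^+ 3 - 24 / k%:R) <= (num_3AP A d)%:R :> R.
Proof.
move=> n1 no k0 ks big An.
have [b [b' [hb hb' bb cnt]]] :=
  @popular_difference_cyclic R n k s (residues A) n1 no k0 ks big.
have [D [Dn bD]] := near_zero_int n1 hb; have [D' [Dn' bD']] := near_zero_int n1 hb'.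
have n0 : 0 < n%:R :> R by rewrite ltr0n ltnW.
have k1 : 0 < k%:R :> R by rewrite ltr0n.
exists (D + D'); split.
  by apply: contra bb => /eqP e; rewrite bD bD' -rmorphD /= e.
rewrite bD bD' -rmorphD /= in cnt.
have := card_aps_le n1 A (D + D'); rewrite -(ler_nat R) => h.
have := le_trans cnt h; rewrite natrD => {}h.
have hD : (2 * absz (D + D')%R)%N%:R <= n%:R / k%:R :> R.
  rewrite ler_pdivlMr // -natrM ler_nat; nia.
have hA : (#|` A|%:R / n%:R) ^+ 3 <= (#|residues A : {set 'Z_n}|%:R / n%:R) ^+ 3 :> R.
  rewrite lerXn2r ?nnegrE ?divr_ge0 // ler_pM2r ?invr_gt0 // ler_nat.
  exact: card_residues_ge.
have hA' : n%:R * (#|` A|%:R / n%:R) ^+ 3 <=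
  n%:R * (#|residues A : {set 'Z_n}|%:R / n%:R) ^+ 3 :> R by rewrite ler_pM2l.
rewrite !mulrBr in h *.
have e c : n%:R * (c / k%:R) = c * (n%:R / k%:R) :> R by rewrite mulrCA.
rewrite !e in h *; lra.
Qed.

(** * The upper bound *)

(** The modulus must be odd for [2] to be invertible; when [N] is even, [A] is seen
    as a subset of the first [N + 1] integers. *)
Lemma popular_from {R : realType} (eps : R) (k s : nat) :
    (0 < k)%N -> (k.+1 < 2 ^ s)%N -> 50 / k%:R <= eps ->
  popular_difference_from eps (24 * k * scale_index k s)%N.
Proof.
move=> k0 ks epsk N NN A AN; have k1 : 0 < k%:R :> R by rewrite ltr0n.
have kN : (24 * k <= N)%N.
  by apply: leq_trans NN; rewrite leq_pmulr // scale_index_gt0.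
have N1 : (1 < N)%N by lia.
have AcN : (#|` A| <= N)%N.
  by apply: leq_trans (card_residues_ge N1 AN) _; rewrite -[X in (_ <= X)%N](card_Zn N1) max_card.
have N0 : 0 < N%:R :> R by rewrite ltr0n ltnW.
have kNR : k%:R <= N%:R :> R by rewrite ler_nat; lia.
have ek : 50 * (N%:R / k%:R) <= eps * N%:R by rewrite mulrA mulrAC ler_pM2r.
have Nk : 1 <= N%:R / k%:R :> R by rewrite ler_pdivlMr // mul1r.
have e (m : nat) c : m%:R * (c / k%:R) = c * (m%:R / k%:R) :> R by rewrite mulrCA.
rewrite /density; have [oN|eN] := boolP (odd N).
  have [d [d0 hd]] := @popular_difference_odd R N k s A N1 oN k0 ks NN AN.
  exists d; split=> //; apply: le_trans hd.
  rewrite mulrC !mulrBr e [_ * eps]mulrC; lra.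
have N1' : (1 < N.+1)%N by lia.
have oN1 : odd N.+1 by rewrite /= eN.
have AN1 : subset_interval N.+1 A by move=> a /AN; lia.
have [d [d0 hd]] := @popular_difference_odd R N.+1 k s A N1' oN1 k0 ks (leqW NN) AN1.
exists d; split=> //; apply: le_trans hd.
rewrite mulrC !mulrBr e [_ * eps]mulrC -natr1.
set a : R := #|` A|%:R; have aN : a <= N%:R by rewrite ler_nat.
have a0 : 0 <= a by [].
have N10 : 0 < N%:R + 1 :> R by lra.
have Nn0 : N%:R != 0 :> R by rewrite gt_eqF.
have N1n0 : N%:R + 1 != 0 :> R by rewrite gt_eqF.
(* The passage from N to N + 1 costs at most two progressions. *)
have cube : N%:R * (a / N%:R) ^+ 3 <= (N%:R + 1) * (a / (N%:R + 1)) ^+ 3 + 2.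
  rewrite -subr_ge0.
  set r := a / N%:R; have r01 : 0 <= r <= 1.
    by rewrite divr_ge0 // ler_pdivrMr // mul1r.
  have r3 : 0 <= r ^+ 3 <= 1 by case/andP: r01 => ? ?; rewrite exprn_ge0 // expr_le1.
  have -> : (N%:R + 1) * (a / (N%:R + 1)) ^+ 3 + 2 - N%:R * r ^+ 3 =
    2 * (1 - r ^+ 3) + r ^+ 3 * ((3 * N%:R + 2) / (N%:R + 1) ^+ 2).
    by rewrite /r; field; rewrite Nn0 N1n0.
  case/andP: r3 => r30 r31; apply: addr_ge0; first by rewrite mulr_ge0 // subr_ge0.
  by rewrite mulr_ge0 // divr_ge0 ?sqr_ge0 //; lra.
rewrite mulrDl mul1r.
have : k%:R^-1 <= N%:R / k%:R :> R by rewrite ler_peMl ?invr_ge0 ?ler0n // ler1n ltnW.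
lra.
Qed.

Lemma tower_mono i j : (i <= j)%N -> (tower i <= tower j)%N.
Proof.
move=> /subnKC <-; elim: (j - i)%N => [|d IH]; rewrite ?addn0 // addnS /=.
by apply: leq_trans IH (ltnW (ltn_expl _ _)).
Qed.

(** With [T = tower h], the loss is at most [T ^ (3 T^6)], which three
    exponentials absorb. *)
Lemma scale_loss_tower k w h : (k <= tower h)%N -> (w <= tower h)%N ->
  (16 <= tower h)%N -> (scale_loss k w <= tower h.+3)%N.
Proof.
set T := tower h => kT wT T16; rewrite /scale_loss.
have wk : (w * k <= T * T)%N by apply: leq_mul.
have h1 : ((8 * w * k).+1 <= T ^ 3)%N.
  by rewrite -mulnA !expnS expn0 muln1; nia.
have h2 : ((16 * (w * k) ^ 2).+1 <= T ^ 6)%N.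
  have : ((w * k) ^ 2 <= (T * T) ^ 2)%N by rewrite leq_exp2r.
  move=> hX.
  have -> : (T ^ 6 = T ^ 2 * (T * T) ^ 2)%N by rewrite expnMn -!expnD.
  have : (256 <= T ^ 2)%N by rewrite -mulnn; nia.
  have : (0 < (T * T) ^ 2)%N by rewrite expn_gt0; lia.
  move: hX; move: ((w * k) ^ 2)%N ((T * T) ^ 2)%N (T ^ 2)%N => X Y Z; nia.
apply: leq_trans (_ : (T ^ 3) ^ (T ^ 6) <= _)%N.
  apply: leq_trans (_ : (T ^ 3) ^ (16 * (w * k) ^ 2).+1 <= _)%N.
    by rewrite leq_exp2r.
  by rewrite leq_exp2l // -[1%N](expn0 T) ltn_exp2l; lia.
have TT : (T < 2 ^ T)%N by apply: ltn_expl.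
apply: leq_trans (_ : (2 ^ T) ^ (3 * T ^ 6) <= _)%N.
  by rewrite -expnM leq_exp2r ?muln_gt0 ?expn_gt0 ?(leq_trans _ T16) // ltnW.
rewrite /= -/T -expnM leq_exp2l //.
apply: leq_trans (_ : T ^ 8 <= _)%N.
  rewrite mulnCA -expnS (expnS T 7) leq_mul2r; lia.
apply: leq_trans (_ : (2 ^ T) ^ 8 <= _)%N; first by rewrite leq_exp2r // ltnW.
rewrite -expnM leq_exp2l //.
have : (16 <= 2 ^ (T - 4))%N by rewrite -[16%N]/(2 ^ 4)%N leq_exp2l //; lia.
have : (T - 4 < 2 ^ (T - 4))%N by apply: ltn_expl.
have -> : (2 ^ T = 16 * 2 ^ (T - 4))%N by rewrite -[16%N]/(2 ^ 4)%N -expnD; congr expn; lia.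
lia.
Qed.

Lemma scale_index_tower k s h : (k <= tower h)%N -> (16 <= tower h)%N ->
  (24 * k * scale_index k s <= tower (h + 6 * s + 2))%N.
Proof.
move=> kT T16.
have idx : (scale_index k s <= tower (h + 6 * s))%N.
  elim: s => [|s IH]; first by rewrite muln0 addn0; apply: leq_trans T16.
  have hm : (tower h <= tower (h + 6 * s))%N by apply: tower_mono; apply: leq_addr.
  have -> : (h + 6 * s.+1 = (h + 6 * s).+3.+3)%N by lia.
  have m3 : (tower (h + 6 * s) <= tower (h + 6 * s).+3)%N by apply: tower_mono; lia.
  apply: scale_loss_tower; [| |]; last 2 first.
  - by apply: scale_loss_tower => //; apply: leq_trans hm.
  - by apply: leq_trans T16 _; apply: leq_trans hm m3.
  by apply: leq_trans kT _; apply: leq_trans hm m3.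
have hm : (tower h <= tower (h + 6 * s))%N by apply: tower_mono; apply: leq_addr.
rewrite !addnS addn0 /=; set T := tower (h + 6 * s) in idx hm *.
have T16' : (16 <= T)%N by apply: leq_trans T16 hm.
apply: leq_trans (_ : T ^ 4 <= _)%N.
  have kT' : (k <= T)%N by apply: leq_trans kT hm.
  rewrite -mulnA; apply: leq_trans (_ : (T * T) * (T * T) <= _)%N; last first.
    by rewrite !expnS expn0 muln1 !mulnA.
  by apply: leq_mul; [nia|apply: leq_mul].
apply: leq_trans (_ : (2 ^ T) ^ 4 <= _)%N; first by rewrite leq_exp2r // ltnW // ltn_expl.
rewrite -expnM leq_exp2l //.
have : (16 <= 2 ^ (T - 4))%N by rewrite -[16%N]/(2 ^ 4)%N leq_exp2l //; lia.
have : (T - 4 < 2 ^ (T - 4))%N by apply: ltn_expl.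
have -> : (2 ^ T = 16 * 2 ^ (T - 4))%N by rewrite -[16%N]/(2 ^ 4)%N -expnD; congr expn; lia.
lia.
Qed.

(** The [s] doublings, [s] close to [log_2 (1 / eps)], cost six exponentials each. *)
Lemma upper_bound {R : realType} : exists2 C : R, 0 < C &
  forall eps : R, 0 < eps -> eps < 1 / 2 ->
    popular_difference_from eps (towerR (C * ln (1 / eps))).
Proof.
have hE i : (i + 3 + 6 * i + 2 = 7 * i + 5)%N by lia.
have ln2 : 0 < ln (2 : R) by rewrite ln_gt0 // ltr1n.
exists (61 / ln 2); first by rewrite divr_gt0.
move=> eps e0 e2; have i0 : 0 < 1 / eps by rewrite divr_gt0.
have i2 : 2 <= 1 / eps by rewrite ler_pdivlMr //; lra.
have x2 : ln 2 <= ln (1 / eps) by rewrite ler_ln ?posrE.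
set k := (Num.truncn (50 / eps)).+1; set s := (trunc_log 2 k.+1).+1.
have e50 : 0 <= 50 / eps by rewrite divr_ge0 // ltW.
have /andP[k1 k2] := truncn_itv e50; rewrite -/k in k2.
have kR : k%:R <= 50 / eps + 1 by rewrite /k -natr1; lra.
have ks : (k.+1 < 2 ^ s)%N by apply: trunc_log_ltn.
have sk : (2 ^ s.-1 <= k.+1)%N by apply: trunc_logP.
have sR : (s%:R - 7) * ln 2 <= ln (1 / eps).
  have h : 2 ^+ s.-1 <= 2 ^+ 6 * (1 / eps).
    have : (2 ^ s.-1)%:R <= k.+1%:R :> R by rewrite ler_nat.
    rewrite natrX -natr1 => h; apply: le_trans h _; apply: le_trans (_ : 50 / eps + 2 <= _).
      by move: kR; lra.
    have -> : 50 / eps = 50 * (1 / eps) by rewrite mulrA mulr1.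
    have -> : (2 : R) ^+ 6 = 64 by rewrite -natrX.
    lra.
  have p1 m : 0 < 2 ^+ m :> R by rewrite exprn_gt0.
  have p2 : 0 < 2 ^+ 6 * (1 / eps) by rewrite mulr_gt0.
  have : ln (2 ^+ s.-1) <= ln (2 ^+ 6 * (1 / eps)) by rewrite ler_ln ?posrE.
  rewrite lnM ?posrE ?exprn_gt0 // !lnXn //.
  have -> : s%:R - 7 = s.-1%:R - 6 :> R by rewrite /s /= -natr1; ring.
  rewrite -![ln 2 *+ _]mulr_natr; lra.
have fl : (s + 3 + 6 * s + 2 <= Num.truncn (61 / ln 2 * ln (1 / eps)))%N.
  rewrite truncn_ge_nat; last by rewrite mulr_ge0 ?divr_ge0 // ltW // (lt_le_trans ln2).
  rewrite mulrAC ler_pdivlMr // -(ler_pM2l (_ : 0 < 1 / 61)) //; last by lra.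
  rewrite hE natrD natrM; lra.
have ke : 50 / k%:R <= eps.
  by rewrite ler_pdivrMr ?ltr0n // mulrC -ler_pdivrMr // ltW.
move=> N NN A AN; apply: (popular_from (isT : (0 < k)%N) ks ke) AN.
apply: leq_trans NN; apply: leq_trans (tower_mono fl).
have kt : (k <= tower (s + 3))%N.
  rewrite addnS /=; apply: leq_trans (_ : 2 ^ s <= _)%N; first by apply: ltnW; apply: ltnW.
  rewrite leq_exp2l // addn2 /=.
  have : (s < 2 ^ s)%N by apply: ltn_expl.
  have : (s <= tower s)%N by elim: (s) => //= i IH; apply: leq_ltn_trans IH (ltn_expl _ _).
  move=> h1 _; apply: leq_trans h1 _; apply: leq_trans (ltnW (ltn_expl _ (isT : 1 < 2)%N)) _.
  exact: ltnW (ltn_expl _ _).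
apply: scale_index_tower => //.
by apply: leq_trans (_ : tower 3 <= _)%N => //; apply: tower_mono; rewrite leq_addl.
Qed.

(** * Concentration for functions of independent coordinates *)

Lemma expR_le_quadratic {R : realType} (u : R) : `|u| <= 1 / 2 ->
  expR u <= 1 + u + 2 * u ^+ 2.
Proof.
rewrite ler_norml => /andP[u1 u2].
have u10 : 0 < 1 - u by lra.
have h : expR u <= (1 - u)^-1.
  have := expR_ge1Dx (- u); rewrite expRN => h.
  by rewrite -[expR u]invrK lef_pV2 ?posrE ?invr_gt0 ?expR_gt0.
apply: le_trans h _; rewrite -(ler_pM2r u10) mulVf ?gt_eqF // -subr_ge0.
have -> : (1 + u + 2 * u ^+ 2) * (1 - u) - 1 = u ^+ 2 * (1 - 2 * u) by ring.
by rewrite mulr_ge0 ?sqr_ge0 //; lra.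
Qed.

Section BoundedDifferences.
Context {R : realType} {I : finType} {Om : finZmodType}.
Local Notation T := {ffun I -> Om}.
Implicit Types (F H : T -> R) (w : T) (i j : I) (o : Om).

Definition at_coord i o : T := [ffun j => if j == i then o else 0].

Lemma at_coordD i o o' : at_coord i (o + o') = at_coord i o + at_coord i o'.
Proof. by apply/ffunP => j; rewrite !ffunE; case: eqP; rewrite ?addr0. Qed.

Definition bounded_diff (c : R) F : Prop :=
  forall w i o, `|F (w + at_coord i o) - F w| <= c.

(** The conditional expectation given all coordinates but [i]. It is written with
    translations of the product group, so that sums over the product space can be
    reindexed without splitting off a coordinate. *)
Definition resample i F w : R := (\sum_o F (w + at_coord i o)) / #|Om|%:R.

Lemma cardOm_gt0 : 0 < #|Om|%:R :> R.
Proof. by rewrite ltr0n; apply/card_gt0P; exists 0. Qed.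

Lemma sum_resample i F : \sum_(w : T) resample i F w = \sum_(w : T) F w.
Proof.
rewrite -mulr_suml exchange_big /=.
under eq_bigr => o _.
  have <- : \sum_(w : T) F w = \sum_(w : T) F (w + at_coord i o) by rewrite (reindex_inj (addIr (at_coord i o))).
  over.
by rewrite sumr_const -[X in X / _]mulr_natr mulfK // gt_eqF // cardOm_gt0.
Qed.

Lemma mean_norm_le (f : Om -> R) c : (forall o, `|f o| <= c) ->
  `|(\sum_o f o) / #|Om|%:R| <= c.
Proof.
move=> h; have N0 := cardOm_gt0; rewrite normrM [X in _ * X]ger0_norm ?invr_ge0 ?ler0n //.
rewrite ler_pdivrMr // mulr_natr -sumr_const; apply: le_trans (ler_norm_sum _ _ _) _.
exact: ler_sum.
Qed.

Lemma resample_bounded_diff c i F : bounded_diff c F -> bounded_diff c (resample i F).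
Proof.
move=> h w j o; rewrite /resample -mulrBl -sumrB; apply: mean_norm_le => o'.
by rewrite addrAC; apply: h.
Qed.

Lemma resample_near c i F w o : bounded_diff c F ->
  `|F (w + at_coord i o) - resample i F w| <= c.
Proof.
move=> h; have N0 := cardOm_gt0.
have -> : F (w + at_coord i o) - resample i F w
    = (\sum_o' (F (w + at_coord i o) - F (w + at_coord i o'))) / #|Om|%:R.
  rewrite sumrB mulrBl sumr_const -[X in X / _ - _]mulr_natr mulfK // gt_eqF //.
apply: mean_norm_le => o'; rewrite distrC.
have -> : w + at_coord i o' = w + at_coord i o + at_coord i (o' - o).
  by rewrite -addrA -at_coordD [o + _]addrC subrK.
exact: h.
Qed.

Lemma sum_expR_resample c lam i F : bounded_diff c F -> 0 <= lam -> lam * c <= 1 / 2 ->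
  \sum_(w : T) expR (lam * F w)
    <= expR (2 * (lam * c) ^+ 2) * \sum_(w : T) expR (lam * resample i F w).
Proof.
move=> h l0 lc; have N0 := cardOm_gt0.
rewrite -(sum_resample i) mulr_sumr; apply: ler_sum => w _.
rewrite /(resample i _) ler_pdivrMr //.
set m := resample i F w.
pose u o := lam * (F (w + at_coord i o) - m).
have uc o : `|u o| <= lam * c.
  by rewrite normrM (ger0_norm l0) ler_wpM2l // resample_near.
have -> : \sum_o expR (lam * F (w + at_coord i o)) = expR (lam * m) * \sum_o expR (u o).
  rewrite mulr_sumr; apply: eq_bigr => o _; rewrite -expRD; congr expR.
  by rewrite /u; ring.
rewrite [X in _ <= X * _]mulrC -mulrA ler_pM2l ?expR_gt0 //.
have u0 : \sum_o u o = 0.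
  rewrite -mulr_sumr sumrB sumr_const -[X in _ - X]mulr_natr /m /resample.
  by rewrite divfK ?gt_eqF // subrr mulr0.
apply: le_trans (_ : \sum_o (1 + u o + 2 * (lam * c) ^+ 2) <= _).
  apply: ler_sum => o _; apply: le_trans (expR_le_quadratic _) _.
    exact: le_trans (uc o) lc.
  rewrite lerD2l ler_wpM2l // -[u o ^+ 2](real_normK (num_real _)).
  by rewrite lerXn2r ?nnegrE // (le_trans _ (uc o)).
rewrite !big_split /= u0 addr0 !sumr_const -[(2 * _) *+ _]mulr_natr.
rewrite -[X in X + _]mul1r -mulrDl ler_wpM2r ?ler0n //.
exact: expR_ge1Dx.
Qed.

Lemma resample_invariant i F w o : resample i F (w + at_coord i o) = resample i F w.
Proof.
rewrite /resample; congr (_ / _); rewrite [RHS](reindex_inj (addrI o)) /=.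
by apply: eq_bigr => o' _; rewrite at_coordD addrA.
Qed.

Lemma resample_all_cst F : forall w, foldr resample F (enum I) w
  = (\sum_(w : T) F w) / #|{: T}|%:R.
Proof.
set H := foldr _ _ _.
have inv (l : seq I) i w o : i \in l ->
    foldr resample F l (w + at_coord i o) = foldr resample F l w.
  elim: l w => //= j l IH w; have [-> _|ne] := eqVneq i j.
    exact: resample_invariant.
  rewrite inE (negPf ne) /= => il; rewrite /(resample j _); congr (_ / _).
  by apply: eq_bigr => o' _; rewrite addrAC IH.
have H0 w : H w = H 0.
  have -> : w = \sum_i at_coord i (w i).
    apply/ffunP => j; rewrite sum_ffunE (bigD1 j) //= ffunE eqxx big1 ?addr0 //.
    by move=> i ij; rewrite ffunE eq_sym (negPf ij).
  elim/big_rec: _ => // i x _ IH; by rewrite addrC /H inv ?mem_enum //; apply: IH.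
have HS : \sum_(w : T) H w = \sum_(w : T) F w.
  rewrite /H; elim: (enum I) => //= a l IH; rewrite sum_resample; apply: IH.
move=> w; rewrite -HS (eq_bigr (fun=> H w)) => [|x _]; last by rewrite !H0.
rewrite sumr_const -[X in X / _]mulr_natr mulfK // pnatr_eq0 -lt0n.
by apply/card_gt0P; exists 0.
Qed.

(** McDiarmid's inequality. Resampling the coordinates one after the other multiplies
    the exponential moment by at most [expR (2 * (lam * c) ^+ 2)] each time and ends
    with the mean; Markov's inequality concludes. *)
Lemma bounded_diff_tail c lam mu t F : bounded_diff c F -> 0 <= lam -> lam * c <= 1 / 2 ->
    \sum_(w : T) F w <= #|{: T}|%:R * mu ->
  #|[set w | mu + t <= F w]|%:R
    <= #|{: T}|%:R * expR (2 * (lam * c) ^+ 2 * #|I|%:R - lam * t).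
Proof.
move=> h l0 lc hmu.
have T0 : 0 < #|{: T}|%:R :> R by rewrite ltr0n; apply/card_gt0P; exists 0.
have step (l : seq I) : bounded_diff c (foldr resample F l) /\
    \sum_(w : T) expR (lam * F w) <= expR (2 * (lam * c) ^+ 2 * (size l)%:R)
      * \sum_(w : T) expR (lam * foldr resample F l w).
  elim: l => [|i l [IH1 IH2]] /=; first by rewrite mulr0 expR0 mul1r.
  split; first exact: resample_bounded_diff.
  apply: le_trans IH2 _; rewrite -[(size l).+1%:R]natr1 mulrDr mulr1 expRD.
  rewrite -[expR _ * expR _ * _]mulrA ler_pM2l ?expR_gt0 //.
  exact: sum_expR_resample.
have [_ mgf] := step (enum I).
have {step} := mgf; rewrite -cardE => {}mgf.
have mgf2 : \sum_(w : T) expR (lam * F w) <= expR (2 * (lam * c) ^+ 2 * #|I|%:R)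
    * (#|{: T}|%:R * expR (lam * mu)).
  apply: le_trans mgf _; rewrite ler_pM2l ?expR_gt0 // mulr_natl -sumr_const.
  apply: ler_sum => w _; rewrite resample_all_cst ler_expR ler_wpM2l //.
  by rewrite ler_pdivrMr // mulrC.
have low : #|[set w | mu + t <= F w]|%:R * expR (lam * (mu + t))
    <= \sum_(w : T) expR (lam * F w).
  rewrite mulr_natl -sumr_const [X in _ <= X](bigID [pred w | mu + t <= F w]) /=.
  rewrite -[X in X <= _]addr0; apply: lerD; last by apply: sumr_ge0 => *; apply: expR_ge0.
  rewrite (eq_bigl (fun w => mu + t <= F w)) => [|w]; last by rewrite inE.
  by apply: ler_sum => w hw; rewrite ler_expR ler_wpM2l.
rewrite -(ler_pM2r (expR_gt0 (lam * (mu + t)))); apply: le_trans low _.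
apply: le_trans mgf2 _; rewrite -[X in _ <= X]mulrA -[in X in _ <= X]expRD mulrCA -expRD.
by rewrite le_eqVlt; apply/orP; left; apply/eqP; congr (_ * expR _); ring.
Qed.

End BoundedDifferences.

(** * Trigonometric polynomials on cyclic groups *)

Lemma prod3_sum (S : comPzRingType) (K : finType) (a b c : K -> S) :
  (\sum_i a i) * (\sum_j b j) * (\sum_l c l)
    = \sum_i \sum_j \sum_l a i * b j * c l.
Proof.
rewrite !mulr_suml; apply: eq_bigr => i _; rewrite -mulrA mulr_suml mulr_sumr.
by apply: eq_bigr => j _; rewrite !mulr_sumr; apply: eq_bigr => l _; rewrite mulrA.
Qed.

Section TrigPolynomials.
Context {R : realType} {p : nat}.
Hypothesis p_gt1 : (1 < p)%N.
Hypothesis p60 : coprime p 60.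
Local Notation Z := 'Z_p.
Variable chi : Z -> R[i].
Hypothesis chiP : faithful_char chi.
Let chi0 : chi 0 = 1. Proof. by case: chiP. Qed.
Let chiD x y : chi (x + y) = chi x * chi y. Proof. by case: chiP. Qed.

Definition freq (k : 'I_5) : int := (k : nat)%:Z - 2.
Definition zero_freq : 'I_5 := inord 2.

Lemma small_unit (z : int) : z != 0 -> (`|z| <= 6)%N -> (z%:~R : Z) \is a GRing.unit.
Proof.
move=> z0 z6; have h (m : nat) : (0 < m)%N -> (m <= 6)%N -> (m%:R : Z) \is a GRing.unit.
  move=> m0 m6; rewrite unitZpE //; apply: coprime_dvdr p60.
  by case: m m0 m6 => [|[|[|[|[|[|[|]]]]]]].
case: (intP z) z0 z6 => // m _ m6; first exact: h.
by rewrite mulrNz unitrN; apply: h.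
Qed.

Lemma freq_neq0 k : k != zero_freq -> freq k != 0.
Proof.
apply: contra => /eqP h; apply/eqP/val_inj; rewrite /= inordK //.
by move: h; rewrite /freq; lia.
Qed.

Lemma freq_le k : (`|freq k| <= 2)%N.
Proof. by have := ltn_ord k; rewrite /freq; lia. Qed.

Lemma freq_unit k : k != zero_freq -> ((freq k)%:~R : Z) \is a GRing.unit.
Proof.
by move=> /freq_neq0 h; apply: small_unit => //; apply: leq_trans (freq_le k) _.
Qed.

Definition trig (c : 'I_5 -> R) (u : Z) : R[i] :=
  \sum_k (c k)%:C%C * chi ((freq k)%:~R * u).

(** In the absence of relations between the frequencies [x1], [x2], [x3] only the
    constant terms survive the sum over [y]. The relation is required only
    for exponents with nonzero coefficients, so that constant factors may carry
    any frequency. *)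
Lemma trig3_sum (c1 c2 c3 : 'I_5 -> R) (x1 x2 x3 s1 s2 s3 : Z) :
    (forall k1 k2 k3, c1 k1 != 0 -> c2 k2 != 0 -> c3 k3 != 0 ->
       (freq k1)%:~R * x1 + (freq k2)%:~R * x2 + (freq k3)%:~R * x3 = 0 ->
       [/\ k1 = zero_freq, k2 = zero_freq & k3 = zero_freq]) ->
  \sum_y trig c1 (x1 * y + s1) * trig c2 (x2 * y + s2) * trig c3 (x3 * y + s3)
    = (#|Z|%:R * (c1 zero_freq * c2 zero_freq * c3 zero_freq))%:C%C.
Proof.
move=> rel.
transitivity (\sum_k1 \sum_k2 \sum_k3 (c1 k1 * c2 k2 * c3 k3)%:C%C
   * chi ((freq k1)%:~R * s1 + (freq k2)%:~R * s2 + (freq k3)%:~R * s3)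
   * \sum_y chi (y * ((freq k1)%:~R * x1 + (freq k2)%:~R * x2 + (freq k3)%:~R * x3))).
  under eq_bigr => y _.
    rewrite prod3_sum; over.
  rewrite exchange_big /=; apply: eq_bigr => k1 _.
  rewrite exchange_big /=; apply: eq_bigr => k2 _.
  rewrite exchange_big /=; apply: eq_bigr => k3 _.
  rewrite mulr_sumr; apply: eq_bigr => y _.
  rewrite -[RHS]mulrA -chiD !rmorphM.
  have -> : (freq k1)%:~R * s1 + (freq k2)%:~R * s2 + (freq k3)%:~R * s3
      + y * ((freq k1)%:~R * x1 + (freq k2)%:~R * x2 + (freq k3)%:~R * x3)
    = (freq k1)%:~R * (x1 * y + s1) + (freq k2)%:~R * (x2 * y + s2)
      + (freq k3)%:~R * (x3 * y + s3) by ring.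
  by rewrite !chiD; ring.
have fm : freq zero_freq = 0 by rewrite /freq /zero_freq inordK.
rewrite (bigD1 zero_freq) //= (bigD1 zero_freq) //= (bigD1 zero_freq) //=.
have vanish k1 k2 k3 : ~ [/\ k1 = zero_freq, k2 = zero_freq & k3 = zero_freq] ->
  (c1 k1 * c2 k2 * c3 k3)%:C%C
   * chi ((freq k1)%:~R * s1 + (freq k2)%:~R * s2 + (freq k3)%:~R * s3)
   * (\sum_y chi (y * ((freq k1)%:~R * x1 + (freq k2)%:~R * x2 + (freq k3)%:~R * x3))) = 0.
  move=> nmid; rewrite (char_sum chiP).
  have [->|h1] := eqVneq (c1 k1) 0; first by rewrite !mul0r.
  have [->|h2] := eqVneq (c2 k2) 0; first by rewrite mulr0 !mul0r.
  have [->|h3] := eqVneq (c3 k3) 0; first by rewrite mulr0 !mul0r.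
  by case: eqP => [/(rel _ _ _ h1 h2 h3) //|_]; rewrite mulr0.
rewrite [X in _ + X = _]big1 ?addr0 => [|k1 k1m]; last first.
  rewrite big1 // => k2 _; rewrite big1 // => k3 _; apply: vanish => -[e _ _].
  by rewrite e eqxx in k1m.
rewrite [X in _ + X = _]big1 ?addr0 => [|k2 k2m]; last first.
  rewrite big1 // => k3 _; apply: vanish => -[_ e _].
  by rewrite e eqxx in k2m.
rewrite [X in _ + X = _]big1 ?addr0 => [|k3 k3m]; last first.
  apply: vanish => -[_ _ e].
  by rewrite e eqxx in k3m.
rewrite fm !mul0r !addr0 chi0 mulr1.
under eq_bigr do rewrite mulr0 chi0.
by rewrite sumr_const [RHS]rmorphM rmorph_nat mulrC.
Qed.

Definition weight_coef (k : 'I_5) : R :=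
  match (k : nat) with 0 | 4 => - (1 / 4) | 2 => 1 | _ => 1 / 4 end.
Definition one_coef (k : 'I_5) : R := if k == zero_freq then 1 else 0.

(** The transform is [1] at [0], [1 / 4] at [1] and [- 1], and [- 1 / 4] at [2] and
    [- 2]. A progression [y, y + d, y + 2 d] correlates the frequencies [k], [- 2 k]
    and [k], so the negative coefficient at [2] lowers the mean number of
    progressions. *)
Definition weight (u : Z) : R :=
  1 + complex.Re (chi u) / 2 - complex.Re (chi (2 * u)) / 2.

Lemma weight_coef_zero : weight_coef zero_freq = 1.
Proof. by rewrite /weight_coef inordK. Qed.

Lemma one_coef_zero : one_coef zero_freq = 1.
Proof. by rewrite /one_coef eqxx. Qed.

Lemma trig_one_coef u : trig one_coef u = 1.
Proof.
rewrite /trig (bigD1 zero_freq) //= big1 => [|k /negPf km]; last by rewrite /one_coef km mul0r.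
by rewrite one_coef_zero /freq inordK // subrr mul0r chi0 mulr1 addr0.
Qed.

Lemma trig_weight_coef u : trig weight_coef u = (weight u)%:C%C.
Proof.
have ReE z : (complex.Re (chi z) / 2)%:C%C = (1 / 4)%:C%C * (chi z + chi (- z)).
  rewrite -(char_conj chiP) addcJ.
  have -> : 2%:R = (2 : R)%:C%C by rewrite rmorph_nat.
  by rewrite -!rmorphM; congr (_%:C)%C; field.
rewrite /weight rmorphB rmorphD /= !ReE /trig !big_ord_recl big_ord0.
pose k1 : 'I_5 := lift ord0 ord0; pose k2 : 'I_5 := lift ord0 (lift ord0 ord0).
pose k3 : 'I_5 := lift ord0 (lift ord0 (lift ord0 ord0)).
pose k4 : 'I_5 := lift ord0 (lift ord0 (lift ord0 (lift ord0 ord0))).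
rewrite -/k1 -/k2 -/k3 -/k4.
have -> : (freq ord0)%:~R * u = - (2 * u) by rewrite -mulNr.
have -> : (freq k1)%:~R * u = - u by rewrite mulN1r.
have -> : (freq k2)%:~R * u = 0 by rewrite mul0r.
have -> : (freq k3)%:~R * u = u by rewrite mul1r.
have -> : (freq k4)%:~R * u = 2 * u by [].
have -> : weight_coef k1 = 1 / 4 by []. have -> : weight_coef k3 = 1 / 4 by [].
have -> : weight_coef k2 = 1 by []. have -> : weight_coef k4 = - (1 / 4) by [].
have -> : weight_coef ord0 = - (1 / 4) by [].
rewrite chi0 rmorphN /= rmorph1; ring.
Qed.

Lemma weight_itv u : 0 <= weight u <= 2.
Proof.
have h z : -1 <= complex.Re (chi z) <= 1.
  have h1 := Re_le_normc (chi z); have h2 := Re_le_normc (- chi z).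
  rewrite normcN (normc_char chiP) raddfN /= in h1 h2; lra.
by have := h u; have := h (2 * u); rewrite /weight; lra.
Qed.

Lemma weight_ge0 u : 0 <= weight u. Proof. by case/andP: (weight_itv u). Qed.
Lemma weight_le2 u : weight u <= 2. Proof. by case/andP: (weight_itv u). Qed.

Definition ap_density (d t : Z) : R :=
  (\sum_y weight (t * y) * weight (t * (y + d)) * weight (t * (y + d *+ 2))) / #|Z|%:R.

Lemma ap_density_itv d t : 0 <= ap_density d t <= 8.
Proof.
have N0 : 0 < #|Z|%:R :> R by rewrite ltr0n card_ord.
rewrite /ap_density ler_pdivrMr // divr_ge0 ?ler0n //=; last first.
  by apply: sumr_ge0 => y _; rewrite !mulr_ge0 ?weight_ge0.
rewrite mulr_natr -sumr_const; apply: ler_sum => y _.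
have -> : 8 = 2 * 2 * 2 :> R by ring.
by rewrite !ler_pM ?mulr_ge0 ?weight_ge0 ?weight_le2.
Qed.

(** The conditions mean [k1 = k3] and [k2 = - 2 k1], so the sum is
    [1 + 2 * (1 / 4) ^+ 2 * (- (1 / 4))]. *)
Lemma sum_weight_coef_diagonal :
  \sum_k1 \sum_k2 \sum_k3 (if (freq k1 + freq k2 + freq k3 == 0)
     && (freq k2 + 2 * freq k3 == 0) then weight_coef k1 * weight_coef k2 * weight_coef k3 else 0)
  = 31 / 32.
Proof.
under eq_bigr do under eq_bigr do rewrite !big_ord_recl big_ord0 /freq /weight_coef /= /bump /=.
by rewrite !big_ord_recl !big_ord0 /= !addr0 !add0r; field.
Qed.

Lemma sum_norm_weight_coef : \sum_k1 \sum_k2 \sum_k3 `|weight_coef k1 * weight_coef k2 * weight_coef k3| = 8.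
Proof.
have n4 : `|1 / 4| = 1 / 4 :> R by rewrite ger0_norm // divr_ge0.
transitivity ((\sum_k `|weight_coef k|) * (\sum_k `|weight_coef k|) * (\sum_k `|weight_coef k|)).
  rewrite prod3_sum; apply: eq_bigr => k1 _; apply: eq_bigr => k2 _.
  by apply: eq_bigr => k3 _; rewrite !normrM.
have -> : \sum_k `|weight_coef k| = 2.
  rewrite !big_ord_recl big_ord0 /weight_coef /= normrN !n4 normr1; lra.
by ring.
Qed.

(** Summing over the dilation [t] first leaves a linear condition on [y], which holds
    for all [y] when both its coefficients vanish and for at most one [y] otherwise. *)
Lemma sum_ap_density d : d != 0 ->
  \sum_t ap_density d t <= #|Z|%:R * (31 / 32) + 8.
Proof.
move=> d0; have N0 : 0 < #|Z|%:R :> R by rewrite ltr0n card_ord.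
rewrite -mulr_suml ler_pdivrMr // exchange_big /=.
pose c3 k1 k2 k3 := weight_coef k1 * weight_coef k2 * weight_coef k3.
pose e k1 k2 k3 (y : Z) : Z :=
  (freq k1 + freq k2 + freq k3)%:~R * y + (freq k2 + 2 * freq k3)%:~R * d.
have -> : \sum_y \sum_t weight (t * y) * weight (t * (y + d)) * weight (t * (y + d *+ 2))
    = \sum_k1 \sum_k2 \sum_k3 \sum_y c3 k1 k2 k3 * (if e k1 k2 k3 y == 0 then #|Z|%:R else 0).
  under [RHS]eq_bigr do under eq_bigr do rewrite exchange_big.
  under [RHS]eq_bigr do rewrite exchange_big.
  rewrite [RHS]exchange_big /=; apply: eq_bigr => y _.
  apply: (@complexI R); rewrite rmorph_sum /=.
  under eq_bigr do rewrite !rmorphM /= -!trig_weight_coef /trig prod3_sum.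
  rewrite exchange_big rmorph_sum /=; apply: eq_bigr => k1 _.
  rewrite exchange_big rmorph_sum /=; apply: eq_bigr => k2 _.
  rewrite exchange_big rmorph_sum /=; apply: eq_bigr => k3 _.
  rewrite rmorphM /=.
  have -> : (if e k1 k2 k3 y == 0 then #|Z|%:R else 0 : R)%:C%C
      = \sum_t chi (t * e k1 k2 k3 y).
    by rewrite (char_sum chiP); case: eqP => _; rewrite ?rmorph0 // rmorph_nat.
  rewrite mulr_sumr; apply: eq_bigr => t _.
  have -> : t * e k1 k2 k3 y = (freq k1)%:~R * (t * y) + (freq k2)%:~R * (t * (y + d))
      + (freq k3)%:~R * (t * (y + d *+ 2)).
    rewrite /e mulr2n; ring.
  by rewrite !chiD /c3 !rmorphM /=; ring.
apply: le_trans (_ : \sum_k1 \sum_k2 \sum_k3 #|Z|%:R * (#|Z|%:R * (if (freq k1 + freq k2 + freq k3 == 0)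
     && (freq k2 + 2 * freq k3 == 0) then c3 k1 k2 k3 else 0) + `|c3 k1 k2 k3|) <= _); last first.
  under eq_bigr do under eq_bigr do rewrite -mulr_sumr big_split -mulr_sumr.
  under eq_bigr do rewrite -mulr_sumr big_split -mulr_sumr.
  rewrite -mulr_sumr big_split -mulr_sumr /= /c3 sum_weight_coef_diagonal sum_norm_weight_coef.
  by rewrite mulrC.
apply: ler_sum => k1 _; apply: ler_sum => k2 _; apply: ler_sum => k3 _.
rewrite -mulr_sumr mulrC.
have f1 := freq_le k1; have f2 := freq_le k2; have f3 := freq_le k3.
have [K0|Kn0] := eqVneq (freq k1 + freq k2 + freq k3) 0 => /=.
  have eE y : e k1 k2 k3 y = (freq k2 + 2 * freq k3)%:~R * d by rewrite /e K0 mul0r add0r.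
  under eq_bigr do rewrite eE.
  rewrite sumr_const.
  have [m0|mn0] := eqVneq (freq k2 + 2 * freq k3) 0.
    rewrite m0 mul0r eqxx -[#|Z|%:R *+ _]mulr_natl -mulrA ler_pM2l // mulrC.
    by rewrite lerDl.
  have mu : ((freq k2 + 2 * freq k3)%:~R : Z) \is a GRing.unit.
    by apply: small_unit => //; lia.
  rewrite mulrI_eq0; last exact: mulrI.
  by rewrite (negPf d0) mul0rn mul0r mulr0 add0r mulr_ge0 // ltW.
have Ku : ((freq k1 + freq k2 + freq k3)%:~R : Z) \is a GRing.unit.
  by apply: small_unit => //; lia.
rewrite mulr0 add0r.
pose y0 : Z := - ((freq k1 + freq k2 + freq k3)%:~R^-1 * ((freq k2 + 2 * freq k3)%:~R * d)).
rewrite (bigD1 y0) //= big1 => [|y yn]; last first.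
  case: eqP => // /eqP; rewrite /e addr_eq0 => /eqP h.
  by move: yn; rewrite /y0 -mulrN -h mulKr // eqxx.
rewrite addr0; case: eqP => _; last by rewrite mul0r mulr_ge0 // ltW.
by rewrite ler_pM2l // ler_norm.
Qed.

End TrigPolynomials.

(** * Random frequencies *)

Lemma card_bigcup_le (J T : finType) (P : pred J) (F : J -> {set T}) :
  (#|\bigcup_(j | P j) F j| <= \sum_(j | P j) #|F j|)%N.
Proof.
elim/big_rec2: _ => [|j m A _ h]; first by rewrite cards0.
by apply: leq_trans (leq_card_setU _ _) _; rewrite leq_add2l.
Qed.

Section RandomFrequencies.
Context {R : realType} {p : nat} {I : finType}.
Hypothesis p_gt1 : (1 < p)%N.
Hypothesis p60 : coprime p 60.
Local Notation Z := 'Z_p.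
Local Notation T := {ffun I -> Z}.
Variable chi : Z -> R[i].
Hypothesis chiP : faithful_char chi.

Definition freq_at (xi : T) (o : option I) : Z := if o is Some i then xi i else 0.

(** A linear relation between [xi i] and two other terms, coded by pairs of an
    optional position and an exponent; [None] stands for a position that carries
    no frequency. *)
Definition related (xi : T) (i : I) (k : 'I_5) (q : option I * 'I_5 * (option I * 'I_5)) : bool :=
  (freq k)%:~R * xi i + (freq q.1.2)%:~R * freq_at xi q.1.1
    + (freq q.2.2)%:~R * freq_at xi q.2.1 == 0.

(** The coordinate [i] really occurs in the relation and is independent of the two
    other terms. *)
Definition proper (i : I) (k : 'I_5) (q : option I * 'I_5 * (option I * 'I_5)) : bool :=
  [&& k != zero_freq, q.1.1 != Some i & q.2.1 != Some i].

Let T0 : 0 < #|{: T}|%:R :> R.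
Proof. by rewrite ltr0n; apply/card_gt0P; exists 0. Qed.

Let Z0 : 0 < #|Z|%:R :> R. Proof. by rewrite ltr0n card_ord. Qed.

(** When the other coordinates are fixed, at most one value of the coordinate [i]
    satisfies the relation. *)
Lemma card_related i k q : proper i k q ->
  #|[set xi | related xi i k q]|%:R * #|Z|%:R <= #|{: T}|%:R :> R.
Proof.
move=> /and3P[km q1 q2]; rewrite -ler_pdivlMr //.
have -> : #|[set xi | related xi i k q]|%:R = \sum_(xi : T) (related xi i k q)%:R :> R.
  rewrite -sum1_card natr_sum big_mkcond; apply: eq_bigr => xi _; rewrite inE.
  by case: related.
rewrite -(sum_resample i) -[X in _ <= X / _]sumr_const mulr_suml.
apply: ler_sum => xi _; rewrite /resample ler_wpM2r ?invr_ge0 ?ler0n //.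
rewrite -natr_sum lern1.
have fo (o : option I) t : o != Some i -> freq_at (xi + at_coord i t) o = freq_at xi o.
  case: o => //= j ji; rewrite !ffunE; case: eqP => [e|_]; last by rewrite addr0.
  by rewrite e eqxx in ji.
pose a := (freq k)%:~R * xi i + (freq q.1.2)%:~R * freq_at xi q.1.1
    + (freq q.2.2)%:~R * freq_at xi q.2.1 : Z.
have rE t : related (xi + at_coord i t) i k q = ((freq k)%:~R * t == - a).
  rewrite /related !fo // !ffunE eqxx -[RHS]subr_eq0 opprK /a.
  by congr (_ == _); ring.
under eq_bigr do rewrite rE.
have ku := freq_unit p_gt1 p60 km.
rewrite (bigD1 ((freq k)%:~R^-1 * - a)) //= big1 ?addn0 ?leq_b1 // => t tn.
by case: eqP => // h; move: tn; rewrite -h mulKr ?eqxx //; apply: ku.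
Qed.

(** The [#|I|] coordinates contribute independently, so a deviation from the mean is
    exponentially unlikely in [#|I|]. *)
Lemma card_ap_dense d : d != 0 -> (512 <= #|Z|)%N ->
  #|[set xi : T | #|I|%:R * (1 - 1 / 128) <= \sum_i ap_density chi d (xi i)]|%:R
    <= #|{: T}|%:R * expR (- (#|I|%:R / (512 * 128 ^+ 2))) :> R.
Proof.
move=> d0 Z512; set n : R := #|I|%:R.
pose F (xi : T) := \sum_i ap_density chi d (xi i).
have bd : bounded_diff 8 F.
  move=> xi i t; rewrite /F -sumrB (bigD1 i) //= big1 => [|j ji]; last first.
    by rewrite !ffunE (negPf ji) addr0 subrr.
  rewrite addr0; have /andP[a0 a8] := ap_density_itv chiP d ((xi + at_coord i t) i).
  have /andP[b0 b8] := ap_density_itv chiP d (xi i).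
  by rewrite ler_norml; apply/andP; split; lra.
have mean : \sum_(xi : T) F xi <= #|{: T}|%:R * (n * (1 - 1 / 64)).
  rewrite exchange_big /= mulrCA mulr_natl -sumr_const.
  apply: ler_sum => i _; rewrite -(sum_resample i) mulr_natl -sumr_const.
  apply: ler_sum => xi _; rewrite /resample ler_pdivrMr //.
  under eq_bigr do rewrite !ffunE eqxx.
  have -> : \sum_o ap_density chi d (xi i + o) = \sum_t ap_density chi d t.
    by rewrite [RHS](reindex_inj (addrI (xi i))).
  apply: le_trans (sum_ap_density p_gt1 p60 chiP d0) _.
  have : 512 <= #|Z|%:R :> R by rewrite ler_nat.
  lra.
(* This value minimises 128 lam^2 - lam / 128. *)
pose lam : R := (2 * 128 ^+ 2)^-1.
have lam0 : 0 < lam by rewrite invr_gt0 mulr_gt0 // exprn_gt0.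
have lc : lam * 8 <= 1 / 2.
  by rewrite /lam -(ler_pM2r (_ : 0 < 2 * 128 ^+ 2)) ?mulr_gt0 ?exprn_gt0 // mulrAC mulVf; lra.
have := bounded_diff_tail (n / 128) bd (ltW lam0) lc mean.
have -> : n * (1 - 1 / 64) + n / 128 = n * (1 - 1 / 128) by field.
have -> // : 2 * (lam * 8) ^+ 2 * #|I|%:R - lam * (n / 128)
  = - (n / (512 * 128 ^+ 2)) by rewrite /lam -/n; field.
Qed.

(** The union bound over [d] is why the modulus may be exponential in [#|I|], but not
    larger: this exponential growth is iterated to a tower. *)
Lemma random_frequencies : (512 <= #|Z|)%N -> (250 * #|I|.+1 ^ 3 <= #|Z|)%N ->
    #|Z|%:R * expR (- (#|I|%:R / (512 * 128 ^+ 2))) < 1 / 2 :> R ->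
  exists xi : T,
    (forall d, d != 0 ->
       \sum_i ap_density chi d (xi i) <= #|I|%:R * (1 - 1 / 128)) /\
    (forall i k q, proper i k q -> ~~ related xi i k q).
Proof.
move=> Z512 Zn Zexp.
pose bad1 d := [set xi : T | #|I|%:R * (1 - 1 / 128) <= \sum_i ap_density chi d (xi i)].
pose Q := (I * 'I_5 * (option I * 'I_5 * (option I * 'I_5)))%type.
pose bad2 (j : Q) := [set xi : T | proper j.1.1 j.1.2 j.2 && related xi j.1.1 j.1.2 j.2].
pose bad := (\bigcup_(d : Z | d != 0) bad1 d) :|: \bigcup_(j : Q) bad2 j.
suff lt : (#|bad| < #|{: T}|)%N.
  have [xi xibad] : exists xi, xi \notin bad.
    apply/existsP; rewrite -negb_forall; apply: contraL lt => /forallP h.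
    by rewrite -leqNgt -cardsT; apply/subset_leq_card/subsetP => xi _; apply: h.
  move: xibad; rewrite inE negb_or => /andP[/bigcupP n1 /bigcupP n2].
  exists xi; split=> [d d0|i k q pq].
    rewrite leNgt; apply/negP => h; apply: n1; exists d => //; rewrite inE; exact: ltW.
  apply/negP => rq; apply: n2; exists (i, k, q) => //; by rewrite inE /= pq.
rewrite -(ltr_nat R).
have c1 : #|\bigcup_(d : Z | d != 0) bad1 d|%:R < #|{: T}|%:R * (1 / 2) :> R.
  apply: le_lt_trans (_ : \sum_(d : Z | d != 0) #|bad1 d|%:R < _).
    rewrite -natr_sum ler_nat; exact: card_bigcup_le.
  apply: le_lt_trans (_ : #|Z|%:R * (#|{: T}|%:R * expR (- (#|I|%:R / (512 * 128 ^+ 2)))) < _).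
    rewrite mulr_natl -sumr_const [X in _ <= X](bigID (fun d : Z => d != 0)) /=.
    rewrite -[X in X <= _]addr0; apply: lerD; last first.
      by apply: sumr_ge0 => d _; rewrite mulr_ge0 ?expR_ge0.
    by apply: ler_sum => d d0; apply: card_ap_dense.
  by rewrite mulrCA ltr_pM2l.
have c2 : #|\bigcup_(j : Q) bad2 j|%:R <= #|{: T}|%:R * (1 / 2) :> R.
  apply: le_trans (_ : \sum_(j : Q) #|bad2 j|%:R <= _).
    rewrite -natr_sum ler_nat; exact: card_bigcup_le.
  apply: le_trans (_ : \sum_(j : Q) #|{: T}|%:R / #|Z|%:R <= _).
    apply: ler_sum => j _; have [pj|npj] := boolP (proper j.1.1 j.1.2 j.2).
      rewrite ler_pdivlMr // -[X in X * _ <= _]/(#|_|%:R).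
      have -> : bad2 j = [set xi | related xi j.1.1 j.1.2 j.2].
        by apply/setP => xi; rewrite !inE pj.
      exact: card_related.
    have -> : bad2 j = set0 by apply/setP => xi; rewrite !inE (negPf npj).
    by rewrite cards0 divr_ge0 // ltW.
  rewrite sumr_const !card_prod !card_option !(card_ord 5) -[X in X <= _]mulr_natl mulrCA.
  rewrite ler_pM2l // ler_pdivrMr //; set m := (_ * _)%N.
  suff : 2 * m%:R <= #|Z|%:R :> R by lra.
  rewrite -natrM ler_nat; apply: leq_trans Zn; rewrite /m !expnS expn0 muln1.
  have -> : (2 * (#|I| * 5 * (#|I|.+1 * 5 * (#|I|.+1 * 5))) = 250 * (#|I| * (#|I|.+1 * #|I|.+1)))%N by ring.
  by rewrite leq_mul2l leq_mul2r leqnSn !orbT.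
have : (#|bad| <= #|\bigcup_(d : Z | d != 0%R) bad1 d| + #|\bigcup_(j : Q) bad2 j|)%N.
  exact: leq_card_setU.
rewrite -(ler_nat R) natrD => h; apply: le_lt_trans h _; lra.
Qed.

End RandomFrequencies.

(** * Raising a weight by one exponential *)

HB.instance Definition _ (A B : finZmodType) := GRing.Zmodule.on (A * B)%type.

(** [g] generates the group, which is cyclic of odd order; [al] is the mean of the
    weight [f], [tau] bounds the density of its progressions with any nonzero
    difference, [w] is the room left by the sum of cubes, that is by the
    difference zero, and [U] is a set of positions where [f] is still untouched. *)
Definition level {R : realType} (G : finZmodType) (g : G) (f : G -> R)
    (U : {set G}) (al tau w : R) : Prop :=
  [/\ forall x : nat, g *+ x = 0 -> (#|G| %| x)%N,
      forall d : G, d + d = 0 -> d = 0,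
      forall x, 0 <= f x <= 1,
      forall x, x \in U -> f x = 1 / 2 &
      [/\ \sum_x f x = #|G|%:R * al,
          \sum_x f x ^+ 3 <= #|G|%:R * (tau + w) &
          forall d, d != 0 -> \sum_x f x * f (x + d) * f (x + d *+ 2) <= #|G|%:R * tau]].

Section LevelStep.
Context {R : realType} {G : finZmodType} {p : nat}.
Hypothesis p_gt1 : (1 < p)%N.
Hypothesis p60 : coprime p 60.
Local Notation Z := 'Z_p.
Variables (g : G) (f : G -> R) (U X : {set G}) (al tau w : R).
Hypothesis lev : level g f U al tau w.
Hypothesis XU : X \subset U.
Variable chi : Z -> R[i].
Hypothesis chiP : faithful_char chi.
Local Notation I := {x : G | x \in X}.
Variable xi : {ffun I -> Z}.
Hypothesis unrelated : forall i k q, proper i k q -> ~~ related xi i k q.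
Hypothesis few_aps : forall d, d != 0 ->
  \sum_i ap_density chi d (xi i) <= #|X|%:R * (1 - 1 / 128).
Hypothesis X_large : #|G|%:R * w <= #|X|%:R / 1024.

Local Notation loc x := (insub x : option I).

Definition fiber (x : G) (y : Z) : R :=
  if loc x is Some i then weight chi (xi i * y) else 1.

(** Positions outside [X] carry the constant polynomial, so that all fibers are
    trigonometric polynomials of the same shape. *)
Definition fcoef (x : G) : 'I_5 -> R := if loc x is Some _ then weight_coef else one_coef.

Lemma fiberE x y : (fiber x y)%:C%C = trig chi (fcoef x) (freq_at xi (loc x) * y).
Proof.
rewrite /fiber /fcoef; case: insub => [i|] /=; first by rewrite trig_weight_coef.
by rewrite trig_one_coef.
Qed.

Lemma fiber_itv x y : 0 <= fiber x y <= 2.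
Proof. by rewrite /fiber; case: insub => [i|]; [apply: weight_itv|lra]. Qed.

Lemma fcoef_zero x : fcoef x zero_freq = 1.
Proof. by rewrite /fcoef; case: insub => [i|]; [apply: weight_coef_zero|apply: one_coef_zero]. Qed.

Lemma fcoef_outer x k : fcoef x k != 0 -> k != zero_freq -> exists i, loc x = Some i.
Proof.
rewrite /fcoef; case: (insub x) => [i|]; first by exists i.
by rewrite /one_coef => h /negPf km; move: h; rewrite km eqxx.
Qed.

Lemma loc_neq x x' i : x' != x -> loc x = Some i -> loc x' != Some i.
Proof.
move=> xx; case: insubP => // j _ jx [<-]; case: insubP => //= k _ kx.
by apply: contra xx => /eqP[e]; rewrite -kx -jx e.
Qed.

Lemma unrelated_zero x1 x2 x3 k1 k2 k3 : x1 != x2 -> x1 != x3 ->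
    fcoef x1 k1 != 0 ->
    (freq k1)%:~R * freq_at xi (loc x1) + (freq k2)%:~R * freq_at xi (loc x2)
      + (freq k3)%:~R * freq_at xi (loc x3) = 0 ->
  k1 = zero_freq.
Proof.
move=> x12 x13 c1 rel; apply/eqP; apply/negPn/negP => km.
have [i ei] := fcoef_outer c1 km.
have /unrelated : proper i k1 (loc x2, k2, (loc x3, k3)).
  by rewrite /proper km /= !(@loc_neq x1) // eq_sym.
by rewrite /related /= -rel ei eqxx.
Qed.

(** Fibers over distinct positions are independent: their frequencies satisfy no
    relation. *)
Lemma fiber3_sum x1 x2 x3 d2 d3 : x1 != x2 -> x1 != x3 -> x2 != x3 ->
  \sum_y fiber x1 y * fiber x2 (y + d2) * fiber x3 (y + d3) = #|Z|%:R.
Proof.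
move=> x12 x13 x23; apply: (@complexI R); rewrite rmorph_sum /=.
under eq_bigr do rewrite !rmorphM /= !fiberE !mulrDr -[freq_at xi (loc x1) * _]addr0.
rewrite (trig3_sum chiP) => [|k1 k2 k3 c1 c2 c3 rel].
  by rewrite !fcoef_zero !mulr1.
split.
- exact: (@unrelated_zero x1 x2 x3 k1 k2 k3).
- apply: (@unrelated_zero x2 x1 x3 k2 k1 k3) => //; first by rewrite eq_sym.
  by rewrite -rel; ring.
- apply: (@unrelated_zero x3 x1 x2 k3 k1 k2) => //; rewrite 1?eq_sym //.
  by rewrite -rel; ring.
Qed.

Lemma fiber_sum x : \sum_y fiber x y = #|Z|%:R.
Proof.
apply: (@complexI R); rewrite rmorph_sum /=.
have tm : trig chi one_coef 0 = 1 by rewrite trig_one_coef.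
under eq_bigr => y _.
  rewrite fiberE -[freq_at _ _ * y]addr0 -[trig _ _ _]mulr1 -[_ * 1]mulr1.
  rewrite -[X in _ * X * _](trig_one_coef chiP (0 * y + 0)) -[X in _ * X](trig_one_coef chiP (0 * y + 0)).
  over.
rewrite (trig3_sum chiP) => [|k1 k2 k3 c1 c2 c3].
  by rewrite fcoef_zero !one_coef_zero !mulr1.
have dm k : one_coef (R := R) k != 0 -> k = zero_freq.
  by have [->//|/negPf km] := eqVneq k zero_freq; rewrite /one_coef km eqxx.
rewrite !mulr0 !addr0 => rel; split; [|exact: dm|exact: dm].
apply/eqP; apply/negPn/negP => km; have [i ei] := fcoef_outer c1 km.
have /unrelated : proper i k1 (None, zero_freq, (None, zero_freq)) by rewrite /proper km.
by move: rel; rewrite ei /related /= !mulr0 !addr0 => ->; rewrite eqxx.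
Qed.

Definition lift_f (z : G * Z) : R := f z.1 * fiber z.1 z.2.

(** For a difference that moves in [G] the fibers are independent, so the count of
    progressions is that of [f]. For a difference along the fibers it is governed
    by the sum of cubes of [f], and the weights placed over [X] make it fall below
    [tau]. The price is a larger sum of cubes. *)
Lemma level_lift : coprime #|G| p ->
  level (G := (G * Z)%type) (g, 1) lift_f (setX (U :\: X) setT) al tau
    (w + 3 / 8 * (#|X|%:R / #|G|%:R)).
Proof.
move=> cop; have [ord tor f01 fU [mean cube ap]] := lev.
have N0 : 0 < #|Z|%:R :> R by rewrite ltr0n card_ord.
have G0 : 0 < #|G|%:R :> R by rewrite ltr0n; apply/card_gt0P; exists 0.
have cZ : #|Z| = p by rewrite card_ord Zp_cast.
have cGZ : #|{: (G * Z)%type}| = (#|G| * #|Z|)%N by rewrite card_prod.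
have cGZR : #|{: (G * Z)%type}|%:R = #|G|%:R * #|Z|%:R :> R by rewrite cGZ natrM.
have locX x : x \in X -> exists2 i : I, loc x = Some i & val i = x.
  by move=> xX; case: insubP => [i _ ix|]; [exists i|rewrite xX].
have locnX x : x \notin X -> loc x = None by move=> xX; apply: insubN.
have fX x : x \in X -> f x = 1 / 2 by move=> xX; apply: fU; apply: (subsetP XU).
have sumX (h : G -> R) : \sum_(i : I) h (val i) = \sum_(x in X) h x.
  by rewrite [RHS]big_sub.
have dec (F : G * Z -> R) : \sum_z F z = \sum_x \sum_y F (x, y).
  by rewrite pair_bigA /=; apply: eq_bigr => -[].
split.
- move=> m /(congr1 (fun z => (z.1, z.2))) /=.
  have e1 : ((g, 1 : Z) *+ m).1 = g *+ m by elim: m => // m IH; rewrite !mulrS /= IH.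
  have e2 : ((g, 1 : Z) *+ m).2 = m%:R by elim: m {e1} => // m IH; rewrite !mulrS /= IH.
  rewrite e1 e2 => -[h1 h2]; rewrite cGZ Gauss_dvd ?cZ // ord //=.
  have : nat_of_ord (m%:R : Z) = 0%N by rewrite h2.
  by rewrite val_Zp_nat // => /eqP.
- move=> [d1 d2] [/tor -> /= h2]; congr pair.
  have u2 : (2 : Z) \is a GRing.unit.
    by rewrite unitZpE //; apply: coprime_dvdr p60.
  by apply: (mulrI u2); rewrite mulr0 mulr_natl mulr2n; apply: val_inj.
- move=> [x y]; rewrite /lift_f /=; have [xX|xX] := boolP (x \in X).
    rewrite fX //; have /andP[h0 h2] := fiber_itv x y.
    by rewrite mulr_ge0 ?divr_ge0 //=; lra.
  by rewrite /fiber locnX // mulr1.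
- move=> [x y]; rewrite !inE andbT /= => /andP[xX xU].
  by rewrite /lift_f /fiber /= locnX // mulr1 fU.
split.
- rewrite dec cGZR /lift_f /=.
  under eq_bigr do rewrite -mulr_sumr fiber_sum.
  by rewrite -mulr_suml mean mulrAC.
- rewrite dec cGZR /lift_f /=.
  have pt x : \sum_y (f x * fiber x y) ^+ 3
      <= #|Z|%:R * (f x ^+ 3 + (x \in X)%:R * (3 / 8)).
    have [xX|xX] := boolP (x \in X); last first.
      under eq_bigr do rewrite /fiber locnX // mulr1.
      by rewrite sumr_const mul0r addr0 mulr_natl.
    rewrite fX //; apply: le_trans (_ : \sum_y 1 / 2 * fiber x y <= _).
      apply: ler_sum => y _; have /andP[h0 h2] := fiber_itv x y.
      rewrite -subr_ge0; set a := fiber x y in h0 h2 *.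
      have -> : 1 / 2 * a - (1 / 2 * a) ^+ 3 = 1 / 8 * (a * ((2 - a) * (2 + a))) by field.
      by apply: mulr_ge0; [lra|apply: mulr_ge0 => //; apply: mulr_ge0; lra].
    rewrite -mulr_sumr fiber_sum mulrC ler_pM2l //= mul1r.
    by rewrite le_eqVlt; apply/orP; left; apply/eqP; field.
  apply: le_trans (ler_sum _ (fun x _ => pt x)) _.
  rewrite -mulr_sumr mulrAC -[X in _ <= X]mulrC ler_pM2l //.
  rewrite big_split -mulr_suml /=.
  have -> : \sum_i (i \in X)%:R = #|X|%:R :> R.
    rewrite -sum1_card natr_sum [RHS]big_mkcond; apply: eq_bigr => x _.
    by case: (x \in X).
  rewrite addrA mulrDr; apply: lerD => //.
  by rewrite le_eqVlt; apply/orP; left; apply/eqP; field; rewrite gt_eqF.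
move=> [d1 d2] d0; rewrite dec cGZR /lift_f /=.
have pairE x y : (x, y) + (d1, d2) *+ 2 = (x + d1 *+ 2, y + d2 *+ 2) by rewrite !mulr2n.
have [d10|d1n0] := eqVneq d1 0; last first.
  have dd : d1 *+ 2 != 0 by apply: contra d1n0 => /eqP; rewrite mulr2n => /tor ->.
  have -> : \sum_x \sum_y f x * fiber x y * (f (x + d1) * fiber (x + d1) (y + d2))
        * (f ((x, y) + (d1, d2) *+ 2).1 * fiber ((x, y) + (d1, d2) *+ 2).1 ((x, y) + (d1, d2) *+ 2).2)
      = \sum_x #|Z|%:R * (f x * f (x + d1) * f (x + d1 *+ 2)).
    apply: eq_bigr => x _; rewrite -(@fiber3_sum x (x + d1) (x + d1 *+ 2) d2 (d2 *+ 2)).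
    - by rewrite mulr_suml; apply: eq_bigr => y _; rewrite pairE /=; ring.
    - by rewrite -subr_eq0 opprD addNKr oppr_eq0.
    - by rewrite -subr_eq0 opprD addNKr oppr_eq0.
    - by rewrite (inj_eq (addrI x)) mulr2n -subr_eq0 opprD addNKr oppr_eq0.
  have -> : #|G|%:R * #|Z|%:R * tau = #|Z|%:R * (#|G|%:R * tau) by ring.
  by rewrite -mulr_sumr ler_pM2l // ap.
have d20 : d2 != 0 by apply: contra d0 => /eqP ->; rewrite d10.
have pt x : \sum_y f x * fiber x y * (f (x + d1) * fiber (x + d1) (y + d2))
      * (f (x + (d1 + d1)) * fiber (x + (d1 + d1)) (y + (d2 + d2)))
    = #|Z|%:R * f x ^+ 3 + (if x \in X then
        #|Z|%:R / 8 * (ap_density chi d2 (freq_at xi (loc x)) - 1) else 0).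
  rewrite d10 !addr0.
  have [xX|xX] := boolP (x \in X); last first.
    rewrite addr0; under eq_bigr do rewrite /fiber locnX // !mulr1.
    by rewrite sumr_const -[LHS]mulr_natl !exprS expr0 mulr1 !mulrA.
  have [i ei vi] := locX x xX; rewrite ei /= fX //.
  have -> : #|Z|%:R * (1 / 2) ^+ 3 + #|Z|%:R / 8 * (ap_density chi d2 (xi i) - 1)
      = 1 / 8 * (#|Z|%:R * ap_density chi d2 (xi i)) by field.
  rewrite /ap_density [#|Z|%:R * _]mulrCA divff ?gt_eqF // mulr1 mulr_sumr.
  by apply: eq_bigr => y _; rewrite /fiber ei mulr2n; field.
under eq_bigr do rewrite pt.
rewrite big_split -mulr_sumr -big_mkcond /=.
rewrite -(sumX (fun x => #|Z|%:R / 8 * (ap_density chi d2 (freq_at xi (loc x)) - 1))).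
under [X in _ + X]eq_bigr do rewrite valK /=.
rewrite -mulr_sumr sumrB sumr_const card_sig.
have := few_aps d20; set S := \sum_i _ => hS.
have cX : #|[pred x in X]| = #|X| by apply: eq_card => x; rewrite inE.
have hS2 : S - #|X|%:R <= - (#|X|%:R / 128) by move: hS; lra.
have -> : #|G|%:R * #|Z|%:R * tau = #|Z|%:R * (#|G|%:R * tau) by ring.
rewrite -mulrA -mulrDr ler_pM2l //.
have -> : #|in_mem^~ (mem X)|%:R = #|X|%:R :> R by congr (_%:R); apply: eq_card.
by move: cube X_large; rewrite mulrDr; lra.
Qed.

End LevelStep.

Lemma subset_of_card (T : finType) (U : {set T}) (n : nat) : (n <= #|U|)%N ->
  exists2 X : {set T}, X \subset U & #|X| = n.
Proof.
move=> nU; exists [set x in take n (enum U)].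
  by apply/subsetP => x; rewrite inE => /mem_take; rewrite mem_enum.
rewrite cardsE; have /card_uniqP -> : uniq (take n (enum U)) by rewrite take_uniq ?enum_uniq.
by rewrite size_take -cardE; case: ltngtP nU.
Qed.

Lemma level_step {R : realType} (G : finZmodType) (g : G) (f : G -> R) (U : {set G})
    (al tau w : R) (n p : nat) :
    level g f U al tau w -> (n <= #|U|)%N -> #|G|%:R * w <= n%:R / 1024 ->
    (512 <= p)%N -> coprime p 60 -> coprime #|G| p -> (250 * n.+1 ^ 3 <= p)%N ->
    p%:R * expR (- (n%:R / (512 * 128 ^+ 2))) < 1 / 2 :> R ->
  exists (G' : finZmodType) (g' : G') (f' : G' -> R) (U' : {set G'}),
    [/\ level g' f' U' al tau (w + 3 / 8 * (n%:R / #|G|%:R)),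
        #|G'| = (#|G| * p)%N & #|U'| = ((#|U| - n) * p)%N].
Proof.
move=> lev nU nw p512 p60 Gp np pe.
have p1 : (1 < p)%N by apply: leq_trans p512.
have cZ : #|'Z_p| = p by rewrite card_ord Zp_cast.
have [X XU Xn] := subset_of_card nU.
have [chi chiP] := @faithful_char_exists R p p1.
have cI : #|{: {x : G | x \in X}}| = n.
  by rewrite card_sig -Xn; apply: eq_card.
have := @random_frequencies R p {x : G | x \in X} p1 p60 chi chiP.
rewrite cI cZ => /(_ p512 np pe) [xi [xi1 xi2]].
rewrite -Xn in xi1 nw.
have L := level_lift p1 p60 lev XU chiP xi2 xi1 nw Gp.
exists (G * 'Z_p)%type, (g, 1), (lift_f f chi xi), (setX (U :\: X) setT).
split; first by rewrite -Xn.
  by rewrite card_prod cZ.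
by rewrite cardsX cardsT cZ cardsD (setIidPr XU) Xn.
Qed.

(** Deleting one point kills three progressions of each nonzero difference, whereas
    the cube of the mean [1 - 1 / m] is larger than [1 - 3 / m]. *)
Lemma level_start {R : realType} (m : nat) : (1 < m)%N -> odd m ->
  exists (f : 'Z_m -> R),
    level (1 : 'Z_m) f (~: [set 0]) (1 / 2 * (1 - 1 / m%:R)) (1 / 8 * (1 - 3 / m%:R))
      (1 / 4 * (1 / m%:R)).
Proof.
move=> m1 om; have cm : #|'Z_m| = m by rewrite card_ord Zp_cast.
have m0 : m%:R != 0 :> R by rewrite pnatr_eq0 -lt0n ltnW.
have tor (d : 'Z_m) : d + d = 0 -> d = 0.
  have u2 : (2 : 'Z_m) \is a GRing.unit by rewrite unitZpE // coprimen2.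
  by move=> h; apply: (mulrI u2); rewrite mulr0 mulr_natl mulr2n.
exists (fun x => if x == 0 then 0 else 1 / 2).
have sum_pow (c : R) : \sum_(x : 'Z_m) (if x == 0 then 0 else c) = (m%:R - 1) * c.
  rewrite (bigD1 0) //= add0r (eq_bigr (fun=> c)) => [|x /negPf -> //].
  rewrite sumr_const -[LHS]mulr_natl; congr (_ * _).
  have -> : #|[pred x : 'Z_m | x != 0]| = m.-1 by rewrite cardC1 cm.
  by rewrite -[in RHS](prednK (ltnW m1)) -natr1 addrK.
split=> //.
- by move=> x /(congr1 (@nat_of_ord _)); rewrite val_Zp_nat // cm => /eqP.
- by move=> x; case: ifP; lra.
- by move=> x; rewrite !inE => /negPf ->.
split.
- by rewrite sum_pow cm; field; rewrite m0.
- rewrite (eq_bigr (fun x : 'Z_m => if x == 0 then 0 else (1 / 2) ^+ 3)).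
    by rewrite sum_pow cm le_eqVlt; apply/orP; left; apply/eqP; field; rewrite m0.
  by move=> x _; case: ifP => // _; rewrite expr0n.
move=> d d0; have dd : d + d != 0 by apply: contra d0 => /eqP/tor ->.
apply: le_trans (_ : \sum_(x : 'Z_m) (1 / 8 * (1 - ((x == 0)%:R + ((x == - d)%:R
   + (x == - (d + d))%:R)))) <= _).
  apply: ler_sum => x _; rewrite mulr2n.
  have [->|x0] := eqVneq x 0.
    have e z : z != 0 -> (0 == - z :> 'Z_m) = false.
      by move=> z0; rewrite eq_sym oppr_eq0 (negPf z0).
    by rewrite !e // !mul0r /= !addr0 subrr mulr0.
  have [->|x1] := eqVneq x (- d).
    rewrite addNr eqxx mulr0 mul0r.
    have -> : (- d == - (d + d)) = false.
      by rewrite (inj_eq oppr_inj) -[X in X == _]addr0 (inj_eq (addrI d)) eq_sym (negPf d0).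
    by rewrite add0r addr0 subrr mulr0.
  have [->|x2] := eqVneq x (- (d + d)).
    by rewrite addNr eqxx mulr0 !add0r subrr mulr0.
  rewrite !addr_eq0 (negPf x1) (negPf x2) /= !addr0 subr0.
  by rewrite le_eqVlt; apply/orP; left; apply/eqP; field.
have one (c : 'Z_m) : \sum_(x : 'Z_m) (x == c)%:R = 1 :> R.
  by rewrite (bigD1 c) //= eqxx big1 ?addr0 // => x /negPf ->.
rewrite -mulr_sumr sumrB !big_split /= !one sumr_const cm.
by rewrite le_eqVlt; apply/orP; left; apply/eqP; field; rewrite m0.
Qed.

(** * Random sets of prescribed density *)

Section Sampling.
Context {R : realType} {G : finZmodType} {q : nat}.
Local Notation Om := 'Z_q.
Local Notation T := {ffun G -> Om}.
Hypothesis q_gt1 : (1 < q)%N.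
Let Q0 : 0 < #|Om|%:R :> R. Proof. by rewrite ltr0n card_ord. Qed.

(** The coordinate [a] is independent of any function that does not depend on it. *)
Lemma sum_ffun_indep (a : G) (phi : Om -> R) (H : T -> R) :
    (forall w o, H (w + at_coord a o) = H w) ->
  \sum_(w : T) phi (w a) * H w = (\sum_o phi o) / #|Om|%:R * \sum_(w : T) H w.
Proof.
move=> Ha; rewrite -(sum_resample a) mulr_sumr; apply: eq_bigr => w _.
rewrite /resample; under eq_bigr do rewrite !ffunE eqxx Ha.
have -> : \sum_o phi o = \sum_o phi (w a + o) by rewrite (reindex_inj (addrI (w a))).
by rewrite -mulr_suml mulrAC.
Qed.

Lemma sum_ffun_coord (a : G) (phi : Om -> R) :
  \sum_(w : T) phi (w a) = (\sum_o phi o) / #|Om|%:R * #|{: T}|%:R.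
Proof.
have := sum_ffun_indep (a := a) phi (H := fun=> 1) (fun _ _ => erefl).
by rewrite sumr_const => <-; apply: eq_bigr => w _; rewrite mulr1.
Qed.

Variable f : G -> R.
Hypothesis f01 : forall x, 0 <= f x <= 1.

(** A uniform letter [o] keeps [x] with probability [f x] rounded down to a multiple of
    [1 / #|Om|], which allows counting in place of measures. *)
Definition keep (x : G) (o : Om) : R := ((o : nat).+1%:R <= #|Om|%:R * f x)%R%:R.

Definition sample (w : T) : {set G} := [set x | (w x : nat).+1%:R <= #|Om|%:R * f x].

Definition rounded (x : G) : R := (\sum_(o : Om) keep x o) / #|Om|%:R.

Lemma rounded_itv x : f x - 1 / #|Om|%:R <= rounded x <= f x.
Proof.
have /andP[f0 f1] := f01 x; set y := #|Om|%:R * f x.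
have y0 : 0 <= y by rewrite mulr_ge0 // ltW.
have yQ : y <= #|Om|%:R by rewrite ler_piMr // ltW.
have tQ : (Num.truncn y <= (Zp_trunc q).+2)%N.
  by rewrite -(card_ord (Zp_trunc q).+2) -(ler_nat R); have /andP[h _] := truncn_itv y0; lra.
have -> : rounded x = (Num.truncn y)%:R / #|Om|%:R.
  rewrite /rounded; congr (_ / _); rewrite -[in RHS](card_ord (Num.truncn y)) -sum1_card natr_sum.
  rewrite (big_ord_widen _ (fun=> 1) tQ) [RHS]big_mkcond; apply: eq_bigr => o _.
  by rewrite /keep -/y -(truncn_ge_nat _ y0); case: ifP.
have /andP[h1 h2] := truncn_itv y0; rewrite -natr1 in h2.
rewrite ler_pdivlMr // mulrBl divfK ?gt_eqF // ler_pdivrMr //.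
rewrite [f x * _]mulrC -/y h1 andbT; lra.
Qed.

Lemma rounded_ge0 x : 0 <= rounded x.
Proof. by rewrite divr_ge0 ?ler0n // sumr_ge0 // => o _; rewrite ler0n. Qed.

Lemma keepE (w : T) x : keep x (w x) = (x \in sample w)%:R.
Proof. by rewrite inE. Qed.

Lemma at_coord_other (w : T) a o x : x != a -> (w + at_coord a o) x = w x.
Proof. by move=> xa; rewrite !ffunE (negPf xa) addr0. Qed.

Definition aps_count (d : G) (w : T) : R :=
  \sum_x keep x (w x) * keep (x + d) (w (x + d)) * keep (x + d *+ 2) (w (x + d *+ 2)).

Lemma aps_countE d (w : T) : aps_count d w = #|aps (sample w) d|%:R.
Proof.
rewrite -sum1_card natr_sum [RHS]big_mkcond; apply: eq_bigr => x _.
rewrite !keepE !inE.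
by do 3 case: (_ <= _); rewrite /= ?mulr0 ?mul0r ?mulr1.
Qed.

Lemma sum_aps_count d : d != 0 -> d + d != 0 ->
  \sum_(w : T) aps_count d w
    = #|{: T}|%:R * \sum_x rounded x * rounded (x + d) * rounded (x + d *+ 2).
Proof.
move=> d0 dd; rewrite exchange_big mulr_sumr /=; apply: eq_bigr => x _.
have x1 : x + d != x by rewrite -subr_eq0 addrAC subrr add0r.
have x2 : x + d *+ 2 != x by rewrite -subr_eq0 addrAC subrr add0r mulr2n.
have x3 : x + d *+ 2 != x + d by rewrite (inj_eq (addrI x)) mulr2n -subr_eq0 addrK.
under eq_bigr do rewrite -mulrA.
rewrite (sum_ffun_indep (keep x)
   (H := fun w => keep (x + d) (w (x + d)) * keep (x + d *+ 2) (w (x + d *+ 2)))); last first.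
  by move=> w o; rewrite !at_coord_other.
rewrite (sum_ffun_indep (keep (x + d))
   (H := fun w => keep (x + d *+ 2) (w (x + d *+ 2)))); last first.
  by move=> w o; rewrite !at_coord_other.
by rewrite (sum_ffun_coord _ (keep (x + d *+ 2))) -!/(rounded _); ring.
Qed.

Lemma keep01 x o : 0 <= keep x o <= 1.
Proof. by rewrite /keep ler0n lern1 leq_b1. Qed.

Lemma prod3_lipschitz (a b c a' b' c' : R) :
    0 <= a <= 1 -> 0 <= b <= 1 -> 0 <= c <= 1 ->
    0 <= a' <= 1 -> 0 <= b' <= 1 -> 0 <= c' <= 1 ->
  `|a * b * c - a' * b' * c'| <= `|a - a'| + `|b - b'| + `|c - c'|.
Proof.
move=> /andP[a0 a1] /andP[b0 b1] /andP[c0 c1] /andP[a0' a1'] /andP[b0' b1'] /andP[c0' c1'].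
have -> : a * b * c - a' * b' * c'
  = (a - a') * (b * c) + a' * c * (b - b') + a' * b' * (c - c') by ring.
apply: le_trans (ler_normD _ _) _; apply: lerD.
  apply: le_trans (ler_normD _ _) _; rewrite !normrM.
  apply: lerD; [rewrite ler_piMr // mulr_ile1 //|rewrite ler_piMl // mulr_ile1 //];
  by rewrite ger0_norm.
rewrite !normrM ler_piMl // mulr_ile1 //; by rewrite ger0_norm.
Qed.

(** A coordinate enters three progressions of difference [d], once as each term. *)
Lemma aps_count_bounded_diff d : bounded_diff 3 (aps_count d).
Proof.
move=> w i o; rewrite /aps_count -sumrB; apply: le_trans (ler_norm_sum _ _ _) _.
pose e (x : G) : R := (x == i)%:R.
have near x : `|keep x ((w + at_coord i o) x) - keep x (w x)| <= e x.
  rewrite /e; have [->|xi] := eqVneq x i; last by rewrite at_coord_other // subrr normr0.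
  have /andP[k0 k1] := keep01 i ((w + at_coord i o) i).
  by have /andP[l0 l1] := keep01 i (w i); rewrite ler_norml /=; lra.
have one (c : G) : \sum_x e (x + c) = 1.
  transitivity (\sum_x e x); first by rewrite [RHS](reindex_inj (addIr c)).
  by rewrite /e (bigD1 i) //= eqxx big1 ?addr0 // => x /negPf ->.
have -> : 3 = \sum_x (e (x + 0) + e (x + d) + e (x + d *+ 2)).
  by rewrite !big_split /= !one; ring.
apply: ler_sum => x _; apply: le_trans (prod3_lipschitz _ _ _ _ _ _) _; rewrite ?keep01 //.
by rewrite addr0 !lerD.
Qed.

Lemma sample_size_bounded_diff : bounded_diff 3 (fun w : T => - #|sample w|%:R : R).
Proof.
have E (w : T) : #|sample w|%:R = \sum_x keep x (w x).
  by rewrite -sum1_card natr_sum big_mkcond; apply: eq_bigr => x _; rewrite keepE; case: (x \in _).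
move=> w i o; rewrite !E -opprD normrN -sumrB (bigD1 i) //= big1 => [|x xi].
  have /andP[k0 k1] := keep01 i ((w + at_coord i o) i).
  by have /andP[l0 l1] := keep01 i (w i); rewrite addr0 ler_norml /=; lra.
by rewrite at_coord_other // subrr.
Qed.

Lemma sum_sample_size :
  \sum_(w : T) #|sample w|%:R = #|{: T}|%:R * \sum_x rounded x :> R.
Proof.
transitivity (\sum_(w : T) \sum_x keep x (w x)).
  apply: eq_bigr => w _; rewrite -sum1_card natr_sum big_mkcond.
  by apply: eq_bigr => x _; rewrite keepE; case: (x \in _).
rewrite exchange_big mulr_sumr /=; apply: eq_bigr => x _.
by rewrite (sum_ffun_coord _ (keep x)) mulrC.
Qed.

End Sampling.

(** The number of events is only [#|G|], one for each difference and one, indexed by the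
    difference zero, for the size of the sample. *)
Lemma sample_exists {R : realType} (G : finZmodType) (g : G) (f : G -> R) (U : {set G})
    (al tau w delta : R) :
    level g f U al tau w -> 0 < delta -> delta <= 1 ->
    #|G|%:R * expR (- (delta ^+ 2 * #|G|%:R / 288)) < 1 ->
  exists A : {set G}, #|G|%:R * (al - delta) <= #|A|%:R /\
    forall d, d != 0 -> #|aps A d|%:R <= #|G|%:R * (tau + delta).
Proof.
move=> [_ tor f01 _ [mean _ ap]] d0 d1 small.
(* The rounding error 1 / q is at most delta / 2. *)
pose q := (Num.truncn (2 / delta)).+2.
have cq : #|'Z_q| = q by rewrite card_ord.
have q1 : (1 < q)%N by [].
have qd : 1 / #|'Z_q|%:R <= delta / 2.
  have h0 : 0 <= 2 / delta by rewrite divr_ge0 // ltW.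
  have /andP[_ h] := truncn_itv h0; rewrite ltr_pdivrMr // in h.
  rewrite cq ler_pdivrMr ?ltr0n // mulrAC ler_pdivlMr // mul1r mulrC; apply: ltW.
  apply: lt_le_trans h _; rewrite ler_pM2r // ler_nat /q; lia.
pose T := {ffun G -> 'Z_q}.
have T0 : 0 < #|{: T}|%:R :> R by rewrite ltr0n; apply/card_gt0P; exists 0.
have G0 : 0 < #|G|%:R :> R by rewrite ltr0n; apply/card_gt0P; exists 0.
set n : R := #|G|%:R in G0 small *.
pose t : R := n * delta / 2.
pose F (d : G) (w : T) : R := if d == 0 then - #|sample f w|%:R else aps_count f d w.
pose mu (d : G) : R := if d == 0 then - (n * (al - delta / 2)) else n * tau.
have Fbd d : bounded_diff 3 (F d).
  rewrite /F; case: eqP => _; [exact: sample_size_bounded_diff|exact: aps_count_bounded_diff].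
have Fmu d : \sum_(w : T) F d w <= #|{: T}|%:R * mu d.
  rewrite /F /mu; have [_|dn0] := eqVneq d 0.
    rewrite sumrN (sum_sample_size f) mulrN lerN2 ler_pM2l //.
    rewrite mulrBr -mean [n * _]mulr_natl -sumr_const -sumrB; apply: ler_sum => x _.
    by have /andP[h _] := rounded_itv (q := q) f01 x; lra.
  have dd : d + d != 0 by apply: contra dn0 => /eqP/tor ->.
  rewrite (sum_aps_count f) // ler_pM2l //; apply: le_trans (ap d dn0).
  apply: ler_sum => x _.
  have r0 y := rounded_ge0 (q := q) f y.
  have rf y : rounded (q := q) f y <= f y by have /andP[] := rounded_itv (q := q) f01 y.
  by rewrite !ler_pM // mulr_ge0.
(* This value minimises 18 lam^2 - lam delta / 2. *)
pose lam : R := delta / 72.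
have lam0 : 0 <= lam by rewrite divr_ge0 // ltW.
have lc : lam * 3 <= 1 / 2 by rewrite /lam; lra.
pose bad d := [set w : T | mu d + t <= F d w].
have badc d : #|bad d|%:R <= #|{: T}|%:R * expR (- (delta ^+ 2 * n / 288)).
  have := bounded_diff_tail t (Fbd d) lam0 lc (Fmu d).
  by congr (_ <= _ * expR _); rewrite -/n /lam /t; field.
have [om wbad] : exists om, om \notin \bigcup_d bad d.
  suff lt : (#|\bigcup_d bad d| < #|{: T}|)%N.
    apply/existsP; rewrite -negb_forall; apply: contraL lt => /forallP h.
    by rewrite -leqNgt -cardsT; apply/subset_leq_card/subsetP => v _; apply: h.
  rewrite -(ltr_nat R).
  have h : #|\bigcup_d bad d|%:R <= \sum_d #|bad d|%:R :> R.
    by rewrite -natr_sum ler_nat card_bigcup_le.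
  apply: le_lt_trans h _; apply: le_lt_trans (ler_sum _ (fun d _ => badc d)) _.
  rewrite sumr_const -[X in X < _]mulr_natl mulrCA -[X in _ < X]mulr1 ltr_pM2l //.
have good d : F d om < mu d + t.
  rewrite ltNge; apply/negP => h; move/bigcupP: wbad; apply; exists d => //; by rewrite inE.
exists (sample f om); split=> [|d dn0].
  have := good 0; rewrite /F /mu eqxx /t; lra.
have := good d; rewrite /F /mu (negPf dn0) /t (aps_countE f) => /ltW h.
apply: le_trans h _; rewrite -/n; have : 0 <= n * delta by rewrite mulr_ge0 // ltW.
lra.
Qed.

(** * From a cyclic group to an interval *)

Lemma mem_3AP (A : {fset int}) (d x : int) :
  (x \in [fset x in A | ((x + d)%R \in A) && ((x + 2 * d)%R \in A)]%fset)
    = [&& x \in A, x + d \in A & x + 2 * d \in A].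
Proof. by rewrite !inE. Qed.

Section IntegerTransfer.
Context {R : realType} {G : finZmodType}.
Variables (g : G) (A : {set G}).
Hypothesis ord : forall x : nat, g *+ x = 0 -> (#|G| %| x)%N.

Let M0 : (0 < #|G|)%N. Proof. by apply/card_gt0P; exists 0. Qed.

Lemma mulrz_eq0_dvd (z : int) : g *~ z = 0 -> (#|G| %| `|z|)%N.
Proof.
case: (intP z) => [|k|k]; first by rewrite dvdn0.
  by rewrite -pmulrn => /ord.
by rewrite mulrNz -pmulrn => /eqP; rewrite oppr_eq0 abszN => /eqP/ord.
Qed.

Definition int_set : {fset int} :=
  [fset x in [seq (i.+1)%:Z | i <- iota 0 #|G|] | g *~ x \in A]%fset.

Lemma int_setP x : x \in int_set -> 1 <= x <= #|G|%:Z /\ g *~ x \in A.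
Proof.
rewrite !inE => /andP[/mapP[i + ->] xA]; rewrite mem_iota add0n => /andP[_ iM].
by split=> //; lia.
Qed.

Lemma mulrz_inj (x y : int) : 1 <= x <= #|G|%:Z -> 1 <= y <= #|G|%:Z ->
  g *~ x = g *~ y -> x = y.
Proof.
move=> hx hy e; have /mulrz_eq0_dvd : g *~ (x - y) = 0 by rewrite mulrzBr e subrr.
move=> /dvdnP[k hk]; have : (k * #|G| < #|G|)%N by rewrite -hk; lia.
by case: k hk => [|k] hk; [lia|rewrite mulSn ltnNge leq_addr].
Qed.

Lemma card_int_set : (#|A| <= #|` int_set|)%N.
Proof.
pose h (i : 'I_#|G|) : G := g *~ (i.+1)%:Z.
have hinj : injective h.
  move=> i j e; apply: val_inj; have il := ltn_ord i; have jl := ltn_ord j.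
  have : (i.+1)%:Z = (j.+1)%:Z by apply: mulrz_inj e; lia.
  by case.
have hsurj x : exists i, x = h i.
  have : x \in h @: setT.
    suff -> : h @: setT = setT by rewrite inE.
    apply/eqP; rewrite eqEcard subsetT /= card_imset // !cardsT card_ord //.
  by case/imsetP => i _ ->; exists i.
rewrite cardE -(size_map (fun x : int => g *~ x) int_set); apply: uniq_leq_size.
  exact: enum_uniq.
move=> x; rewrite mem_enum => xA; have [i xi] := hsurj x.
apply/mapP; exists (i.+1)%:Z => //; rewrite !inE.
apply/andP; split; last by rewrite -[g *~ _]/(h i) -xi.
by apply/mapP; exists (i : nat) => //; rewrite mem_iota add0n ltn_ord.
Qed.

Lemma num_3AP_le (d : int) : d != 0 ->
  (num_3AP int_set d <= if (g *~ d == 0)%R then 0 else #|aps A (g *~ d)%R|)%N.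
Proof.
move=> d0; case: eqP => [/mulrz_eq0_dvd gd|gd].
  rewrite leqn0 cardfs_eq0; apply/eqP/fsetP => x; rewrite mem_3AP in_fset0.
  apply/negbTE/negP => /and3P[xA xd _].
  have [h1 _] := int_setP xA; have [h2 _] := int_setP xd.
  by have : (#|G| <= `|d|)%N by [apply: dvdn_leq gd; lia]; lia.
rewrite /num_3AP cardE -[X in (X <= _)%N](size_map (fun x : int => g *~ x)).
apply: uniq_leq_size.
  rewrite map_inj_in_uniq ?fset_uniq // => x y xI yI.
  have := mem_3AP int_set d x; rewrite xI => /esym/andP[xA _].
  have := mem_3AP int_set d y; rewrite yI => /esym/andP[yA _].
  by apply: mulrz_inj; [case: (int_setP xA)|case: (int_setP yA)].
move=> _ /mapP[x + ->]; rewrite mem_enum mem_3AP [_ \in aps _ _]inE.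
move=> /and3P[xA xdA x2dA].
have [_ h1] := int_setP xA; have [_ h2] := int_setP xdA; have [_ h3] := int_setP x2dA.
rewrite h1 /=; move: h2 h3; rewrite !mulrzDr => -> /=.
by rewrite mulrC mulrzA.
Qed.

(** For sets of integers in an interval of length [#|G|], a nonzero difference killed by
    [g] is a multiple of [#|G|], too long for any progression; every other difference
    has no more progressions than its image in [G]. *)
Lemma not_popular (eps : R) (N0 : nat) :
    (forall d, d != 0 -> #|aps A d|%:R < ((#|A|%:R / #|G|%:R) ^+ 3 - eps) * #|G|%:R) ->
    (1 < #|G|)%N -> (N0 <= #|G|)%N ->
  ~ popular_difference_from eps N0.
Proof.
move=> few G1 NG pop.
have M1 : 0 < #|G|%:R :> R by rewrite ltr0n.
have [|d [d0]] := pop #|G| NG int_set; first by move=> x /int_setP[].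
apply/negP; rewrite -ltNge; apply: lt_le_trans (_ : ((#|A|%:R / #|G|%:R) ^+ 3 - eps) * #|G|%:R <= _).
  have : (num_3AP int_set d)%:R <= (if g *~ d == 0 then 0%N else #|aps A (g *~ d)|)%:R :> R.
    by rewrite ler_nat; apply: num_3AP_le.
  move=> h; apply: le_lt_trans h _.
  have [_|gd] := eqVneq (g *~ d) 0; last exact: few.
  have [a an0] : exists a : G, a != 0.
    move: G1; rewrite (cardD1 (0 : G)) ltnS => /card_gt0P[a]; rewrite !inE andbT.
    by exists a.
  by apply: le_lt_trans (few a an0).
rewrite ler_pM2r // lerD2r lerXn2r ?nnegrE ?divr_ge0 // ler_pM2r ?invr_gt0 // ler_nat.
exact: card_int_set.
Qed.

End IntegerTransfer.

(** * Iteration and the lower bound *)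

(** From [y <= (e + 1) 2 ^ (y %/ (e + 1))] follows
    [y ^ (e + 1) <= (e + 1) ^ (e + 1) 2 ^ y], and one factor [y] is spare. *)
Lemma pow_le_exp2 (C e : nat) : exists y0 : nat,
  forall y, (y0 <= y)%N -> (C * y ^ e <= 2 ^ y)%N.
Proof.
have key : forall y, (y ^ e.+1 <= e.+1 ^ e.+1 * 2 ^ y)%N.
  move=> y; have h : (y <= e.+1 * 2 ^ (y %/ e.+1))%N.
    apply: leq_trans (_ : e.+1 * (y %/ e.+1).+1 <= _)%N; last by rewrite leq_mul2l ltn_expl.
    by rewrite mulnC ltnW // ltn_ceil.
  apply: leq_trans (_ : (e.+1 * 2 ^ (y %/ e.+1)) ^ e.+1 <= _)%N; first by rewrite leq_exp2r.
  by rewrite expnMn leq_mul2l -expnM leq_exp2l // leq_trunc_div orbT.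
exists (C * e.+1 ^ e.+1).+1 => y hy; have y0 : (0 < y)%N by apply: leq_trans hy.
rewrite -(leq_pmul2l y0) mulnCA -expnS.
apply: leq_trans (_ : C * (e.+1 ^ e.+1 * 2 ^ y) <= _)%N; first by rewrite leq_mul2l key orbT.
by rewrite mulnA leq_mul2r ltnW ?orbT.
Qed.

Lemma levelW {R : realType} (G : finZmodType) (g : G) (f : G -> R) (U : {set G})
    (al tau w w' : R) : w <= w' -> level g f U al tau w -> level g f U al tau w'.
Proof.
move=> ww [o t f01 fU [m c a]]; split=> //; split=> //; apply: le_trans c _.
by rewrite ler_wpM2l // lerD2l.
Qed.

(** The modulus is below [2 ^ (6 + 2 y)], while [n] is so large that the exponential
    is below [2 ^ (- 8 y)]. *)
Lemma exp_small {R : realType} (y L n p : nat) :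
    (2 <= y)%N -> (L <= y)%N -> p = (60 * L * 2 ^ y + 1)%N -> (2 ^ 26 * y%:R <= n%:R :> R) ->
  p%:R * expR (- (n%:R / (512 * 128 ^+ 2))) < 1 / 2 :> R.
Proof.
move=> y2 Ly pE nD.
have e1 : expR (- (n%:R / (512 * 128 ^+ 2))) <= (2 ^- (8 * y)) :> R.
  have c0 : 0 < 512 * 128 ^+ 2 :> R by rewrite mulr_gt0 // exprn_gt0.
  rewrite expRN lef_pV2 ?posrE ?expR_gt0 ?exprn_gt0 //.
  apply: le_trans (_ : expR ((8 * y)%N%:R * 1) <= _); last first.
    rewrite ler_expR mulr1 ler_pdivlMr // natrM; apply: le_trans nD.
    by rewrite le_eqVlt; apply/orP; left; apply/eqP; ring.
  rewrite expRM_natl lerXn2r ?nnegrE ?expR_ge0 //; have := expR_ge1Dx (1 : R); lra.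
have p1 : (p <= 2 ^ (6 + 2 * y))%N.
  have Ly2 : (L <= 2 ^ y)%N by apply: leq_trans Ly (ltnW (ltn_expl _ _)).
  have y1 : (0 < 2 ^ y)%N by rewrite expn_gt0.
  have e6 : (2 ^ 6 = 64)%N by [].
  rewrite pE expnD mul2n -addnn expnD e6; move: (2 ^ y)%N Ly2 y1 => z; nia.
apply: le_lt_trans (_ : 2 ^+ (6 + 2 * y) * 2 ^- (8 * y) < _).
  by apply: ler_pM; rewrite ?expR_ge0 ?ler0n // -natrX ler_nat.
rewrite ltr_pdivrMr ?exprn_gt0 //.
have -> : (8 * y = (7 + 2 * y) + (6 * y - 7))%N by lia.
set z := (6 * y - 7)%N; rewrite [X in _ < _ * X]exprD mulrA.
have -> : 1 / 2 * 2 ^+ (7 + 2 * y) = 2 ^+ (6 + 2 * y) :> R by rewrite -[(7 + _)%N]/(6 + 2 * y).+1 exprS; field.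
have z1 : (0 < z)%N by rewrite /z; lia.
by rewrite ltr_pMr ?exprn_gt0 // exprn_egt1 ?ltr1n // -lt0n.
Qed.

Lemma leq_sub_double (a c : nat) : (a - 729 * c <= a - c - c)%N.
Proof. by rewrite -subnDA leq_sub2l // addnn -mul2n leq_mul2r orbT. Qed.

Lemma cube_stable {R : realFieldType} (a r delta : R) :
    1 / 3 <= a -> a <= 1 -> 0 <= delta -> delta <= 1 / 3 -> a - delta <= r ->
  a ^+ 3 - 3 * delta <= r ^+ 3.
Proof.
move=> a0 a1 d0 d1 ar; apply: le_trans (_ : (a - delta) ^+ 3 <= _); last first.
  by rewrite lerXn2r ?nnegrE //; lra.
rewrite -subr_ge0.
have -> : (a - delta) ^+ 3 - (a ^+ 3 - 3 * delta)
  = 3 * delta * (1 - a) * (1 + a) + delta ^+ 2 * (3 * a - delta) by ring.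
apply: addr_ge0; last by rewrite mulr_ge0 ?sqr_ge0 //; lra.
by rewrite mulr_ge0 ?mulr_ge0 //; lra.
Qed.

Lemma start_gap {R : realFieldType} (m : R) : 3 <= m ->
  1 / 8 * (1 - 3 / m) + 16 * (1 / (64 * m ^+ 2)) <= (1 / 2 * (1 - 1 / m)) ^+ 3.
Proof.
move=> m3; have mn0 : m != 0 by rewrite gt_eqF //; lra.
have m0 : 0 < m by lra.
have im : m^-1 <= 1 by rewrite invf_le1 //; lra.
rewrite -subr_ge0.
have -> : (1 / 2 * (1 - 1 / m)) ^+ 3 - (1 / 8 * (1 - 3 / m) + 16 * (1 / (64 * m ^+ 2)))
  = 1 / 8 * (m^-1) ^+ 2 * (1 - m^-1) by field; rewrite mn0.
by rewrite mulr_ge0 ?subr_ge0 // mulr_ge0 ?sqr_ge0 // divr_ge0.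
Qed.

Lemma start_mean_itv {R : realFieldType} (m : R) : 3 <= m ->
  1 / 3 <= 1 / 2 * (1 - 1 / m) <= 1.
Proof.
move=> m3; have m0 : 0 < m by lra.
have im0 : 0 <= m^-1 by rewrite invr_ge0 ltW.
have im : m^-1 <= 1 / 3 by rewrite mul1r lef_pV2 ?posrE //.
by apply/andP; split; lra.
Qed.

(** Of the gap of sixteen [delta], sampling costs three in the density and one in the
    count, which leaves room for eight more. *)
Lemma gap_suffices {R : realFieldType} (tau a r eps delta : R) : 0 < delta ->
    64 * delta <= 1 -> 1 / 3 <= a <= 1 -> tau + 16 * delta <= a ^+ 3 ->
    a - delta <= r -> eps <= 8 * delta ->
  tau + delta < r ^+ 3 - eps.
Proof.
move=> d0 d64 /andP[a0 a1] gain ar e8.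
have d3 : delta <= 1 / 3 by lra.
have := cube_stable a0 a1 (ltW d0) d3 ar; lra.
Qed.

(** The exponential of [x = M / K] exceeds [x^2 / 2], which is at least [2 M]. *)
Lemma expR_quotient_gt {R : realType} (K M : R) : 0 < K -> 4 * K ^+ 2 <= M ->
  M * expR (- (M / K)) < 1.
Proof.
move=> K0 big; have M0 : 0 < M by apply: lt_le_trans big; rewrite mulr_gt0 // exprn_gt0.
rewrite expRN ltr_pdivrMr ?expR_gt0 // mul1r.
have x0 : 0 <= M / K by rewrite divr_ge0 // ltW.
have := expR_ge1Dxn 1 x0; apply: lt_le_trans.
have h : 2 * M <= (M / K) ^+ 2 / 2.
  rewrite expr_div_n ler_pdivlMr // ler_pdivlMr ?exprn_gt0 //.
  have -> : 2 * M * 2 * K ^+ 2 = M * (4 * K ^+ 2) by ring.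
  by rewrite [X in _ <= X]expr2 ler_pM2l.
have -> : (1.+1)`!%:R = 2 :> R by [].
lra.
Qed.

Section Chain.
Context {R : realType}.
Variables (e b s : nat).
Hypothesis e26 : (26 <= e)%N.
Hypothesis b_gt1 : (1 < b)%N.
Hypothesis rel_room : forall y, (3 ^ b <= y)%N -> (250 * (3 ^ e * y).+1 ^ 3 <= 2 ^ y)%N.

(** Stage [j] modifies the share [stage_size j / m] of the positions. Its decrease must
    outweigh the excess of the sum of cubes accumulated before, which the stage
    multiplies by at most [385]; the ratio [729] of successive stages is larger.
    Powers of three keep [m] odd and prime to the moduli. *)
Definition stage_size (j : nat) : nat := (3 ^ (e + b + 6 * j))%N.
Definition stage_exp (j : nat) : nat := (3 ^ (b + 6 * j))%N.
Let m := stage_size s.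

Definition alpha0 : R := 1 / 2 * (1 - 1 / m%:R).
Definition tau0 : R := 1 / 8 * (1 - 3 / m%:R).

Lemma stage_size_gt0 j : (0 < stage_size j)%N. Proof. by rewrite expn_gt0. Qed.
Lemma stage_size_ge3 j : (3 <= stage_size j)%N.
Proof. by apply: leq_trans (_ : 3 ^ 1 <= _)%N => //; rewrite leq_exp2l //; lia. Qed.
Lemma stage_sizeS j : stage_size j.+1 = (729 * stage_size j)%N.
Proof. by rewrite /stage_size mulnS addnCA expnD. Qed.
Lemma stage_sizeE j : stage_size j = (3 ^ e * stage_exp j)%N.
Proof. by rewrite /stage_size /stage_exp -addnA expnD. Qed.

(** The modulus of stage [j] is [60 L 2 ^ y + 1] with [y = stage_exp j * L], which is
    prime to [60], to [L] and to [m], and exponential in the number of modified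
    positions. The exponent [e] makes this number exceed [2 ^ 26 y], as the
    concentration requires. *)
Lemma chain (j : nat) : (j <= s)%N ->
  exists (G : finZmodType) (g : G) (f : G -> R) (U : {set G}) (L : nat),
    [/\ level g f U alpha0 tau0 ((stage_size j)%:R / (1024 * m%:R)), #|G| = (m * L)%N,
        ((m - stage_size j) * L <= #|U|)%N, (tower j <= L)%N &
        (0 < j)%N -> (2 ^ stage_exp j.-1 <= L)%N].
Proof.
have m0 : 0 < m%:R :> R by rewrite ltr0n stage_size_gt0.
have mn0 : m%:R != 0 :> R by rewrite gt_eqF.
have m1 : (1 < m)%N by rewrite -[1%N]/(3 ^ 0)%N ltn_exp2l //; lia.
elim: j => [_|j IH js].
  have om : odd m by rewrite /m /stage_size oddX orbT.
  have [f lev] := @level_start R m m1 om.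
  have cm : #|'Z_m| = m by rewrite card_ord Zp_cast.
  exists 'Z_m, 1, f, (~: [set 0]), 1%N; split=> //.
  - apply: levelW lev.
    have -> : (stage_size 0)%:R / (1024 * m%:R) = (stage_size 0)%:R / 1024 * (1 / m%:R) :> R.
      by field; rewrite mn0.
    rewrite ler_pM2r ?divr_gt0 // ler_pdivlMr //.
    have : 256 <= (stage_size 0)%:R :> R.
      rewrite ler_nat; apply: leq_trans (_ : 3 ^ 6 <= _)%N => //.
      by rewrite leq_exp2l //; lia.
    lra.
  - by rewrite cm muln1.
  - by rewrite muln1 cardsC1 cm; have := stage_size_gt0 0; lia.
have [G [g [f [U [L [lev cG cU tL _]]]]]] := IH (ltnW js).
have L0 : (0 < L)%N.
  by apply: leq_trans tL; case: (j) => //= i; rewrite expn_gt0.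
have qm : (729 * stage_size j <= m)%N by rewrite -stage_sizeS leq_exp2l //; lia.
set n := (stage_size j * L)%N; set y := (stage_exp j * L)%N; set p := (60 * L * 2 ^ y + 1)%N.
have nE : n = (3 ^ e * y)%N by rewrite /n stage_sizeE mulnA.
have by' : (3 ^ b <= y)%N.
  by rewrite -[X in (X <= _)%N]muln1 leq_mul // leq_exp2l // leq_addr.
have y9 : (9 <= y)%N.
  by apply: leq_trans by'; rewrite -[9%N]/(3 ^ 2)%N leq_exp2l.
have yp : (2 ^ y <= p)%N.
  by rewrite /p addn1 leqW // leq_pmull // muln_gt0 L0.
have nU : (n <= #|U|)%N.
  by apply: leq_trans cU; rewrite /n leq_mul2r; apply/orP; right; lia.
have G0 : #|G|%:R = m%:R * L%:R :> R by rewrite cG natrM.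
have Ln0 : L%:R != 0 :> R by rewrite pnatr_eq0 -lt0n.
have nw : #|G|%:R * ((stage_size j)%:R / (1024 * m%:R)) <= n%:R / 1024 :> R.
  by rewrite G0 /n natrM le_eqVlt; apply/orP; left; apply/eqP; field; rewrite mn0.
have p512 : (512 <= p)%N.
  by apply: leq_trans yp; rewrite -[512%N]/(2 ^ 9)%N leq_exp2l.
have cop k : (k %| 60 * L * 2 ^ y)%N -> coprime k p.
  by move=> kd; rewrite /p addn1; apply: coprime_dvdl kd (coprimenS _).
have p60 : coprime p 60 by rewrite coprime_sym cop // -mulnA dvdn_mulr.
have Gp : coprime #|G| p.
  rewrite cG coprimeMl; apply/andP; split; last by rewrite cop // mulnAC dvdn_mull.
  by rewrite coprimeXl // cop // -mulnA dvdn_mulr.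
have np : (250 * n.+1 ^ 3 <= p)%N by rewrite nE; apply: leq_trans (rel_room by') yp.
have nD : 2 ^ 26 * y%:R <= n%:R :> R.
  rewrite nE natrM ler_wpM2r //.
  rewrite -[(2 : R) ^ 26]/(2 ^+ 26) natrX; apply: le_trans (_ : 3 ^+ 26 <= _).
    by rewrite lerXn2r ?nnegrE // ler_nat.
  by rewrite ler_eXn2l // ltr1n.
have Ly : (L <= y)%N by rewrite leq_pmull // expn_gt0.
have pe := exp_small (ltnW (ltnW (ltnW (ltnW (ltnW (ltnW (ltnW y9))))))) Ly (erefl p) nD.
have [G' [g' [f' [U' [lev' cG' cU']]]]] := level_step lev nU nw p512 p60 Gp np pe.
exists G', g', f', U', (L * p)%N; split.
- apply: levelW lev'; rewrite G0 /n natrM stage_sizeS natrM.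
  have -> : (stage_size j)%:R / (1024 * m%:R) + 3 / 8 * ((stage_size j)%:R * L%:R / (m%:R * L%:R))
     = 385 * ((stage_size j)%:R / (1024 * m%:R)) :> R by field; rewrite mn0 Ln0.
  by rewrite -mulrA ler_wpM2r ?divr_ge0 ?mulr_ge0 // ler_nat.
- by rewrite cG' cG mulnA.
- rewrite cU' mulnA leq_mul2r; apply/orP; right.
  apply: leq_trans (leq_sub2r n cU); rewrite /n -mulnBl leq_mul2r; apply/orP; right.
  by rewrite stage_sizeS leq_sub_double.
- rewrite /=; apply: leq_trans (_ : 2 ^ y <= _)%N.
    by rewrite leq_exp2l //; apply: leq_trans tL Ly.
  by apply: leq_trans yp _; rewrite leq_pmull.
- move=> _ /=; apply: leq_trans (_ : 2 ^ y <= _)%N.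
    by rewrite leq_exp2l // leq_pmulr.
  by apply: leq_trans yp _; rewrite leq_pmull.
Qed.

Hypothesis s_gt0 : (0 < s)%N.
Hypothesis sample_room : forall y, (3 ^ b <= y)%N ->
  (4 * (288 * 64 ^ 2) ^ 2 * (3 ^ e * 729 * y) ^ 8 <= 2 ^ y)%N.

(** After [s] stages the order of the group is exponential in [m], far more than the
    power of [m] that sampling with precision [delta] requires. *)
Lemma bad_length : exists2 M : nat, (tower s <= M)%N &
  forall (eps : R) (N0 : nat), 0 < eps -> eps <= 1 / (8 * m%:R ^+ 2) -> (N0 <= M)%N ->
    ~ popular_difference_from eps N0.
Proof.
have [G [g [f [U [L [lev cG _ tL rL]]]]]] := chain (leqnn s).
have m0 : (0 < m)%N := stage_size_gt0 s.
have mR : 1 <= m%:R :> R by rewrite ler1n.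
have mn0 : m%:R != 0 :> R by rewrite gt_eqF // (lt_le_trans ltr01).
exists #|G|; first by rewrite cG; apply: leq_trans tL _; rewrite leq_pmull.
move=> eps N0 eps0 epsm NG.
pose K : R := 288 * 64 ^+ 2 * m%:R ^+ 4.
have K0 : 0 < K by rewrite !mulr_gt0 ?exprn_gt0 // (lt_le_trans ltr01).
have big : 4 * K ^+ 2 <= #|G|%:R.
  have mE : m = (3 ^ e * 729 * stage_exp s.-1)%N by rewrite /m -(prednK s_gt0) stage_sizeS stage_sizeE mulnCA mulnA.
  have /sample_room : (3 ^ b <= stage_exp s.-1)%N by rewrite leq_exp2l // leq_addr.
  rewrite -mE => h; have h2 := leq_trans h (rL s_gt0).
  have KE (k : nat) : 4 * (288 * 64 ^+ 2 * k%:R ^+ 4) ^+ 2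
      = (4 * (288 * 64 ^ 2) ^ 2 * k ^ 8)%N%:R :> R.
    by rewrite !(natrM, natrX); ring.
  rewrite /K KE ler_nat cG; apply: leq_trans h2 _; by rewrite leq_pmull.
have G0 : 0 < #|G|%:R :> R by apply: lt_le_trans big; rewrite mulr_gt0 // exprn_gt0.
pose delta : R := 1 / (64 * m%:R ^+ 2).
have m2 : 1 <= m%:R ^+ 2 :> R by rewrite exprn_ege1.
have d0 : 0 < delta by rewrite divr_gt0 // mulr_gt0 // exprn_gt0 // (lt_le_trans ltr01).
have d64 : 64 * delta <= 1.
  have -> : 64 * delta = (m%:R ^+ 2)^-1 by rewrite /delta; field; rewrite mn0.
  by rewrite invf_le1 // (lt_le_trans ltr01).
have small : #|G|%:R * expR (- (delta ^+ 2 * #|G|%:R / 288)) < 1.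
  have -> : delta ^+ 2 * #|G|%:R / 288 = #|G|%:R / K by rewrite /delta /K; field; rewrite mn0.
  exact: expR_quotient_gt.
have d1 : delta <= 1.
  by apply: le_trans d64; rewrite ler_peMl ?ler1n // ltW.
have [A [A1 A2]] := sample_exists lev d0 d1 small.
have [ord _ _ _ _] := lev.
apply: (not_popular ord (A := A)) NG => [d dn0|]; last first.
  rewrite -(ltr_nat R); apply: lt_le_trans big.
  have K1 : 1 <= K.
    by rewrite /K -[X in X <= _]mul1r ler_pM ?exprn_ege1 // mulr_ege1 ?exprn_ege1 // ler1n.
  by apply: lt_le_trans (_ : 4 * 1 <= _); [rewrite mulr1 ltr1n|rewrite ler_pM2l ?exprn_ege1].
apply: le_lt_trans (A2 d dn0) _; rewrite mulrC ltr_pM2r //.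
set dens := #|A|%:R / #|G|%:R.
have dens1 : alpha0 - delta <= dens by rewrite ler_pdivlMr // mulrC.
have m3 : 3 <= m%:R :> R by rewrite ler_nat stage_size_ge3.
apply: (gap_suffices d0 d64 (start_mean_itv m3) (start_gap m3) dens1).
apply: le_trans epsm _; rewrite le_eqVlt; apply/orP; left; apply/eqP.
by rewrite /delta; field; rewrite mn0.
Qed.

End Chain.

(** The number of stages is chosen with [m ^ 2] of the order of [1 / eps], so it is
    proportional to [ln (1 / eps)]. *)
Lemma lower_bound {R : realType} : exists2 c : R, 0 < c &
  forall eps : R, 0 < eps -> eps < 1 / 2 ->
  forall N0, (0 < N0)%N -> popular_difference_from eps N0 ->
    (towerR (c * ln (1 / eps)) <= N0)%N.
Proof.
(* The value is hidden so that powers of three are never evaluated. *)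
have [e e26] : exists e, (26 <= e)%N by exists 26%N.
set D := (3 ^ e)%N.
have [y1 hy1] := pow_le_exp2 (250 * (D.+1) ^ 3) 3.
have [y2 hy2] := pow_le_exp2 (4 * (288 * 64 ^ 2) ^ 2 * (D * 729) ^ 8) 8.
pose b := (y1 + y2 + 2)%N.
have bb : (b <= 3 ^ b)%N by apply: ltnW; apply: ltn_expl.
have rel y : (3 ^ b <= y)%N -> (250 * (3 ^ e * y).+1 ^ 3 <= 2 ^ y)%N.
  move=> h; have hy : (b <= y)%N by apply: leq_trans bb h.
  apply: leq_trans (hy1 y _); last by apply: leq_trans hy; rewrite /b -addnA leq_addr.
  rewrite -mulnA leq_mul2l -expnMn leq_exp2r // -/D mulSn -[X in (X <= _)%N]add1n leq_add2r.
  by apply: leq_trans hy; rewrite /b addn2.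
have smp y : (3 ^ b <= y)%N ->
    (4 * (288 * 64 ^ 2) ^ 2 * (3 ^ e * 729 * y) ^ 8 <= 2 ^ y)%N.
  move=> h; have hy : (b <= y)%N by apply: leq_trans bb h.
  apply: leq_trans (hy2 y _); last first.
    by apply: leq_trans hy; rewrite /b addnAC leq_addl.
  by rewrite -/D [((D * 729 * y) ^ 8)%N]expnMn mulnA.
have b2 : (1 < b)%N by rewrite /b addn2.
pose B : R := 8 * (3 ^+ (e + b)) ^+ 2 * 3 ^+ 12.
have B1 : 1 < B.
  have h k : 1 <= 3 ^+ k :> R by rewrite exprn_ege1 // ler1n.
  apply: lt_le_trans (_ : 8 * 1 * 1 <= _); first by lra.
  apply: ler_pM; rewrite ?h //; first by lra.
  by rewrite ler_pM2l // exprn_ege1.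
have lnB : 0 < ln B by rewrite ln_gt0.
exists (1 / ln B); first by rewrite divr_gt0.
move=> eps eps0 eps2 N0 N00 pop.
set x := ln (1 / eps); rewrite /towerR; set s := Num.truncn _.
have i0 : 0 < 1 / eps by rewrite divr_gt0.
have i2 : 1 <= 1 / eps by rewrite ler_pdivlMr // mul1r; lra.
have x0 : 0 <= 1 / ln B * x by rewrite mulr_ge0 ?divr_ge0 ?ln_ge0 // ltW.
have [s0|s0] := posnP s; first by rewrite s0.
have [M tM notpop] := bad_length (R := R) e26 b2 rel s0 smp.
apply: leq_trans tM _; rewrite leqNgt; apply/negP => NM.
apply: (notpop eps N0 eps0 _ (ltnW NM) pop).
have sx : s%:R * ln B <= x.
  have /andP[h _] := truncn_itv x0.
  by rewrite -/s mulrAC mul1r ler_pdivlMr in h.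
have Bs : B ^+ s <= 1 / eps.
  have Bp : 0 < B by apply: lt_trans B1.
  rewrite -ler_ln ?posrE ?exprn_gt0 // lnXn // -/x -mulr_natl; exact: sx.
have mB : 8 * (stage_size e b s)%:R ^+ 2 <= B ^+ s.
  have mE : (stage_size e b s)%:R = 3 ^+ (e + b) * (3 ^+ 6) ^+ s :> R by rewrite /stage_size natrX exprD exprM.
  have B12 : B = 8 * (3 ^+ (e + b)) ^+ 2 * (3 ^+ 6) ^+ 2 by rewrite /B; congr (_ * _); rewrite -exprM.
  rewrite mE B12; set u : R := 3 ^+ (e + b); set v : R := 3 ^+ 6.
  have u1 : 1 <= 8 * u ^+ 2 by rewrite mulr_ege1 ?exprn_ege1 ?ler1n.
  have -> : 8 * (u * v ^+ s) ^+ 2 = (8 * u ^+ 2) * (v ^+ 2) ^+ s.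
    by rewrite exprMn mulrA [(v ^+ s) ^+ 2]exprAC.
  rewrite [X in _ <= X]exprMn ler_wpM2r ?exprn_ge0 //.
  by rewrite -[X in X <= _]expr1 ler_weXn2l.
rewrite ler_pdivlMr; last first.
  by rewrite mulr_gt0 // exprn_gt0 // ltr0n stage_size_gt0.
have := le_trans mB Bs; rewrite ler_pdivlMr // => h.
by rewrite mulrC.
Qed.

(** * The theorem *)

Lemma tower_gt0 n : (0 < tower n)%N.
Proof. by case: n => //= n; rewrite expn_gt0. Qed.

Theorem theorem1p2 (R : realType) :
  exists c C : R,
    [/\ 0 < c, 0 < C &
      forall eps : R, 0 < eps -> eps < 1 / 2 ->
      exists N0 : nat,
        is_N0 eps N0 /\
        (towerR (c * ln (1 / eps)) <= N0 <= towerR (C * ln (1 / eps)))%N].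
Proof.
have [c c0 low] := @lower_bound R; have [C C0 upp] := @upper_bound R.
exists c, C; split=> // eps eps0 eps2.
pose good n := (0 < n)%N && `[< popular_difference_from eps n >].
have ex : exists n, good n.
  exists (towerR (C * ln (1 / eps))); rewrite /good tower_gt0 /=.
  by apply/asboolP; apply: upp.
case: (ex_minnP ex) => N0 /andP[N00 /asboolP pop] minN0.
have min M : (0 < M)%N -> popular_difference_from eps M -> (N0 <= M)%N.
  by move=> M0 popM; apply: minN0; rewrite /good M0; apply/asboolP.
exists N0; split; first by split.
by rewrite (low eps) //= min ?tower_gt0 //; apply: upp.
Qed.
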